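(* Let $\mathcal Z=\bigoplus_{n\ge 0}\mathcal Z(\mathcal H_n)$ be the direct sum of the centers of the Hecke algebras $\mathcal H_n$ over $\mathbb C(v)$, endowed with the product $\circ$ given by $z_1\circ z_2=\mathcal N_{(m,n)}(z_1\otimes z_2)$ for $z_1\in\mathcal Z(\mathcal H_m)$, $z_2\in\mathcal Z(\mathcal H_n)$. Then the algebra $(\mathcal Z,\circ)$ is commutative, associative, and is isomorphic to a polynomial algebra (over $\mathbb C(v)$) with generators $\mathcal N_n(1)$, for $n\ge 1$.
   Context: Hecke algebra: $\mathfrak S_n$ is the symmetric group on $n$ letters with simple transpositions $s_i=(i,i+1)$ and length function $\ell$; $v$ is an indeterminate. $\mathcal H_n$ is the unital $\mathbb C(v)$-algebra generated by $T_1,\dots,T_{n-1}$ with relations $(T_k-v)(T_k+1)=0$, $T_kT_{k+1}T_k=T_{k+1}T_kT_{k+1}$, $T_kT_l=T_lT_k$ for $|k-l|>1$ ($\mathcal H_0=\mathbb C(v)$). For a reduced expression $w=s_{i_1}\cdots s_{i_r}$ put $T_w=T_{i_1}\cdots T_{i_r}$; $\{T_w\}_{w\in\mathfrak S_n}$ is a $\mathbb C(v)$-basis of $\mathcal H_n$. $\mathcal Z(\mathcal H_n)$ denotes the center of $\mathcal H_n$. Relative norm: for a composition $\alpha=(\alpha_1,\dots,\alpha_\ell)$ of $n$, $\mathfrak S_\alpha\subseteq\mathfrak S_n$ is the Young subgroup, and $\mathcal H_\alpha\cong\mathcal H_{\alpha_1}\otimes\cdots\otimes\mathcal H_{\alpha_\ell}$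 is its Hecke algebra, identified with the subalgebra of $\mathcal H_n$ generated by the $T_i$, $1\le i\le n-1$, $i\ne\alpha_1,\alpha_1+\alpha_2,\dots,\alpha_1+\cdots+\alpha_{\ell-1}$. $\mathcal D_\alpha$ is the set of minimal length representatives of the cosets $w\mathfrak S_\alpha$ in $\mathfrak S_n$. For $h\in\mathcal H_\alpha$, $$\mathcal N_\alpha(h)=\sum_{w\in\mathcal D_\alpha}v^{-\ell(w)}T_w\,h\,T_{w^{-1}}\in\mathcal H_n.$$ It is known (Jones) that $\mathcal N_\alpha(h)\in\mathcal Z(\mathcal H_n)$ if $h$ is central in $\mathcal H_\alpha$. In the product $\circ$, $z_1\otimes z_2$ is viewed in $\mathcal H_m\otimes\mathcal H_n\cong\mathcal H_{(m,n)}\subseteq\mathcal H_{m+n}$, and $\circ$ is extended bilinearly to $\mathcal Z$. For the one-part composition $(n)$ one writes $\mathcal N_n$ for $\mathcal N_{(n)}$; thus $\mathcal N_n(1)$ is the identity of $\mathcal H_n$ regarded as an element of the degree $n$ summand of $\mathcal Z$. *)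

(* Defs.v *)
From HB Require Import structures.
From mathcomp Require Import all_boot all_order all_algebra all_fingroup.
From mathcomp Require Import generic_quotient.
From mathcomp Require Import boolp classical_sets reals.
From mathcomp Require Import complex fraction.
From mathcomp Require Import monalg.

Set Implicit Arguments.
Unset Strict Implicit.
Unset Printing Implicit Defensive.

Import GRing.Theory.

Local Open Scope ring_scope.
Local Open Scope quotient_scope.

(* Generators of S_n and of H_n are indexed from 0: [i : 'I_n.-1] stands for  *)
(* s_{i+1} = (i+1, i+2) and T_{i+1}, the letters 1, ..., n being 0, ..., n-1. *)

Section FreeAlgebra.
Variables (K : fieldType) (I : choiceType).
Local Notation F := {malg K[{fmonom I}]}.

Definition fvar (i : I) : F := << fmu i >>.

Lemma fscalerAr (c : K) (x y : F) : c *: (x * y) = x * (c *: y).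
Proof.
have comC (z : F) : z * (mkmalgU (mone : {fmonom I}) c : F) = c *: z.
  rewrite -mul_malgC !malgM_def fgmulgU fgmulUg.
  by apply: eq_bigr => m _; rewrite mulrC mulm1 mul1m.
by rewrite -!comC mulrA.
Qed.

Section Eval.
Variables (B : algType K) (f : I -> B).

Definition feval_mon (m : {fmonom I}) : B := \prod_(i <- m) f i.

Lemma feval_mon_mmorphism : mmorphism feval_mon.
Proof.
by split=> [x y|]; rewrite /feval_mon ?fmM ?big_cat // fm1 big_nil.
Qed.

HB.instance Definition _ :=
  isMultiplicative.Build _ _ feval_mon feval_mon_mmorphism.

Definition feval (g : F) : B := mmap (in_alg B) feval_mon g.

Lemma feval_is_zmod_morphism : zmod_morphism feval.
Proof. exact: (raddfB (mmap (in_alg B) feval_mon)). Qed.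

HB.instance Definition _ := GRing.isZmodMorphism.Build F B feval
  feval_is_zmod_morphism.

Lemma feval_is_monoid_morphism : monoid_morphism feval.
Proof.
have [h1 h2] := @commr_mmap_is_multiplicative _ _ _ (in_alg B) feval_mon
  (fun _ _ _ => comm_alg _ _).
by split.
Qed.

HB.instance Definition _ := GRing.isMonoidMorphism.Build F B feval
  feval_is_monoid_morphism.

Lemma feval_is_scalable : scalable feval.
Proof. by move=> c g; rewrite /feval mmapZ mulr_algl. Qed.

HB.instance Definition _ := GRing.isScalable.Build K F B *:%R feval
  feval_is_scalable.

Lemma feval_var i : feval (fvar i) = f i.
Proof. by rewrite /feval mmapU /= scale1r mul1r /feval_mon fmU big_seq1. Qed.

End Eval.
End FreeAlgebra.

Section RelatorMorphism.
Variables (K : fieldType) (A : lalgType K) (B : lalgType K).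
Variable g : {lrmorphism A -> B}.

Lemma morph_quadratic c x : g ((x - c%:A) * (x + 1)) = (g x - c%:A) * (g x + 1).
Proof. by rewrite rmorphM rmorphB rmorphD /= !rmorph1 [in LHS]linearZ /= rmorph1. Qed.

Lemma morph_braid x y :
  g (x * y * x - y * x * y) = g x * g y * g x - g y * g x * g y.
Proof. by rewrite rmorphB !rmorphM. Qed.

Lemma morph_commute x y : g (x * y - y * x) = g x * g y - g y * g x.
Proof. by rewrite rmorphB !rmorphM. Qed.

End RelatorMorphism.

Section HeckePresentation.
Variables (K : fieldType) (v : K) (n : nat).

Local Notation F := {malg K[{fmonom 'I_n.-1}]}.
Local Notation t := (@fvar K 'I_n.-1).

Inductive hecke_relator : F -> Prop :=
| hecke_quadratic (k : 'I_n.-1) :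
    hecke_relator ((t k - v%:A) * (t k + 1))
| hecke_braid (k l : 'I_n.-1) : l = k.+1 :> nat ->
    hecke_relator (t k * t l * t k - t l * t k * t l)
| hecke_commute (k l : 'I_n.-1) : (k.+1 < l)%N || (l.+1 < k)%N ->
    hecke_relator (t k * t l - t l * t k).

Inductive hecke_ideal : F -> Prop :=
| hecke_ideal_relator r : hecke_relator r -> hecke_ideal r
| hecke_ideal0 : hecke_ideal 0
| hecke_idealD x y : hecke_ideal x -> hecke_ideal y -> hecke_ideal (x + y)
| hecke_idealMl a x : hecke_ideal x -> hecke_ideal (a * x)
| hecke_idealMr x a : hecke_ideal x -> hecke_ideal (x * a).

Lemma hecke_idealN x : hecke_ideal x -> hecke_ideal (- x).
Proof. by move=> Ix; rewrite -mulN1r; apply: hecke_idealMl. Qed.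

Definition hecke_eqv (x y : F) : bool := `[< hecke_ideal (x - y) >].

Lemma hecke_eqv_refl : reflexive hecke_eqv.
Proof. by move=> x; apply/asboolP; rewrite subrr; apply: hecke_ideal0. Qed.

Lemma hecke_eqv_sym : symmetric hecke_eqv.
Proof.
by move=> x y; apply/asboolP/asboolP => /hecke_idealN; rewrite opprB.
Qed.

Lemma hecke_eqv_trans : transitive hecke_eqv.
Proof.
move=> y x z /asboolP Ixy /asboolP Iyz; apply/asboolP.
by rewrite -(subrK y x) -addrA; apply: hecke_idealD.
Qed.

Canonical hecke_eqv_equiv :=
  EquivRel hecke_eqv hecke_eqv_refl hecke_eqv_sym hecke_eqv_trans.

Definition hecke := {eq_quot hecke_eqv}.
HB.instance Definition _ := Choice.on hecke.
HB.instance Definition _ := EqQuotient.on hecke.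

Definition hecke_pi (x : F) : hecke := \pi_hecke x.

Lemma hecke_piP x y : hecke_pi x = hecke_pi y <-> hecke_ideal (x - y).
Proof.
by split=> [/eqquotP/asboolP|Ixy] //; apply/eqquotP/asboolP.
Qed.

Lemma hecke_pi_surj (z : hecke) : exists x, z = hecke_pi x.
Proof. by exists (repr z); rewrite /hecke_pi reprK. Qed.

Lemma hecke_reprP x : hecke_ideal (repr (hecke_pi x) - x).
Proof. by apply/hecke_piP; rewrite /hecke_pi reprK. Qed.

Definition hecke_add (x y : hecke) := hecke_pi (repr x + repr y).
Definition hecke_opp (x : hecke) := hecke_pi (- repr x).
Definition hecke_mul (x y : hecke) := hecke_pi (repr x * repr y).
Definition hecke_scale (c : K) (x : hecke) := hecke_pi (c *: repr x).

Lemma hecke_pi_add x y :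
  hecke_add (hecke_pi x) (hecke_pi y) = hecke_pi (x + y).
Proof.
apply/hecke_piP; rewrite opprD addrACA.
by apply: hecke_idealD; apply: hecke_reprP.
Qed.

Lemma hecke_pi_opp x : hecke_opp (hecke_pi x) = hecke_pi (- x).
Proof. by apply/hecke_piP; rewrite -opprD; apply/hecke_idealN/hecke_reprP. Qed.

Lemma hecke_pi_mul x y :
  hecke_mul (hecke_pi x) (hecke_pi y) = hecke_pi (x * y).
Proof.
rewrite /hecke_mul; apply/hecke_piP; move: (hecke_reprP x) (hecke_reprP y).
 move: (repr (hecke_pi x)) (repr (hecke_pi y)) => a b Ia Ib.
rewrite (_ : a * b - x * y = (a - x) * b + x * (b - y)); last first.
  by rewrite mulrBl mulrBr addrA subrK.
by apply: hecke_idealD; [apply: hecke_idealMr | apply: hecke_idealMl].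
Qed.

Lemma hecke_pi_scale c x : hecke_scale c (hecke_pi x) = hecke_pi (c *: x).
Proof.
apply/hecke_piP; rewrite -scalerBr -mulr_algl.
exact/hecke_idealMl/hecke_reprP.
Qed.

Definition hecke_piE :=
  (hecke_pi_add, hecke_pi_opp, hecke_pi_mul, hecke_pi_scale).

Lemma hecke_addA : associative hecke_add.
Proof.
move=> x y z; have [a ->] := hecke_pi_surj x; have [b ->] := hecke_pi_surj y.
by have [c ->] := hecke_pi_surj z; rewrite !hecke_piE addrA.
Qed.

Lemma hecke_addC : commutative hecke_add.
Proof.
move=> x y; have [a ->] := hecke_pi_surj x; have [b ->] := hecke_pi_surj y.
by rewrite !hecke_piE addrC.
Qed.

Lemma hecke_add0 : left_id (hecke_pi 0) hecke_add.
Proof.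
by move=> x; have [a ->] := hecke_pi_surj x; rewrite !hecke_piE add0r.
Qed.

Lemma hecke_addN : left_inverse (hecke_pi 0) hecke_opp hecke_add.
Proof.
by move=> x; have [a ->] := hecke_pi_surj x; rewrite !hecke_piE addNr.
Qed.

HB.instance Definition _ := GRing.isZmodule.Build hecke
  hecke_addA hecke_addC hecke_add0 hecke_addN.

Lemma hecke_mulA : associative hecke_mul.
Proof.
move=> x y z; have [a ->] := hecke_pi_surj x; have [b ->] := hecke_pi_surj y.
by have [c ->] := hecke_pi_surj z; rewrite !hecke_piE mulrA.
Qed.

Lemma hecke_mul1 : left_id (hecke_pi 1) hecke_mul.
Proof.
by move=> x; have [a ->] := hecke_pi_surj x; rewrite !hecke_piE mul1r.
Qed.

Lemma hecke_mulr1 : right_id (hecke_pi 1) hecke_mul.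
Proof.
by move=> x; have [a ->] := hecke_pi_surj x; rewrite !hecke_piE mulr1.
Qed.

Lemma hecke_mulDl : left_distributive hecke_mul +%R.
Proof.
move=> x y z; have [a ->] := hecke_pi_surj x; have [b ->] := hecke_pi_surj y.
have [c ->] := hecke_pi_surj z.
by rewrite /GRing.add /= !hecke_piE mulrDl.
Qed.

Lemma hecke_mulDr : right_distributive hecke_mul +%R.
Proof.
move=> x y z; have [a ->] := hecke_pi_surj x; have [b ->] := hecke_pi_surj y.
have [c ->] := hecke_pi_surj z.
by rewrite /GRing.add /= !hecke_piE mulrDr.
Qed.

Definition hecke_rels (B : algType K) (f : 'I_n.-1 -> B) :=
  [/\ forall k, (f k - v%:A) * (f k + 1) = 0,
      forall k l : 'I_n.-1, l = k.+1 :> nat ->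
        f k * f l * f k = f l * f k * f l
    & forall k l : 'I_n.-1, (k.+1 < l)%N || (l.+1 < k)%N ->
        f k * f l = f l * f k].

Lemma hecke_ideal_feval (B : algType K) (f : 'I_n.-1 -> B) x :
  hecke_rels f -> hecke_ideal x -> feval f x = 0.
Proof.
case=> quad braid comm Ix; elim: Ix=> {x} [r [k|k l lk|k l kl]||x y _ Ix _ Iy|a x _ Ix|x a _ Ix].
- by rewrite (morph_quadratic (feval f)) /= feval_var quad.
- by rewrite (morph_braid (feval f)) /= !feval_var braid // subrr.
- by rewrite (morph_commute (feval f)) /= !feval_var comm // subrr.
- exact: rmorph0.
- by rewrite rmorphD /= Ix Iy addr0.
- by rewrite rmorphM /= Ix mulr0.
- by rewrite rmorphM /= Ix mul0r.
Qed.

(* The index representation T_k |-> v shows that 1 <> 0 in H_n. *)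
Lemma hecke_rels_index : hecke_rels (fun=> v : K^o).
Proof.
by split=> // k; rewrite /GRing.scale /= mulr1 subrr mul0r.
Qed.

Lemma hecke_1neq0 : hecke_pi 1 != 0 :> hecke.
Proof.
apply/eqP => /hecke_piP /(hecke_ideal_feval hecke_rels_index) /eqP.
by rewrite subr0 rmorph1 oner_eq0.
Qed.

HB.instance Definition _ := GRing.Zmodule_isNzRing.Build hecke
  hecke_mulA hecke_mul1 hecke_mulr1 hecke_mulDl hecke_mulDr hecke_1neq0.

Lemma hecke_scaleA a b x :
  hecke_scale a (hecke_scale b x) = hecke_scale (a * b) x.
Proof.
by have [y ->] := hecke_pi_surj x; rewrite !hecke_piE scalerA.
Qed.

Lemma hecke_scale1 : left_id 1 hecke_scale.
Proof.
by move=> x; have [y ->] := hecke_pi_surj x; rewrite !hecke_piE scale1r.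
Qed.

Lemma hecke_scaleDr : right_distributive hecke_scale +%R.
Proof.
move=> a x y; have [b ->] := hecke_pi_surj x; have [c ->] := hecke_pi_surj y.
by rewrite /GRing.add /= !hecke_piE scalerDr.
Qed.

Lemma hecke_scaleDl x : {morph hecke_scale^~ x : a b / a + b}.
Proof.
move=> a b; have [y ->] := hecke_pi_surj x.
by rewrite [in RHS]/GRing.add /= !hecke_piE scalerDl.
Qed.

HB.instance Definition _ := GRing.Zmodule_isLmodule.Build K hecke
  hecke_scaleA hecke_scale1 hecke_scaleDr hecke_scaleDl.

Lemma hecke_scaleAl (a : K) (x y : hecke) : a *: (x * y) = (a *: x) * y.
Proof.
have [b ->] := hecke_pi_surj x; have [c ->] := hecke_pi_surj y.
by rewrite /GRing.scale /GRing.mul /= !hecke_piE scalerAl.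
Qed.

HB.instance Definition _ := GRing.Lmodule_isLalgebra.Build K hecke
  hecke_scaleAl.

Lemma hecke_scaleAr (a : K) (x y : hecke) : a *: (x * y) = x * (a *: y).
Proof.
have [b ->] := hecke_pi_surj x; have [c ->] := hecke_pi_surj y.
by rewrite /GRing.scale /GRing.mul /= !hecke_piE fscalerAr.
Qed.

HB.instance Definition _ := GRing.Lalgebra_isAlgebra.Build K hecke
  hecke_scaleAr.

Lemma hecke_pi_is_zmod_morphism : zmod_morphism hecke_pi.
Proof.
by move=> x y; rewrite /GRing.add /GRing.opp /= !hecke_piE.
Qed.

HB.instance Definition _ := GRing.isZmodMorphism.Build F hecke hecke_pi
  hecke_pi_is_zmod_morphism.

Lemma hecke_pi_is_monoid_morphism : monoid_morphism hecke_pi.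
Proof. by split=> [|x y]; last by rewrite [in RHS]/GRing.mul /= hecke_piE. Qed.

HB.instance Definition _ := GRing.isMonoidMorphism.Build F hecke hecke_pi
  hecke_pi_is_monoid_morphism.

Lemma hecke_pi_is_scalable : scalable hecke_pi.
Proof. by move=> c x; rewrite [in RHS]/GRing.scale /= hecke_piE. Qed.

HB.instance Definition _ := GRing.isScalable.Build K F hecke *:%R hecke_pi
  hecke_pi_is_scalable.

(* [heckeT i] is T_{i+1}; the value 1 for [i >= n.-1] is a placeholder. *)
Definition heckeT (i : nat) : hecke :=
  if insub i is Some k then hecke_pi (t k) else 1.

Lemma heckeTE (k : 'I_n.-1) : heckeT k = hecke_pi (t k).
Proof. by rewrite /heckeT valK. Qed.

Lemma hecke_pi_relator x : hecke_relator x -> hecke_pi x = 0.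
Proof.
move=> rx; rewrite -[RHS](rmorph0 hecke_pi); apply/hecke_piP.
by rewrite subr0; apply: hecke_ideal_relator.
Qed.

Lemma hecke_rels_T : hecke_rels (fun k : 'I_n.-1 => heckeT k).
Proof.
split=> [k|k l lk|k l kl]; rewrite !heckeTE.
- rewrite -(morph_quadratic hecke_pi).
  exact: (hecke_pi_relator (hecke_quadratic k)).
- apply/eqP; rewrite -subr_eq0 -(morph_braid hecke_pi); apply/eqP.
  exact: (hecke_pi_relator (hecke_braid lk)).
- apply/eqP; rewrite -subr_eq0 -(morph_commute hecke_pi); apply/eqP.
  exact: (hecke_pi_relator (hecke_commute kl)).
Qed.

Lemma heckeT_quadratic i : (i < n.-1)%N ->
  (heckeT i - v%:A) * (heckeT i + 1) = 0.
Proof. by move=> lti; have [/(_ (Ordinal lti))] := hecke_rels_T. Qed.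

Lemma heckeT_braid i : (i.+1 < n.-1)%N ->
  heckeT i * heckeT i.+1 * heckeT i = heckeT i.+1 * heckeT i * heckeT i.+1.
Proof.
move=> lti; have [_ braid _] := hecke_rels_T.
exact: (braid (Ordinal (ltnW lti)) (Ordinal lti)).
Qed.

Lemma heckeT_commute i j : (i < n.-1)%N -> (j < n.-1)%N ->
  (i.+1 < j)%N || (j.+1 < i)%N -> heckeT i * heckeT j = heckeT j * heckeT i.
Proof.
move=> lti ltj; have [_ _ comm] := hecke_rels_T.
exact: (comm (Ordinal lti) (Ordinal ltj)).
Qed.

(* Universal property: the map H_n -> B with T_{k+1} |-> f k. It evaluates a  *)
(* chosen representative, hence is meaningful only if f satisfies the         *)
(* relations [hecke_rels]; see hecke_lift_pi.                                 *)
Section Lift.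
Variables (B : algType K) (f : 'I_n.-1 -> B).

Definition hecke_lift (x : hecke) : B := feval f (repr x).

Hypothesis relf : hecke_rels f.

Lemma hecke_lift_pi x : hecke_lift (hecke_pi x) = feval f x.
Proof.
apply/eqP; rewrite -subr_eq0 -rmorphB; apply/eqP.
exact/hecke_ideal_feval/hecke_reprP.
Qed.

Lemma hecke_liftD : {morph hecke_lift : x y / x + y}.
Proof.
move=> x y; have [a ->] := hecke_pi_surj x; have [b ->] := hecke_pi_surj y.
by rewrite -rmorphD !hecke_lift_pi rmorphD.
Qed.

Lemma hecke_liftM : {morph hecke_lift : x y / x * y}.
Proof.
move=> x y; have [a ->] := hecke_pi_surj x; have [b ->] := hecke_pi_surj y.
by rewrite -rmorphM !hecke_lift_pi rmorphM.
Qed.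

Lemma hecke_liftZ c : {morph hecke_lift : x / c *: x}.
Proof.
move=> x; have [a ->] := hecke_pi_surj x.
by rewrite -linearZ !hecke_lift_pi linearZ.
Qed.

Lemma hecke_lift0 : hecke_lift 0 = 0.
Proof. by rewrite -[0]/(hecke_pi 0) hecke_lift_pi rmorph0. Qed.

Lemma hecke_lift1 : hecke_lift 1 = 1.
Proof. by rewrite -[1]/(hecke_pi 1) hecke_lift_pi rmorph1. Qed.

Lemma hecke_liftT (k : 'I_n.-1) : hecke_lift (heckeT k) = f k.
Proof. by rewrite heckeTE hecke_lift_pi feval_var. Qed.

End Lift.

Definition hecke_center : {pred hecke} :=
  [pred z | `[< forall h, z * h = h * z >]].

End HeckePresentation.

Arguments hecke_center {K v n}.

(* The embedding H_m -> H_k, T_i |-> T_{a+i}, intended for a + m <= k. *)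
Definition hecke_emb (K : fieldType) (v : K) (k a m : nat) :
    hecke v m -> hecke v k :=
  hecke_lift (fun i : 'I_m.-1 => heckeT v k (a + i)).

Lemma hecke_emb_rels (K : fieldType) (v : K) (k a m : nat) :
  (a + m <= k)%N -> hecke_rels v (fun i : 'I_m.-1 => heckeT v k (a + i)).
Proof.
move=> le_k.
have lt_k (i : 'I_m.-1) : (a + i < k.-1)%N.
  case: i => i /= lti; case: m lti le_k => [|[|m]] //= lti le_k.
  by rewrite ltn_predRL (leq_trans _ le_k) // -!addnS leq_add2l !ltnS.
split=> [i|i j ji|i j ij]; first exact/heckeT_quadratic/lt_k.
- by have:= lt_k j; rewrite ji addnS; apply: heckeT_braid.
- by apply: heckeT_commute => //; rewrite -!addnS !leq_add2l.
Qed.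

Section Symmetric.
Variable n : nat.
Local Open Scope group_scope.

Fact adj_lt (i : 'I_n.-1) : (i.+1 < n)%N.
Proof. by case: i => i /= lti; rewrite -ltn_predRL. Qed.

Definition adj_tperm (i : 'I_n.-1) : 'S_n :=
  tperm (Ordinal (ltnW (adj_lt i))) (Ordinal (adj_lt i)).

Definition word_perm (s : seq 'I_n.-1) : 'S_n := \prod_(i <- s) adj_tperm i.

Definition reduced_expr (w : 'S_n) (s : seq 'I_n.-1) : Prop :=
  word_perm s = w /\ forall s', word_perm s' = w -> (size s <= size s')%N.

(* A chosen reduced expression; by Matsumoto's theorem, T_w (hecke_Tw below)  *)
(* does not depend on the choice.                                             *)
Definition red_word (w : 'S_n) : seq 'I_n.-1 := xget [::] (reduced_expr w).

Definition perm_length (w : 'S_n) : nat := size (red_word w).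

Lemma word_permE (w : 'S_n) : exists s, word_perm s = w.
Proof.
pose G (w' : 'S_n) := exists s, word_perm s = w'.
have GM x y : G x -> G y -> G (x * y).
  by move=> [s <-] [s' <-]; exists (s ++ s'); rewrite /word_perm big_cat.
have Gadj i : G (adj_tperm i) by exists [:: i]; rewrite /word_perm big_seq1.
have G1 : G 1 by exists [::]; rewrite /word_perm big_nil.
have Gt d : forall i j : 'I_n, j = (i + d.+1)%N :> nat -> G (tperm i j).
  elim: d => [|d IHd] i j ji.
    have lti : (i < n.-1)%N by have:= ltn_ord j; rewrite ji addn1 ltn_predRL.
    suff -> : tperm i j = adj_tperm (Ordinal lti) by [].
    by congr (tperm _ _); apply: val_inj => //=; rewrite ji addn1.
  have lti : (i < n.-1)%N.
    rewrite ltn_predRL (leq_trans _ (ltn_ord j)) // ji ltnS.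
    by rewrite -addn1 leq_add2l.
  pose i' := Ordinal (adj_lt (Ordinal lti)).
  have nij : i != j by rewrite -val_eqE /= ji -{1}[val i]addn0 eqn_add2l.
  have ni'j : i' != j.
    by rewrite -val_eqE /= ji -addn1 eqn_add2l.
  have := IHd i' j; rewrite /= ji addSnnS => /(_ erefl) Gi'.
  have -> : tperm i j = tperm i' j ^ adj_tperm (Ordinal lti).
    rewrite tpermJ; congr (tperm _ _).
      rewrite /adj_tperm -/i' tpermR; exact: val_inj.
    by rewrite tpermD.
  by rewrite conjgE tpermV; exact: (GM _ _ (Gadj _) (GM _ _ Gi' (Gadj _))).
have Gtp (i j : 'I_n) : G (tperm i j).
  have [lt_ij|lt_ji|/val_inj ->] := ltngtP i j; last by rewrite tperm1.
    by apply: (Gt (j - i).-1); rewrite prednK ?subn_gt0 // subnKC // ltnW.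
  rewrite tpermC.
  by apply: (Gt (i - j).-1); rewrite prednK ?subn_gt0 // subnKC // ltnW.
suff: G w by [].
have [ts -> _] := prod_tpermP w.
by elim/big_ind: _.
Qed.

Lemma red_wordP (w : 'S_n) : reduced_expr w (red_word w).
Proof.
apply: (@xgetPex _ _ (reduced_expr w)).
have [s sw] := word_permE w.
pose P k := `[< exists s, word_perm s = w /\ size s = k >].
have exP : exists k, P k by exists (size s); apply/asboolP; exists s.
case: (ex_minnP exP) => k /asboolP [s0 [s0w s0k]] mink.
exists s0; split=> // s' s'w; rewrite s0k; apply: mink.
by apply/asboolP; exists s'.
Qed.

(* For a composition al of n, reshape_index al x is the index of the block of *)
(* consecutive letters, of size a part of al, that contains x.                *)
Definition young (al : seq nat) : {set 'S_n} :=
  [set w : 'S_n | [forall x, reshape_index al (w x) == reshape_index al x]].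

Definition min_coset_reps (al : seq nat) : {set 'S_n} :=
  [set w : 'S_n |
    [forall u in young al, (perm_length w <= perm_length (w * u))%N]].

End Symmetric.

Section Norm.
Variables (K : fieldType) (v : K) (n : nat).

Definition hecke_Tw (w : 'S_n) : hecke v n :=
  \prod_(i <- red_word w) heckeT v n i.

(* Meaningful when al is a composition of n and h lies in H_al <= H_n. *)
Definition rel_norm (al : seq nat) (h : hecke v n) : hecke v n :=
  \sum_(w in min_coset_reps n al)
    v ^- perm_length w *: (hecke_Tw w * h * hecke_Tw w^-1%g).

End Norm.

(* The image of z1 (x) z2 under H_m (x) H_n = H_{(m,n)} <= H_k, for k = m+n. *)
Definition hecke_tensor (K : fieldType) (v : K) (k m n : nat)
    (z1 : hecke v m) (z2 : hecke v n) : hecke v k :=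
  hecke_emb k 0 z1 * hecke_emb k m z2.

Definition hecke_circ (K : fieldType) (v : K) (k m n : nat)
    (z1 : hecke v m) (z2 : hecke v n) : hecke v k :=
  rel_norm [:: m; n] (hecke_tensor k z1 z2).

Section DirectSum.
Variables (K : fieldType) (V : nat -> lmodType K).

Definition fin_supp (x : forall n, V n) : Prop :=
  exists N, forall n, (N <= n)%N -> x n = 0.

Record dsum : Type := DSum { dsum_val :> forall n, V n; _ : fin_supp dsum_val }.

HB.instance Definition _ := gen_eqMixin dsum.
HB.instance Definition _ := gen_choiceMixin dsum.

Lemma dsumP (x : dsum) : fin_supp x. Proof. by case: x. Qed.

Lemma dsum_eqP (x y : dsum) : (forall n, x n = y n) -> x = y.
Proof.
case: x y => [x fx] [y fy] /= xy.
have {xy} exy : x = y by apply: functional_extensionality_dep.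
by subst y; congr DSum; apply: Prop_irrelevance.
Qed.

Fact dsum0_subproof : fin_supp (fun n => 0 : V n).
Proof. by exists 0%N. Qed.
Definition dsum0 := DSum dsum0_subproof.

Fact dsumD_subproof (x y : dsum) : fin_supp (fun n => x n + y n).
Proof.
have [N xN] := dsumP x; have [M yM] := dsumP y; exists (maxn N M) => n.
by rewrite geq_max => /andP[/xN -> /yM ->]; rewrite addr0.
Qed.
Definition dsumD x y := DSum (dsumD_subproof x y).

Fact dsumN_subproof (x : dsum) : fin_supp (fun n => - x n).
Proof. by have [N xN] := dsumP x; exists N => n /xN ->; rewrite oppr0. Qed.
Definition dsumN x := DSum (dsumN_subproof x).

Fact dsumZ_subproof c (x : dsum) : fin_supp (fun n => c *: x n).
Proof. by have [N xN] := dsumP x; exists N => n /xN ->; rewrite scaler0. Qed.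
Definition dsumZ c x := DSum (dsumZ_subproof c x).

Fact dsum_addA : associative dsumD.
Proof. by move=> x y z; apply: dsum_eqP => n /=; rewrite addrA. Qed.
Fact dsum_addC : commutative dsumD.
Proof. by move=> x y; apply: dsum_eqP => n /=; rewrite addrC. Qed.
Fact dsum_add0 : left_id dsum0 dsumD.
Proof. by move=> x; apply: dsum_eqP => n /=; rewrite add0r. Qed.
Fact dsum_addN : left_inverse dsum0 dsumN dsumD.
Proof. by move=> x; apply: dsum_eqP => n /=; rewrite addNr. Qed.

HB.instance Definition _ := GRing.isZmodule.Build dsum
  dsum_addA dsum_addC dsum_add0 dsum_addN.

Fact dsum_scaleA a b x : dsumZ a (dsumZ b x) = dsumZ (a * b) x.
Proof. by apply: dsum_eqP => n /=; rewrite scalerA. Qed.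
Fact dsum_scale1 : left_id 1 dsumZ.
Proof. by move=> x; apply: dsum_eqP => n /=; rewrite scale1r. Qed.
Fact dsum_scaleDr : right_distributive dsumZ +%R.
Proof. by move=> a x y; apply: dsum_eqP => n /=; rewrite scalerDr. Qed.
Fact dsum_scaleDl x : {morph dsumZ^~ x : a b / a + b}.
Proof. by move=> a b; apply: dsum_eqP => n /=; rewrite scalerDl. Qed.

HB.instance Definition _ := GRing.Zmodule_isLmodule.Build K dsum
  dsum_scaleA dsum_scale1 dsum_scaleDr dsum_scaleDl.

Fact dsum_inj_subproof n (z : V n) :
  fin_supp (dfwith (fun k => 0 : V k) z).
Proof.
by exists n.+1 => k ltnk; rewrite dfwith_out // neq_ltn ltnk.
Qed.

Definition dsum_inj n (z : V n) : dsum := DSum (dsum_inj_subproof z).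

End DirectSum.

Section Circ.
Variables (K : fieldType) (v : K).

Definition hecke_sum := dsum (fun n => hecke v n).
HB.instance Definition _ := GRing.Lmodule.on hecke_sum.

Definition center_sum : {pred hecke_sum} :=
  [pred x : hecke_sum | `[< forall n, x n \in hecke_center >]].

Definition circ_fun (x y : hecke_sum) (k : nat) : hecke v k :=
  \sum_(m < k.+1) hecke_circ k (x m) (y (k - m)%N).

Lemma hecke_emb_linear k a m : (a + m <= k)%N ->
  forall c, {morph @hecke_emb K v k a m : x y / c *: x + y}.
Proof.
move=> le_k c x y; rewrite /hecke_emb; have relT := hecke_emb_rels v le_k.
by rewrite (hecke_liftD relT) (hecke_liftZ relT).
Qed.

Lemma scale_sandwich_linear (A : algType K) (a c : K) (s t x y : A) :
  a *: (s * (c *: x + y) * t) = c *: (a *: (s * x * t)) + a *: (s * y * t).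
Proof.
by rewrite mulrDr mulrDl scalerDr -scalerAr -scalerAl !scalerA mulrC.
Qed.

Lemma rel_norm_linear n al c :
  {morph @rel_norm K v n al : x y / c *: x + y}.
Proof.
move=> x y; rewrite /rel_norm scaler_sumr -big_split; apply: eq_bigr => w _.
exact: scale_sandwich_linear.
Qed.

Lemma hecke_circ_linearl k m n (z : hecke v n) : (m + n = k)%N ->
  forall c, {morph (fun x : hecke v m => hecke_circ k x z) :
               x y / c *: x + y}.
Proof.
move=> mnk c x y; rewrite /hecke_circ -rel_norm_linear; congr (rel_norm _ _).
rewrite /hecke_tensor hecke_emb_linear ?mulrDl ?scalerAl //.
by rewrite -mnk leq_addr.
Qed.

Lemma hecke_circ_linearr k m n (z : hecke v m) : (m + n = k)%N ->
  forall c, {morph (fun x : hecke v n => hecke_circ k z x) :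
               x y / c *: x + y}.
Proof.
move=> mnk c x y; rewrite /hecke_circ -rel_norm_linear; congr (rel_norm _ _).
by rewrite /hecke_tensor hecke_emb_linear ?mulrDr -?scalerAr // mnk.
Qed.

Lemma hecke_circ0l k m n (z : hecke v n) : (m + n = k)%N ->
  hecke_circ k (0 : hecke v m) z = 0.
Proof.
move=> mnk; have := hecke_circ_linearl z mnk (-1) 0 0.
by rewrite scaler0 addr0 scaleN1r addNr.
Qed.

Lemma hecke_circ0r k m n (z : hecke v m) : (m + n = k)%N ->
  hecke_circ k z (0 : hecke v n) = 0.
Proof.
move=> mnk; have := hecke_circ_linearr z mnk (-1) 0 0.
by rewrite scaler0 addr0 scaleN1r addNr.
Qed.

Fact circ_subproof x y : fin_supp (circ_fun x y).
Proof.
have [N xN] := dsumP x; have [M yM] := dsumP y; exists (N + M)%N => k le_k.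
apply: big1 => m _; have mk : (m + (k - m) = k)%N by rewrite subnKC // -ltnS.
have [/xN ->|lt_mN] := leqP N m; first exact: hecke_circ0l.
rewrite yM ?hecke_circ0r // -(leq_add2l m) mk (leq_trans _ le_k) //.
by rewrite leq_add2r ltnW.
Qed.

(* The bilinear extension of hecke_circ; see circ_inj and circ_linearl. *)
Definition circ (x y : hecke_sum) : hecke_sum := DSum (circ_subproof x y).

Lemma circ_linearl (z : hecke_sum) c : {morph circ^~ z : x y / c *: x + y}.
Proof.
move=> x y; apply: dsum_eqP => k /=; rewrite /circ_fun scaler_sumr -big_split.
by apply: eq_bigr => m _; rewrite /= hecke_circ_linearl // subnKC // -ltnS.
Qed.

Lemma circ_linearr (z : hecke_sum) c : {morph circ z : x y / c *: x + y}.
Proof.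
move=> x y; apply: dsum_eqP => k /=; rewrite /circ_fun scaler_sumr -big_split.
by apply: eq_bigr => m _; rewrite /= hecke_circ_linearr // subnKC // -ltnS.
Qed.

Definition hecke_inj n (z : hecke v n) : hecke_sum :=
  dsum_inj (V := fun n => hecke v n) z.

Lemma circ_inj m n (z1 : hecke v m) (z2 : hecke v n) :
  circ (hecke_inj z1) (hecke_inj z2) = hecke_inj (hecke_circ (m + n) z1 z2).
Proof.
apply: dsum_eqP => k; rewrite /= /circ_fun /=.
have [->|neq_k] := eqVneq k (m + n)%N.
  have lt_m : (m < (m + n).+1)%N by rewrite ltnS leq_addr.
  rewrite (bigD1 (Ordinal lt_m)) //= big1 ?addr0 => [|i neq_i].
    have circ_at p : p = n -> hecke_circ (m + n) z1
        (dfwith (fun j => 0 : hecke v j) z2 p) = hecke_circ (m + n) z1 z2.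
      by move=> ->; rewrite dfwith_in.
    by rewrite !dfwith_in circ_at // addKn.
  have ik : (i + (m + n - i) = m + n)%N by rewrite subnKC // -ltnS.
  by rewrite dfwith_out ?hecke_circ0l // eq_sym.
rewrite dfwith_out 1?eq_sym // big1 // => i _.
have ik : (i + (k - i) = k)%N by rewrite subnKC // -ltnS.
have [im|neq_i] := eqVneq m i; last by rewrite dfwith_out ?hecke_circ0l.
rewrite [X in hecke_circ _ _ X]dfwith_out ?hecke_circ0r //.
by apply: contraNneq neq_k => nki; rewrite -ik -im nki -im.
Qed.

Definition rel_norm1 (n : nat) : hecke_sum :=
  hecke_inj (rel_norm [:: n] (1 : hecke v n)).

End Circ.

Arguments center_sum {K} v.
Arguments circ {K v} x y.

Definition Cv (R : realType) : fieldType := {fraction {poly R[i]}}.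
Definition Cv_v (R : realType) : Cv R := tofrac 'X.

(* Main.v *)
Require Import Defs.
From HB Require Import structures.
From mathcomp Require Import all_boot all_order all_algebra all_fingroup.
From mathcomp Require Import boolp classical_sets reals complex fraction.
From mathcomp Require Import finmap.
From mathcomp Require monalg.
From mathcomp Require Import zify ring.

Set Implicit Arguments.
Unset Strict Implicit.
Unset Printing Implicit Defensive.

(** The centers of the Hecke algebras form a ring of symmetric functions: a
characteristic map identifies circ with the product of polynomials and
N_n(1) with a multiple of the elementary symmetric polynomial e_n, and the
fundamental theorem on symmetric polynomials does the rest. The argument
works over any field, with any v other than 0 and 1.

Let tau be the symmetrizing trace of H_n, the coefficient of T_1. A central
z gives the trace function h |-> tau (z h). For a sequence al of k numbers
with sum n let T_al be the Coxeter element of the Young subgroup of al, the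
increasing product of the generators inside the blocks, and let l(al) be
the number of nonzero parts. The characteristic of z in k variables is
  center_char z = sum over al of (v - 1)^l(al) tau (z T_al) t^al.

It is faithful on central elements of degree at most k. Indeed
H_n = H_(n-1) + H_(n-1) T_(n-1) H_(n-1), and cyclicity of a trace function
moves everything to the elements T_al (trace_reduction, trace_vanish), while
tau is nondegenerate (tau_nondegenerate).

It is multiplicative (center_char_circ). The T_d, d a shuffle, are a basis of
H_n as a right module over the subalgebra H_(a,b), with dual family
v^-l(d) T_(d^-1), so tau (N(z) T_al) is the sum over d of tau applied to z
times the diagonal coefficient of T_al at T_d (tau_norm_sum). As T_al is an
increasing product of generators, that coefficient is a product of local
ones (tau_diag). It is nonzero only if each block of d puts the letters of
the second class before those of the first, so that d amounts to a
decomposition al = be + ga, and then it is T_be (x) T_ga up to a factor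
v - 1 for each block that meets both classes (block_prod_shuffle_word). The
powers of v - 1 in the definition absorb these factors (weight_split).

It is symmetric (center_char_sym): T_w, for the permutation w that exchanges
two neighbouring blocks, conjugates the corresponding Coxeter elements. And
tau (T_al) = 1 if all parts are at most 1 and 0 otherwise, so the identity of
H_n has characteristic (v - 1)^n e_n (center_char_graded_unit).

Since relative norms of central elements are central (norm_central), circ
inherits associativity and commutativity from polynomials. Algebraic
independence of the N_n(1) is that of the e_n (centers_eval_eq0), and they
generate because the characteristic of a central element is symmetric, hence
a polynomial in the e_n (centers_eval_surj). The form tau itself comes from
the regular representation (reg_gens), together with Matsumoto's theorem
(Tword_reduced_eq) for the elements T_w. *)

(** * Permutations of intervals of numbers, words and inversions *)

(** Defined on all numbers, so that words can be compared across symmetric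
groups of different degrees. *)
Definition nat_swap (i x : nat) : nat :=
  if x == i then i.+1 else if x == i.+1 then i else x.

Lemma nat_swapK i : involutive (nat_swap i).
Proof. by move=> x; rewrite /nat_swap; do ?case: eqP; lia. Qed.

Lemma nat_swapL i : nat_swap i i = i.+1.
Proof. by rewrite /nat_swap eqxx. Qed.

Lemma nat_swapR i : nat_swap i i.+1 = i.
Proof. by rewrite /nat_swap eqxx; case: eqP => //; lia. Qed.

Lemma nat_swap_lt i x : x < i -> nat_swap i x = x.
Proof. by rewrite /nat_swap; do ?case: eqP; lia. Qed.

Lemma nat_swap_gt i x : i.+1 < x -> nat_swap i x = x.
Proof. by rewrite /nat_swap; do ?case: eqP; lia. Qed.

Lemma nat_swap_braid i x : nat_swap i (nat_swap i.+1 (nat_swap i x)) =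
  nat_swap i.+1 (nat_swap i (nat_swap i.+1 x)).
Proof. by rewrite /nat_swap; do ?case: eqP; lia. Qed.

Lemma nat_swap_comm i j x : i.+1 < j -> nat_swap i (nat_swap j x) =
  nat_swap j (nat_swap i x).
Proof. by rewrite /nat_swap; do ?case: eqP; lia. Qed.

Section PermValues.
Variable n : nat.
Implicit Types (u w : 'S_n) (s : seq nat).
Local Open Scope group_scope.

(** Extended by the identity, a permutation acts on plain numbers and no bound
appears in the types. *)
Definition natperm w (x : nat) : nat := if insub x is Some y then val (w y) else
  x.

Lemma natpermE w (x : 'I_n) : natperm w x = w x.
Proof. by rewrite /natperm valK. Qed.

Lemma natperm_ge w x : n <= x -> natperm w x = x.
Proof. by move=> nx; rewrite /natperm insubF // ltnNge nx. Qed.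

Lemma natperm_lt w x : (natperm w x < n) = (x < n).
Proof.
have [ltx|nx] := ltnP x n; last by rewrite natperm_ge // ltnNge nx.
by rewrite -[x]/(val (Ordinal ltx)) natpermE ltn_ord.
Qed.

Lemma natpermM u w x : natperm (u * w) x = natperm w (natperm u x).
Proof.
have [ltx|nx] := ltnP x n; last by rewrite !natperm_ge.
by rewrite -[x]/(val (Ordinal ltx)) !natpermE permM.
Qed.

Lemma natperm1 x : natperm 1 x = x.
Proof.
have [ltx|nx] := ltnP x n; last by rewrite !natperm_ge.
by rewrite -[x]/(val (Ordinal ltx)) !natpermE perm1.
Qed.

Lemma natpermK w : cancel (natperm w) (natperm w^-1).
Proof. by move=> x; rewrite -natpermM mulgV natperm1. Qed.

Lemma natpermVK w : cancel (natperm w^-1) (natperm w).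
Proof. by move=> x; rewrite -natpermM mulVg natperm1. Qed.

Lemma natperm_inj w : injective (natperm w).
Proof. exact: can_inj (natpermK w). Qed.

Lemma natpermP u w : (forall x, x < n -> natperm u x = natperm w x) -> u = w.
Proof. by move=> uw; apply/permP => x; apply: ord_inj;
  rewrite -!natpermE uw. Qed.

(** Indexed by numbers, with the same placeholder out of range as [heckeT]. *)
Definition adjp (i : nat) : 'S_n :=
  if insub i is Some k then adj_tperm k else 1.

Lemma adjpE (k : 'I_n.-1) : adjp k = adj_tperm k.
Proof. by rewrite /adjp valK. Qed.

Lemma natperm_adjp i x : i.+1 < n -> natperm (adjp i) x = nat_swap i x.
Proof.
move=> lti; have lti' : i < n.-1 by lia.
rewrite -[ i ]/(val (Ordinal lti')) adjpE.
have [ltx|nx] := ltnP x n; last by rewrite natperm_ge // /nat_swap;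
  do ?case: eqP => /=; lia.
rewrite (natpermE _ (Ordinal ltx)) /adj_tperm /nat_swap.
case: tpermP => [/(congr1 val)/= ->|/(congr1 val)/= ->|] /=.
- by rewrite eqxx.
- by rewrite eqxx; case: eqP => //; lia.
- by move=> /eqP + /eqP; rewrite -!val_eqE /= => /negbTE -> /negbTE ->.
Qed.

Lemma adjpK i : i.+1 < n -> adjp i * adjp i = 1.
Proof. by move=> lti; apply: natpermP => x _;
  rewrite natpermM natperm1 !natperm_adjp // nat_swapK. Qed.

Lemma adjpV i : i.+1 < n -> (adjp i)^-1 = adjp i.
Proof. by move=> lti; apply/eqP; rewrite eq_invg_mul adjpK. Qed.

Lemma natperm_adjpM i w x : i.+1 < n -> natperm (adjp i * w) x =
  natperm w (nat_swap i x).
Proof. by move=> lti; rewrite natpermM natperm_adjp. Qed.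

Definition invset w : {set 'I_n * 'I_n} :=
  [set p : 'I_n * 'I_n | (p.1 < p.2) && (w p.2 < w p.1)].

Definition ninv w := #|invset w|.

(** Left multiplication exchanges two neighbouring entries of the word w 0, w 1,
..., so one inversion appears, between these entries, and the others are carried
along. *)
Lemma ninv_adjp i w : i.+1 < n -> natperm w i < natperm w i.+1 ->
  ninv (adjp i * w) = (ninv w).+1.
Proof.
move=> lti asc.
pose i0 : 'I_n := Ordinal (ltnW lti); pose i1 : 'I_n := Ordinal lti.
pose f (p : 'I_n * 'I_n) := (adjp i p.1, adjp i p.2).
have swx (x : 'I_n) : adjp i x = nat_swap i x :> nat by rewrite -natpermE
  natperm_adjp.
have swxK (x : 'I_n) : adjp i (adjp i x) = x by apply: ord_inj;
  rewrite !swx nat_swapK.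
have injf : injective f.
  by move=> [x y] [x' y'] [] /perm_inj -> /perm_inj ->.
rewrite /ninv; have -> : invset (adjp i * w) = (i0, i1) |: f @: invset w.
  apply/setP => -[x y]; rewrite !inE /= !permM.
  apply/idP/idP.
    move=> /andP[xy wyx].
    have [//|ne /=] := eqVneq (x, y) (i0, i1).
    apply/imsetP; exists (adjp i x, adjp i y); last by rewrite /f /= !swxK.
    rewrite inE /= wyx andbT !swx.
    move: ne; rewrite xpair_eqE -!val_eqE /= /nat_swap.
    by move: xy; do ?case: eqP => //=; lia.
  case/orP=> [/eqP[-> ->] /=|/imsetP[[x' y']]].
    rewrite ltnSn /= -!natpermE !natperm_adjp // /nat_swap /= !eqxx.
    by rewrite (_ : i.+1 == i = false) ?eqxx //; apply/eqP; lia.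
  rewrite inE /= => /andP[xy wyx] [-> ->]; rewrite !swxK wyx andbT !swx.
  have ne : (x' == i :> nat) && (y' == i.+1 :> nat) = false.
    apply/negbTE/negP => /andP[/eqP ex /eqP ey].
    by move: wyx; rewrite -!natpermE ex ey; lia.
  by rewrite /nat_swap; move: xy ne; do ?case: eqP => //=; lia.
rewrite cardsU1 card_imset //; case: imsetP => // -[[x y]].
rewrite inE /= => /andP[xy _] [/(congr1 val)/= ex /(congr1 val)/= ey].
by move: ex ey xy; rewrite !swx /nat_swap; do ?case: eqP => //=; lia.
Qed.

Lemma ninv_adjp_desc i w : i.+1 < n -> natperm w i.+1 < natperm w i ->
  ninv w = (ninv (adjp i * w)).+1.
Proof.
move=> lti desc; rewrite -(ninv_adjp lti);
  first by rewrite mulgA adjpK // mul1g.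
rewrite !natperm_adjpM // /nat_swap eqxx; case: eqP; first lia.
by rewrite eqxx.
Qed.

Lemma natperm_asc_or w i : (natperm w i < natperm w i.+1) ||
  (natperm w i.+1 < natperm w i).
Proof.
by have [//|//|/natperm_inj] := ltngtP (natperm w i) (natperm w i.+1); lia.
Qed.

Lemma ninv_adjp_le i w : i.+1 < n -> ninv (adjp i * w) <= (ninv w).+1.
Proof.
move=> lti; have /orP[asc|desc] := natperm_asc_or w i;
  first by rewrite ninv_adjp.
by rewrite [ninv w](ninv_adjp_desc lti desc); lia.
Qed.

Lemma ninv1 : ninv 1 = 0%N.
Proof.
by apply/eqP; rewrite cards_eq0; apply/eqP/setP => p; rewrite !inE !perm1; lia.
Qed.

Lemma ninvV w : ninv w^-1 = ninv w.
Proof.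
pose f (p : 'I_n * 'I_n) := (w p.2, w p.1).
have injf : injective f.
  by move=> [x y] [x' y'] [] /perm_inj -> /perm_inj ->.
rewrite /ninv -[RHS](card_imset _ injf); apply: eq_card => -[x y].
apply/idP/imsetP => [|[[x' y']]]; rewrite !inE /=.
  move=> /andP[xy wyx]; exists (w^-1 y, w^-1 x); last by rewrite /f /= !permKV.
  by rewrite !inE /= !permKV wyx.
by move=> /andP[xy wyx] [-> ->]; rewrite !permK wyx.
Qed.

Lemma asc_homo w a b :
  (forall i, a <= i -> i.+1 < b -> natperm w i < natperm w i.+1) ->
  forall x y, a <= x -> x < y -> y < b -> natperm w x < natperm w y.
Proof.
move=> asc x y ax; elim: y => // y IHy; rewrite ltnS leq_eqVlt.
case/orP=> [/eqP <-|xy] yb; first exact: asc.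
apply: ltn_trans (asc y _ yb); [apply: IHy|]; lia.
Qed.

Lemma homo_ge w : {in gtn n &, {homo natperm w : x y / x < y}} ->
  forall x, x < n -> x <= natperm w x.
Proof.
move=> hw; elim=> // x IHx ltx.
apply: leq_ltn_trans (IHx _) (hw _ _ _ _ _); rewrite ?inE //; lia.
Qed.

(** An increasing self-map of an interval dominates the identity, and so does
its inverse. *)
Lemma asc_perm1 w : (forall i, i.+1 < n -> natperm w i < natperm w i.+1) ->
  w = 1.
Proof.
move=> asc.
have hw : {in gtn n &, {homo natperm w : x y / x < y}}.
  move=> x y xn yn xy; apply: (@asc_homo w 0 n) => // i _; exact: asc.
have hwV : {in gtn n &, {homo natperm w^-1 : x y / x < y}}.
  move=> x y; rewrite !inE => xn yn xy.
  rewrite ltnNge leq_eqVlt negb_or; apply/andP; split.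
    by apply/eqP => /natperm_inj; lia.
  apply/negP => /hw; rewrite !inE !natperm_lt => /(_ yn xn).
  by rewrite !natpermVK; lia.
apply: natpermP => x xn; rewrite natperm1; apply/eqP;
  rewrite eqn_leq homo_ge // andbT.
by rewrite -{2}[x](natpermK w) homo_ge // natperm_lt.
Qed.

Lemma perm_desc w : w != 1 ->
  exists2 i, i.+1 < n & natperm w i.+1 < natperm w i.
Proof.
move=> nw1; have [//|nd] :=
  pselect (exists2 i, i.+1 < n & natperm w i.+1 < natperm w i).
case/eqP: nw1; apply: asc_perm1 => i lti.
by have /orP[//|dsc] := natperm_asc_or w i; case: nd; exists i.
Qed.

Definition letters s := all (gtn n.-1) s.

Lemma letters_cons i s : letters (i :: s) = (i.+1 < n) && letters s.
Proof. by rewrite /letters /= ltn_predRL. Qed.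

Lemma letters_cat s t : letters (s ++ t) = letters s && letters t.
Proof. exact: all_cat. Qed.

Definition wperm s : 'S_n := \prod_(i <- s) adjp i.

Lemma wperm_cons i s : wperm (i :: s) = adjp i * wperm s.
Proof. by rewrite /wperm big_cons. Qed.

Lemma wperm_cat s t : wperm (s ++ t) = wperm s * wperm t.
Proof. by rewrite /wperm big_cat. Qed.

Lemma wperm_nil : wperm [::] = 1.
Proof. by rewrite /wperm big_nil. Qed.

Lemma letters_val (s : seq 'I_n.-1) : letters (map val s).
Proof. by apply/allP => _ /mapP[i _ ->]; rewrite inE ltn_ord. Qed.

Lemma lettersP s : letters s -> exists t : seq 'I_n.-1, s = map val t.
Proof.
move=> ls; exists (pmap insub s); rewrite pmap_filter; last exact: insubK.
by apply/esym/all_filterP/allP => i /(allP ls) lti; rewrite isSome_insub.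
Qed.

Lemma word_perm_val (s : seq 'I_n.-1) : word_perm s = wperm (map val s).
Proof. by rewrite /wperm big_map; apply: eq_bigr => i _; rewrite adjpE. Qed.

Lemma ninv_wperm s : letters s -> ninv (wperm s) <= size s.
Proof.
elim: s => [|i s IHs]; first by rewrite wperm_nil ninv1.
rewrite letters_cons wperm_cons => /andP[lti ls].
by rewrite (leq_trans (ninv_adjp_le _ lti)) // ltnS IHs.
Qed.

Lemma ninv_word w : exists s, [/\ letters s, wperm s = w & size s = ninv w].
Proof.
have [m invw] : exists m, ninv w = m by exists (ninv w).
elim: m w invw => [|m IHm] w invw.
  exists [::]; rewrite wperm_nil invw; split=> //.
  have [->//|/perm_desc[i lti desc]] := eqVneq w 1.
  by move: invw; rewrite (ninv_adjp_desc lti desc).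
have /perm_desc[i lti desc] : w != 1 by apply: contra_eq_neq invw => ->;
  rewrite ninv1.
have := ninv_adjp_desc lti desc; rewrite invw => -[/esym/IHm[s [ls sw_ ss]]].
exists (i :: s); rewrite letters_cons lti wperm_cons sw_ mulgA adjpK // mul1g.
by split=> //=; rewrite ss -(ninv_adjp_desc lti desc) invw.
Qed.

(** Each letter changes the number of inversions by one, and removing descents
one by one attains the resulting bound. *)
Lemma perm_lengthE w : perm_length w = ninv w.
Proof.
have [rw minw] := red_wordP w.
apply/eqP; rewrite eqn_leq; apply/andP; split.
  have [t [lt tw <-]] := ninv_word w; have [t' et] := lettersP lt.
  by rewrite et size_map; apply: minw; rewrite word_perm_val -et.
rewrite -[in ninv w]rw word_perm_val (leq_trans (ninv_wperm _)) ?letters_val //.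
by rewrite size_map.
Qed.

Definition reduced s := ninv (wperm s) == size s.

Lemma reduced_cons i s : letters (i :: s) -> reduced (i :: s) ->
  reduced s /\ natperm (wperm s) i < natperm (wperm s) i.+1.
Proof.
rewrite letters_cons /reduced wperm_cons => /andP[lti ls] /= /eqP.
have := ninv_wperm ls; have /orP[asc|desc] := natperm_asc_or (wperm s) i.
  by rewrite ninv_adjp // => _ [->].
by rewrite [ninv (wperm s)](ninv_adjp_desc lti desc) => ? ?; exfalso; lia.
Qed.

Lemma reduced_cons_asc i s : i.+1 < n -> reduced s ->
  natperm (wperm s) i < natperm (wperm s) i.+1 -> reduced (i :: s).
Proof.
by move=> lti /eqP rs asc; rewrite /reduced wperm_cons ninv_adjp // rs.
Qed.

Fixpoint word_act s x := if s is i :: s' then word_act s' (nat_swap i x) else x.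

Lemma word_actE s x : letters s -> natperm (wperm s) x = word_act s x.
Proof.
elim: s x => [|i s IHs] x; first by rewrite wperm_nil natperm1.
by rewrite letters_cons wperm_cons => /andP[lti ls];
  rewrite natperm_adjpM // IHs.
Qed.

(** Reducedness tested on numbers only: since n does not occur, the test is
transported by the embeddings of Hecke algebras. *)
Fixpoint ascending s :=
  if s is i :: s' then (word_act s' i < word_act s' i.+1) &&
    ascending s' else true.

Lemma reducedE s : letters s -> reduced s = ascending s.
Proof.
elim: s => [|i s IHs]; first by rewrite /reduced wperm_nil ninv1.
move=> ls; have := ls; rewrite letters_cons => /andP[lti ls'].
rewrite /= -!word_actE // -IHs //;
  apply/idP/andP => [/reduced_cons[]//|[asc rs]].
exact: reduced_cons_asc.
Qed.

End PermValues.

(** * Words attached to compositions and to their decompositions *)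

Lemma filter_iotaT (P : pred nat) o r :
  (forall x, o <= x < o + r -> P x) -> [seq x <- iota o r | P x] = iota o r.
Proof. by move=> h; apply/all_filterP/allP => x; rewrite mem_iota;
  apply: h. Qed.

Lemma filter_iotaF (P : pred nat) o r :
  (forall x, o <= x < o + r -> ~~ P x) -> [seq x <- iota o r | P x] = [::].
Proof.
move=> h; apply/eqP; rewrite -size_eq0 size_filter -leqn0 leqNgt -has_count.
by apply/hasPn => x; rewrite mem_iota; apply: h.
Qed.

Lemma cat_iota (s t : seq nat) o m : s ++ t = iota o m ->
  [/\ s = iota o (size s), t = iota (o + size s) (size t) & size s + size t =
    m].
Proof.
move=> e; have em : m = size s + size t by rewrite -size_cat e size_iota.
by move: e; rewrite em iotaD => /eqP;
  rewrite eqseq_cat ?size_iota // => /andP[/eqP <- /eqP <-].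
Qed.

(** The increasing word of a Coxeter element of the Young subgroup whose blocks
have sizes al and start at o; parts 0 and 1 contribute no letter. *)
Fixpoint cox_word (o : nat) (al : seq nat) : seq nat :=
  if al is r :: al' then iota o r.-1 ++ cox_word (o + r) al' else [::].

Lemma cox_word_bound o al i : i \in cox_word o al ->
  o <= i /\ i.+1 < o + sumn al.
Proof.
elim: al o => //= r al IHal o; rewrite mem_cat mem_iota => /orP[|/IHal]; lia.
Qed.

Lemma cox_word_letters al : letters (sumn al) (cox_word 0 al).
Proof. by apply/allP => i /cox_word_bound; rewrite inE; lia. Qed.

Lemma cox_word_sorted o al : sorted ltn (cox_word o al).
Proof.
rewrite (sorted_pairwise ltn_trans).
elim: al o => //= r al IHal o; rewrite pairwise_cat IHal andbT.
apply/andP; split; last by rewrite -(sorted_pairwise ltn_trans) iota_ltn_sorted.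
by apply/allrelP => x y; rewrite mem_iota => + /cox_word_bound; lia.
Qed.

Lemma cox_word_shift o al : cox_word o al = map (addn o) (cox_word 0 al).
Proof.
elim: al o => //= r al IHal o; rewrite map_cat IHal [cox_word (0 + r) al]IHal.
rewrite -[o in iota o _]addn0 iotaDl -map_comp; congr (_ ++ _).
by apply: eq_map => x /=; rewrite add0n addnA.
Qed.

Lemma cox_word_cat o al be : cox_word o (al ++ be) =
  cox_word o al ++ cox_word (o + sumn al) be.
Proof.
by elim: al o => [|r al IHal] o /=; rewrite ?addn0 // IHal catA addnA.
Qed.

Lemma cox_word_nseq0 o k : cox_word o (nseq k 0) = [::].
Proof. by elim: k o => //= k IHk o. Qed.

Lemma cox_word_eq0 o al : (cox_word o al == [::]) = all (leq^~ 1) al.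
Proof.
elim: al o => //= r al IHal o; rewrite -(IHal (o + r)).
by case: r => [|[|r]] /=; rewrite ?addn0.
Qed.

(** The decompositions al = be + complements al be into sequences of the same
length, represented by be. *)
Fixpoint splittings (al : seq nat) : seq (seq nat) :=
  if al is r :: al' then [seq q :: be | q <- iota 0 r.+1, be <- splittings al']
  else [:: [::]].

Fixpoint complements (al be : seq nat) : seq nat :=
  match al, be with r :: al', q :: be' => (r - q) :: complements al' be' | _,
    _ => [::] end.

Lemma splittings_cons r al q be : (q :: be \in splittings (r :: al)) =
  (q <= r) && (be \in splittings al).
Proof.
rewrite /splittings -/splittings;
  apply/allpairsP/andP => [[[q' be'] []]|[qr sb]].
  by rewrite mem_iota => qr sb [-> ->]; split=> //; move: qr => /=; lia.
by exists (q, be); split=> //; rewrite mem_iota /=; lia.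
Qed.

Lemma splittings_consP r al be : be \in splittings (r :: al) ->
  exists q be', [/\ be = q :: be', q <= r & be' \in splittings al].
Proof.
case: be => [/allpairsP[? []] //|q be].
by rewrite splittings_cons => /andP[qr sb]; exists q, be.
Qed.

Lemma splittings_nil be : (be \in splittings [::]) = (be == [::]).
Proof. by rewrite inE. Qed.

Lemma splittings_uniq al : uniq (splittings al).
Proof.
elim: al => // r al IHal; rewrite /splittings -/splittings.
apply: allpairs_uniq IHal _; first exact: iota_uniq.
by move=> [q be] [q' be'] _ _ [-> ->].
Qed.

Lemma sumn_splittings al be : be \in splittings al ->
  sumn be + sumn (complements al be) = sumn al.
Proof.
elim: al be => [|r al IHal] be; first by rewrite splittings_nil => /eqP ->.
by case/splittings_consP => q [be' [-> qr /IHal /= <-]]; lia.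
Qed.

Lemma size_splittings al be : be \in splittings al -> size be = size al.
Proof.
elim: al be => [|r al IHal] be; first by rewrite splittings_nil => /eqP ->.
by case/splittings_consP => q [be' [-> qr /IHal /= <-]].
Qed.

Lemma size_complements al be : be \in splittings al ->
  size (complements al be) = size al.
Proof.
elim: al be => [|r al IHal] be; first by rewrite splittings_nil => /eqP ->.
by case/splittings_consP => q [be' [-> qr /IHal /= <-]].
Qed.

(** In each block the letters of the second class (values from a on) precede
those of the first class (values below a); b and c count the letters of the two
classes that are already placed. *)
Fixpoint shuffle_word (a b c : nat) (al be : seq nat) : seq nat :=
  match al, be with
  | r :: al', q :: be' =>
    iota (a + c) (r - q) ++ iota b q ++ shuffle_word a (b + q) (c + (r - q)) al'
      be'
  | _, _ => [::]
  end.

Section ShufSeq.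
Variable a : nat.
Local Notation lo := (fun x => x < a).
Local Notation hi := (fun x => a <= x).

Lemma filter_lo_shuffle_word b c al be : be \in splittings al ->
  b + sumn be <= a ->
  filter lo (shuffle_word a b c al be) = iota b (sumn be).
Proof.
elim: al be b c => [|r al IHal] be b c;
  first by rewrite splittings_nil => /eqP ->.
case/splittings_consP => q [be' [-> qr sb]] /= le_a;
  rewrite !filter_cat IHal //; last lia.
by rewrite filter_iotaF ?filter_iotaT ?iotaD //= => x; lia.
Qed.

Lemma filter_hi_shuffle_word b c al be : be \in splittings al ->
  b + sumn be <= a ->
  filter hi (shuffle_word a b c al be) =
    iota (a + c) (sumn (complements al be)).
Proof.
elim: al be b c => [|r al IHal] be b c;
  first by rewrite splittings_nil => /eqP ->.
case/splittings_consP => q [be' [-> qr sb]] /= le_a;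
  rewrite !filter_cat IHal //; last lia.
rewrite filter_iotaT ?[filter _ (iota b q)]filter_iotaF /=; try by move=> x;
  lia.
by rewrite iotaD addnA.
Qed.

Lemma perm_shuffle_word al be : be \in splittings al -> sumn be = a ->
  perm_eq (shuffle_word a 0 0 al be) (iota 0 (sumn al)).
Proof.
move=> sb sa; rewrite -(sumn_splittings sb) iotaD sa.
rewrite -(perm_filterC lo) (@eq_filter _ (predC lo) hi) => [|x];
  last by rewrite /= -leqNgt.
by rewrite filter_lo_shuffle_word ?filter_hi_shuffle_word ?sa // addn0.
Qed.

Fixpoint blockwise (R : rel nat) (al s : seq nat) : bool :=
  if al is r :: al' then sorted R (take r s) && blockwise R al' (drop r s) else
    true.

(** Only a step from the first class up to the second is excluded. *)
Definition no_ascent : rel nat := fun x y => (y < a) || (a <= x).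

Lemma sorted_no_ascent s : sorted no_ascent s -> s = filter hi s ++ filter lo s.
Proof.
elim: s => //= x s IHs sxs; have ss := path_sorted sxs.
have [xa|ax] /= := ltnP x a; last by rewrite {1}(IHs ss).
rewrite {1}(IHs ss); have -> // : filter hi s = [::].
have tr : transitive no_ascent by move=> y u z; rewrite /no_ascent; lia.
apply/eqP; rewrite -size_eq0 size_filter -leqn0 leqNgt -has_count;
  apply/hasPn => y ys.
by have /allP/(_ y ys) := order_path_min tr sxs; rewrite /no_ascent; lia.
Qed.

(** Without ascents from the first class to the second, a block is determined by
the number of its entries in each class; the values are then forced, because
each class appears in its natural order. *)
Lemma shuffle_wordP b c nb nc al s : size s = sumn al ->
  blockwise no_ascent al s ->
  filter lo s = iota b nb -> filter hi s = iota (a + c) nc ->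
  exists be, [/\ be \in splittings al, sumn be = nb & s =
    shuffle_word a b c al be].
Proof.
elim: al s b c nb nc => [|r al IHal] s b c nb nc /= sz.
  move=> _ e _; exists [::]; rewrite (size0nil sz) /= in e *; split=> //.
  by have := congr1 size e; rewrite size_iota.
case/andP=> sorted1 bw; rewrite -{1 2}(cat_take_drop r s) !filter_cat.
have sz1 : size (take r s) = r by rewrite size_takel // sz leq_addr.
case/cat_iota; set q := size _ => lo1 lo2 eq_nb.
case/cat_iota; set p := size _ => hi1 hi2 _.
have qp : q + p = r.
  rewrite -sz1 /q /p !size_filter -(count_predC lo); congr (_ + _).
  by apply: eq_count => x /=; rewrite -leqNgt.
have p_r : p = r - q by lia.
rewrite -addnA in hi2.
have [|be [sb sq es]] := IHal _ _ _ _ _ _ bw lo2 hi2;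
  first by rewrite size_drop sz addKn.
exists (q :: be); split; first by rewrite splittings_cons sb andbT; lia.
  by rewrite /= sq.
rewrite -[LHS](cat_take_drop r) es /= -p_r.
by rewrite {1}(sorted_no_ascent sorted1) hi1 lo1 -catA.
Qed.

Lemma take_shuffle_word b c r al q be : q <= r ->
  take r (shuffle_word a b c (r :: al) (q :: be)) = iota (a + c) (r - q) ++
    iota b q.
Proof.
by move=> qr /=; rewrite catA take_cat size_cat !size_iota subnK // ltnn subnn
  take0 cats0.
Qed.

Lemma drop_shuffle_word b c r al q be : q <= r ->
  drop r (shuffle_word a b c (r :: al) (q :: be)) =
    shuffle_word a (b + q) (c + (r - q)) al be.
Proof.
by move=> qr /=; rewrite catA drop_cat size_cat !size_iota subnK // ltnn subnn
  drop0.
Qed.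

Lemma shuffle_word_inj b c al be be' : be \in splittings al ->
  be' \in splittings al ->
  b + sumn be <= a -> b + sumn be' <= a ->
  shuffle_word a b c al be = shuffle_word a b c al be' -> be = be'.
Proof.
elim: al be be' b c => [|r al IHal] be be' b c.
  by rewrite !splittings_nil => /eqP -> /eqP ->.
case/splittings_consP => q [be1 [-> qr sb]];
  case/splittings_consP => q' [be1' [-> qr' sb']] sa sa' e.
have /(congr1 (count lo)) : take r (shuffle_word a b c (r :: al) (q :: be1)) =
  take r (shuffle_word a b c (r :: al) (q' :: be1')) by rewrite e.
have /= : drop r (shuffle_word a b c (r :: al) (q :: be1)) =
  drop r (shuffle_word a b c (r :: al) (q' :: be1')) by rewrite e.
rewrite !drop_shuffle_word // !take_shuffle_word // !count_cat.
have ct x : b + x <= a ->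
  count lo (iota (a + c) (r - x)) + count lo (iota b x) = x.
  move=> bx; rewrite -!size_filter filter_iotaF ?filter_iotaT ?size_iota //= =>
    y; lia.
move: sa sa' => /= sa sa'; rewrite !ct; [|lia|lia] => e' eq.
by subst q'; congr (_ :: _); apply: IHal e' => //; lia.
Qed.

Lemma blockwise_shuffle_word b c al be : be \in splittings al ->
  b + sumn be <= a ->
  blockwise no_ascent al (shuffle_word a b c al be).
Proof.
elim: al be b c => [|r al IHal] be b c //.
case/splittings_consP => q [be1 [-> qr sb]] /= sa.
rewrite [X in take _ X](_ : _ = shuffle_word a b c (r :: al) (q :: be1)) //.
rewrite [X in drop _ X](_ : _ = shuffle_word a b c (r :: al) (q :: be1)) //.
rewrite take_shuffle_word // drop_shuffle_word // IHal //; last lia.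
rewrite andbT sorted_pairwise; last by move=> y u z; rewrite /no_ascent; lia.
rewrite pairwise_cat; apply/and3P; split.
- by apply/allrelP => x y; rewrite !mem_iota /no_ascent; lia.
- apply/(pairwiseP 0) => i j; rewrite !inE size_iota => ip jp _.
  by rewrite !nth_iota // /no_ascent; lia.
- apply/(pairwiseP 0) => i j; rewrite !inE size_iota => ip jp _.
  by rewrite !nth_iota // /no_ascent; lia.
Qed.

End ShufSeq.

Lemma sorted_filter_homo (s : seq nat) (P : pred nat) x y :
  sorted ltn (filter P s) -> x < y -> y < size s ->
  P (nth 0 s x) -> P (nth 0 s y) -> nth 0 s x < nth 0 s y.
Proof.
elim: s x y => [|u s IHs] [|x] [|y] //= sP; rewrite ?ltnS //.
  move=> _ ys Pu Py; move: sP; rewrite Pu /= => /(order_path_min ltn_trans).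
  by move/allP; apply; rewrite mem_filter Py mem_nth.
by apply: IHs; move: sP; case: (P u) => //= /path_sorted.
Qed.

Lemma homo_sorted_filter (s : seq nat) (P : pred nat) :
  (forall x y, x < y -> y < size s -> P (nth 0 s x) -> P (nth 0 s y) ->
    nth 0 s x < nth 0 s y) -> sorted ltn (filter P s).
Proof.
elim: s => //= u s IHs h.
have sP : sorted ltn (filter P s) by apply: IHs => x y xy ys;
  apply: (h x.+1 y.+1).
case: (boolP (P u)) => //= Pu; rewrite path_sortedE ?sP ?andbT;
  last exact: ltn_trans.
apply/allP => z; rewrite mem_filter => /andP[Pz zs].
have := h 0 (index z s).+1 isT; rewrite /= nth_index // ltnS index_mem.
exact.
Qed.

Section PermOfSeq.
Variable n : nat.

Lemma perm_of_seq (s : seq nat) : perm_eq s (iota 0 n) ->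
  exists w : 'S_n, forall x, x < n -> natperm w x = nth 0 s x.
Proof.
move=> ps; have sz : size s = n by rewrite (perm_size ps) size_iota.
have ltn_s (x : 'I_n) : nth 0 s x < n.
  have : nth 0 s x \in iota 0 n by rewrite -(perm_mem ps) mem_nth ?sz.
  by rewrite mem_iota.
have inj : injective (fun x : 'I_n => Ordinal (ltn_s x)).
  move=> x y /(congr1 val) /= /eqP;
    rewrite nth_uniq ?sz ?(perm_uniq ps) ?iota_uniq //.
  by move/eqP/ord_inj.
by exists (perm inj) => x ltx; rewrite (natpermE _ (Ordinal ltx)) permE.
Qed.

Definition perm_word (w : 'S_n) : seq nat := map (natperm w) (iota 0 n).

Lemma size_perm_word w : size (perm_word w) = n.
Proof. by rewrite size_map size_iota. Qed.

Lemma nth_perm_word w x : x < n -> nth 0 (perm_word w) x = natperm w x.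
Proof. by move=> ltx; rewrite (nth_map 0) ?size_iota // nth_iota. Qed.

Lemma perm_word_inj : injective perm_word.
Proof. by move=> u w e; apply: natpermP => x ltx;
  rewrite -!nth_perm_word // e. Qed.

Lemma perm_eq_perm_word w : perm_eq (perm_word w) (iota 0 n).
Proof.
apply: uniq_perm; first by rewrite map_inj_uniq ?iota_uniq //;
  exact: natperm_inj.
  exact: iota_uniq.
move=> x; rewrite mem_iota /=; apply/mapP/idP => [[y]|ltx].
  by rewrite mem_iota /= add0n => lty ->; rewrite natperm_lt.
by exists (natperm w^-1 x)%g; rewrite ?natpermVK // mem_iota /= natperm_lt.
Qed.

Lemma perm_word_surj s : perm_eq s (iota 0 n) -> exists w, perm_word w = s.
Proof.
move=> ps; have [w ws] := perm_of_seq ps.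
exists w; apply: (@eq_from_nth _ 0);
  first by rewrite size_perm_word (perm_size ps) size_iota.
by move=> x; rewrite size_perm_word => ltx; rewrite nth_perm_word ?ws.
Qed.

End PermOfSeq.

Import GRing.Theory.
Local Open Scope ring_scope.

(** * Products of Hecke generators *)

(** The relations of H_n for a family in an arbitrary algebra: they are used for
the generators of H_n and for the operators of the regular representation. *)
Record hecke_gens (K : fieldType) (v : K) (n : nat) (A : algType K)
    (T : nat -> A) : Prop := HeckeGens {
  gens_sqr : forall i, (i.+1 < n)%N -> T i * T i = (v - 1) *: T i + v%:A;
  gens_braid : forall i, (i.+2 < n)%N ->
    T i * T i.+1 * T i = T i.+1 * T i * T i.+1;
  gens_far : forall i j, (j.+1 < n)%N -> (i.+1 < j)%N ->
    T i * T j = T j * T i }.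

Section Words.
Variables (K : fieldType) (n : nat) (A : algType K) (T : nat -> A).
Implicit Types (w : 'S_n) (s : seq nat) (x y : A) (P : pred nat).

Definition Tword s : A := \prod_(i <- s) T i.

Lemma Tword_nil : Tword [::] = 1. Proof. exact: big_nil. Qed.
Lemma Tword_cons i s : Tword (i :: s) = T i * Tword s.
Proof. exact: big_cons. Qed.
Lemma Tword_cat s t : Tword (s ++ t) = Tword s * Tword t.
Proof. exact: big_cat. Qed.
Lemma Tword1 i : Tword [:: i] = T i. Proof. exact: big_seq1. Qed.

(** The subalgebra generated by the T i with i in P, as a span of words that
grow on the left: a linear property that survives left multiplication by these T
i holds on it by induction. *)
Inductive gensub (P : pred nat) : A -> Prop :=
| gensub1 : gensub P 1
| gensubT i x : P i -> (i.+1 < n)%N -> gensub P x -> gensub P (T i * x)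
| gensubD x y : gensub P x -> gensub P y -> gensub P (x + y)
| gensubZ c x : gensub P x -> gensub P (c *: x).

Lemma gensubM P x y : gensub P x -> gensub P y -> gensub P (x * y).
Proof.
move=> Px Py; elim: Px => {x} [|i x Pi lti _ IHx|x x' _ IHx _ IHx'|c x _ IHx].
- by rewrite mul1r.
- by rewrite -mulrA; apply: gensubT.
- by rewrite mulrDl; apply: gensubD.
- by rewrite -scalerAl; apply: gensubZ.
Qed.

Lemma gensub0 P : gensub P 0.
Proof. by rewrite -(scale0r 1); apply/gensubZ/gensub1. Qed.

Lemma gensub_T P i : P i -> (i.+1 < n)%N -> gensub P (T i).
Proof. by move=> Pi lti; rewrite -[T i]mulr1; apply: gensubT (gensub1 P). Qed.

Lemma gensub_sub (P Q : pred nat) x : subpred P Q -> gensub P x -> gensub Q x.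
Proof.
move=> PQ; elim=> {x} [|i x Pi lti _ IHx|x x' _ IHx _ IHx'|c x _ IHx].
- exact: gensub1.
- by apply: gensubT => //; apply: PQ.
- exact: gensubD.
- exact: gensubZ.
Qed.

Lemma gensub_comm P x y : (forall i, P i -> (i.+1 < n)%N ->
  T i * y = y * T i) ->
  gensub P x -> x * y = y * x.
Proof.
move=> cy; elim=> {x} [|i x Pi lti _ IHx|x x' _ IHx _ IHx'|c x _ IHx].
- by rewrite mulr1 mul1r.
- by rewrite -mulrA IHx mulrA (cy i Pi lti) -mulrA.
- by rewrite mulrDl mulrDr IHx IHx'.
- by rewrite -scalerAl -scalerAr IHx.
Qed.

End Words.

Section Matsumoto.
Variables (K : fieldType) (v : K) (n : nat) (A : algType K) (T : nat -> A).
Hypothesis relT : hecke_gens v n T.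
Implicit Types (w : 'S_n) (s t : seq nat).
Local Notation Tword := (Tword T).

(** Matsumoto's theorem. Two reduced words of w start with descents i and j of
w. For distinct i and j, w also has reduced words that start with s_i s_j and
s_j s_i, or with s_i s_j s_i and s_j s_i s_j; by induction they can replace the
given words, and one relation identifies them. *)
Lemma Tword_reduced_eq s t : letters n s -> letters n t -> reduced n s ->
  reduced n t -> wperm n s = wperm n t -> Tword s = Tword t.
Proof.
have [m] := ubnP (size s); elim: m s t => // m IHm [|i s] t;
  rewrite ltnS => szs.
  move=> _ lt _ /eqP rt; rewrite wperm_nil => w1.
  by move: rt; rewrite -w1 ninv1; case: t {lt w1}.
case: t => [|j t] lis ljt ris rjt.
  by rewrite wperm_nil => w1; move: ris; rewrite /reduced w1 ninv1.
have [rs asi] := reduced_cons lis ris; have [rt asj] := reduced_cons ljt rjt.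
have := lis; rewrite letters_cons => /andP[lti ls].
have := ljt; rewrite letters_cons => /andP[ltj lt].
move=> ww; rewrite !Tword_cons.
have sz_st : size s = size t.
  by move/eqP: ris => /=; rewrite ww; move/eqP: rjt => -> [].
wlog : i j s t szs lis ljt ris rjt lti ltj ls lt rs rt asi asj ww sz_st /
  (i <= j)%N.
  move=> W; have [le_ij|/ltnW le_ji] := leqP i j; first exact: W.
  by apply/esym; apply: W => //; rewrite ?ww //= -sz_st.
rewrite leq_eqVlt => /orP[/eqP eij|lt_ij].
  subst j; congr (_ * _); apply: IHm => //.
  by move: ww; rewrite !wperm_cons => /mulgI.
set w := wperm n (i :: s) in ww *.
have es : wperm n s = (adjp n i * w)%g.
  by rewrite /w wperm_cons mulgA adjpK // mul1g.
have et : wperm n t = (adjp n j * w)%g.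
  by rewrite ww wperm_cons mulgA adjpK // mul1g.
have invw : ninv w = (size s).+1 by apply/eqP.
have wi : (natperm w i.+1 < natperm w i)%N.
  by move: asi; rewrite es !natperm_adjpM // nat_swapL nat_swapR.
have wj : (natperm w j.+1 < natperm w j)%N.
  by move: asj; rewrite et !natperm_adjpM // nat_swapL nat_swapR.
have invs : ninv (adjp n i * w)%g = size s by rewrite -es; apply/eqP.
have invt : ninv (adjp n j * w)%g = size s by rewrite -et sz_st; apply/eqP.
move: lt_ij; rewrite leq_eqVlt => /orP[/eqP eij|lt_ij].
  subst j.
  have inv_i : ninv (adjp n i * w)%g =
    (ninv (adjp n i.+1 * (adjp n i * w))%g).+1.
    apply: ninv_adjp_desc => //;
      rewrite !natperm_adjpM // nat_swapR nat_swap_gt //.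
    exact: ltn_trans wi.
  have inv2 := @ninv_adjp_desc _ i (adjp n i.+1 * (adjp n i * w))%g lti.
  (* With j = i + 1, w = s_i s_j s_i u, with r a word of u; lengths add up. *)
  have [r [lr wr szr]] := ninv_word
    (adjp n i * (adjp n i.+1 * (adjp n i * w)))%g.
  have {}inv2 : ninv (adjp n i.+1 * (adjp n i * w))%g = (size r).+1.
    by rewrite szr; apply: inv2;
      rewrite !natperm_adjpM // nat_swapL [nat_swap i.+1 i]nat_swap_lt
        // nat_swapL nat_swap_gt.
  have es' : wperm n s = wperm n (i.+1 :: i :: r).
    rewrite !wperm_cons wr es; apply: natpermP => x _.
    by rewrite !natperm_adjpM // !nat_swapK.
  have et' : wperm n t = wperm n (i :: i.+1 :: r).
    rewrite !wperm_cons wr et; apply: natpermP => x _.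
    by rewrite !natperm_adjpM // -nat_swap_braid !nat_swapK.
  rewrite (IHm s (i.+1 :: i :: r)) ?(IHm t (i :: i.+1 :: r)) ?letters_cons ?lti
    ?ltj -?sz_st //; last 2 first.
  - by rewrite /reduced -et' et invt /= -invs inv_i inv2.
  - by rewrite /reduced -es' es invs /= -invs inv_i inv2.
  rewrite !Tword_cons !mulrA; congr (_ * _).
  exact: (gens_braid relT).
(* Here w = s_i s_j u, and again the lengths add up. *)
have inv_i : ninv (adjp n i * w)%g = (ninv (adjp n j * (adjp n i * w))%g).+1.
  by apply: ninv_adjp_desc => //;
    rewrite !natperm_adjpM // !nat_swap_gt // ltnW.
have [r [lr wr szr]] := ninv_word (adjp n j * (adjp n i * w))%g.
have es' : wperm n s = wperm n (j :: r).
  rewrite !wperm_cons wr es; apply: natpermP => x _.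
  by rewrite !natperm_adjpM // !nat_swapK.
have et' : wperm n t = wperm n (i :: r).
  rewrite !wperm_cons wr et; apply: natpermP => x _.
  by rewrite !natperm_adjpM // [nat_swap i (nat_swap j _)]nat_swap_comm
    // nat_swapK.
rewrite (IHm s (j :: r)) ?(IHm t (i :: r)) ?letters_cons ?lti ?ltj -?sz_st //;
  last 2 first.
- by rewrite /reduced -et' et invt /= -invs inv_i szr.
- by rewrite /reduced -es' es invs /= -invs inv_i szr.
by rewrite !Tword_cons !mulrA (gens_far relT).
Qed.

(** [hecke_Tw] for an arbitrary family T. *)
Definition Tw w := Tword (map val (red_word w)).

Lemma reduced_red_word w : reduced n (map val (red_word w)).
Proof.
rewrite /reduced -word_perm_val; have [-> _] := red_wordP w.
by rewrite -perm_lengthE size_map.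
Qed.

Lemma wperm_red_word w : wperm n (map val (red_word w)) = w.
Proof. by rewrite -word_perm_val; have [-> _] := red_wordP w. Qed.

Lemma Tw_word s : letters n s -> reduced n s -> Tw (wperm n s) = Tword s.
Proof.
move=> ls rs; apply: Tword_reduced_eq => //; first exact: letters_val.
  exact: reduced_red_word.
by rewrite wperm_red_word.
Qed.

Lemma Tw1 : Tw 1%g = 1.
Proof.
by rewrite -(wperm_nil n) Tw_word ?Tword_nil // /reduced wperm_nil ninv1.
Qed.

Lemma TwM u w : ninv (u * w)%g = (ninv u + ninv w)%N ->
  Tw u * Tw w = Tw (u * w)%g.
Proof.
move=> e; rewrite -[in RHS](wperm_red_word u) -[in RHS](wperm_red_word w).
rewrite -wperm_cat Tw_word ?Tword_cat // ?letters_cat ?letters_val //.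
rewrite /reduced wperm_cat !wperm_red_word e size_cat -!perm_lengthE.
by rewrite !size_map.
Qed.

Lemma Tw_adjp i : (i.+1 < n)%N -> Tw (adjp n i) = T i.
Proof.
move=> lti; rewrite -[adjp n i]mulg1 -(wperm_nil n) -wperm_cons.
rewrite Tw_word ?letters_cons ?lti ?Tword1 //.
apply: reduced_cons_asc => //; first by rewrite /reduced wperm_nil ninv1.
by rewrite wperm_nil !natperm1.
Qed.

Lemma ninv_adjp1 i : (i.+1 < n)%N -> ninv (adjp n i) = 1%N.
Proof. by move=> lti; rewrite -[adjp n i]mulg1 ninv_adjp ?ninv1 // !natperm1.
  Qed.

Lemma Tw_asc i w : (i.+1 < n)%N -> (natperm w i < natperm w i.+1)%N ->
  T i * Tw w = Tw (adjp n i * w)%g.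
Proof.
by move=> lti asc; rewrite -Tw_adjp // TwM // ninv_adjp // ninv_adjp1.
Qed.

Lemma Tw_desc i w : (i.+1 < n)%N -> (natperm w i.+1 < natperm w i)%N ->
  T i * Tw w = (v - 1) *: Tw w + v *: Tw (adjp n i * w)%g.
Proof.
move=> lti desc.
have e : Tw w = T i * Tw (adjp n i * w)%g.
  by rewrite Tw_asc // ?mulgA ?adjpK ?mul1g // !natperm_adjpM // nat_swapL
    nat_swapR.
by rewrite {1}e mulrA (gens_sqr relT) // mulrDl -scalerAl -e mulr_algl.
Qed.

Lemma Tw_ascr i w : (i.+1 < n)%N -> (natperm w^-1 i < natperm w^-1 i.+1)%N ->
  Tw w * T i = Tw (w * adjp n i)%g.
Proof.
move=> lti asc; rewrite -Tw_adjp // TwM // -[in LHS]ninvV invMg adjpV //.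
by rewrite ninv_adjp // ninvV ninv_adjp1 // addn1.
Qed.

(** If w maps the neighbours i and i + 1 to neighbours, in this order, then s_i
w = w s_(w i) is longer than w, and T_w intertwines T_i and T_(w i). *)
Lemma Tw_step i w : (i.+1 < n)%N -> natperm w i.+1 = (natperm w i).+1 ->
  T i * Tw w = Tw w * T (natperm w i).
Proof.
move=> lti ws; have ltwi : ((natperm w i).+1 < n)%N by rewrite -ws natperm_lt.
rewrite Tw_asc ?ws // Tw_ascr //; last by rewrite -ws !natpermK.
congr Tw; apply: natpermP => x _;
  rewrite natperm_adjpM // [RHS]natpermM natperm_adjp //.
have [->|ni] := eqVneq x i; first by rewrite !nat_swapL.
have [->|nSi] := eqVneq x i.+1; first by rewrite ws !nat_swapR.
have sne y z : z != y -> z != y.+1 -> nat_swap y z = z.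
  by rewrite /nat_swap => /negbTE -> /negbTE ->.
by rewrite !sne // -?ws (inj_eq (@natperm_inj _ w)).
Qed.

(** The span of the T_w with Q w is stable under left multiplication by the T_i
with i in P, hence contains the subalgebra that these generate. *)
Lemma gensub_Tw_ind (P : pred nat) (Q : 'S_n -> Prop) (R : A -> Prop) :
  Q 1%g -> (forall i u, P i -> (i.+1 < n)%N -> Q u -> Q (adjp n i * u)%g) ->
  (forall u, Q u -> R (Tw u)) -> (forall x y, R x -> R y -> R (x + y)) ->
  (forall c x, R x -> R (c *: x)) ->
  forall x, gensub n T P x -> R x.
Proof.
move=> Q1 QM RT RD RZ x Px.
pose S x := exists c : 'S_n -> K, [/\ x = \sum_w c w *: Tw w &
  forall w, ~ Q w -> c w = 0].
have SR y : S y -> R y.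
  case=> c [-> cQ].
  have R0 : R 0 by rewrite -(scale0r (Tw 1%g)); apply/RZ/RT.
  elim/big_rec: _ => [|w z _ Rz] //; apply: RD => //.
  have [Qw|nQw] := pselect (Q w); first exact/RZ/RT.
  by rewrite cQ // scale0r.
have ST w : Q w -> S (Tw w).
  move=> Qw; exists (fun u => (u == w)%:R); split=> [|u nQu].
    rewrite (bigD1 w) //= eqxx scale1r big1 ?addr0 // => u /negbTE ->.
    by rewrite scale0r.
  by case: eqP => // uw; case: nQu; rewrite uw.
have SD y z : S y -> S z -> S (y + z).
  case=> c [-> cQ] [d [-> dQ]]; exists (fun w => c w + d w); split=> [|w nQ].
    by rewrite -big_split /=; apply: eq_bigr => w _; rewrite scalerDl.
  by rewrite cQ // dQ // addr0.
have SZ a y : S y -> S (a *: y).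
  case=> c [-> cQ]; exists (fun w => a * c w); split=> [|w nQ].
    by rewrite scaler_sumr; apply: eq_bigr => w _; rewrite scalerA.
  by rewrite cQ // mulr0.
have SM i y : P i -> (i.+1 < n)%N -> S y -> S (T i * y).
  move=> Pi lti [c [-> cQ]]; rewrite mulr_sumr.
  have S0 : S 0 by rewrite -(scale0r (Tw 1%g)); apply/SZ/ST.
  elim/big_rec: _ => [|w z _ Sz] //; apply/SD => //; rewrite -scalerAr.
  have [Qw|nQw] := pselect (Q w); last by rewrite cQ // scale0r.
  apply/SZ; have /orP[asc|desc] := natperm_asc_or w i.
    by rewrite Tw_asc //; apply/ST/QM.
  by rewrite Tw_desc //; apply/SD; apply/SZ/ST => //; apply: QM.
apply: SR; elim: Px => {x} [|i x Pi lti _ IHx|x x' _ IHx _ IHx'|c x _ IHx].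
- by rewrite -Tw1; apply: ST.
- exact: SM.
- exact: SD.
- exact: SZ.
Qed.

Lemma T_unit i : v != 0 -> (i.+1 < n)%N -> exists y, T i * y = 1 /\ y * T i = 1.
Proof.
move=> v0 lti; exists (v^-1 *: (T i - (v - 1)%:A)).
have e : T i * T i - (v - 1) *: T i = v%:A.
  by rewrite (gens_sqr relT) // addrC addrA addNr add0r.
rewrite -scalerAr -scalerAl mulrBr mulrBl mulr_algr mulr_algl e.
by rewrite scalerA mulVf // scale1r.
Qed.

Lemma Tw_unit w : v != 0 -> exists y, Tw w * y = 1 /\ y * Tw w = 1.
Proof.
move=> v0; rewrite /Tw; have := letters_val (red_word w).
elim: (map _ _) => [|i s IHs]; first by exists 1; rewrite Tword_nil mulr1.
rewrite letters_cons Tword_cons => /andP[lti /IHs[y [sy ys]]].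
have [z [iz zi]] := T_unit v0 lti; exists (y * z); split.
  by rewrite mulrA -[_ * _ * y]mulrA sy mulr1.
by rewrite mulrA -[y * z * _]mulrA zi mulr1.
Qed.

End Matsumoto.

(** * Symmetrizing trace, shuffles and relative norm *)

Lemma nat_swap_mono j x y : (x < y)%N -> ~ (x = j /\ y = j.+1) ->
  (nat_swap j x < nat_swap j y)%N.
Proof. by rewrite /nat_swap; do ?case: eqP; lia. Qed.

Section Shuffles.
Variables (n a : nat).
Implicit Types d u : 'S_n.

Lemma ninv_eq0 u : ninv u = 0%N -> u = 1%g.
Proof.
by move=> u0; have [//|/perm_desc[i lti /(ninv_adjp_desc lti)]] := eqVneq u 1%g;
  rewrite u0.
Qed.

(** The minimal length representatives of the cosets of S_a x S_(n-a): values of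
the same class occur in increasing order. *)
Definition shuffle d : bool :=
  [forall j : 'I_n, (j.+1 < n)%N &&
    (j.+1 != a) ==> (natperm d^-1%g j < natperm d^-1%g j.+1)%N].

Lemma shuffleP d : reflect
  (forall j, (j.+1 < n)%N -> j.+1 != a ->
    (natperm d^-1%g j < natperm d^-1%g j.+1)%N)
  (shuffle d).
Proof.
apply: (iffP forallP) => [sd j ltj ja|sd j]; last first.
  by apply/implyP => /andP[]; apply: sd.
by have /implyP := sd (Ordinal (ltnW ltj)); apply; rewrite /= ltj.
Qed.

Lemma shuffle_homo d x y : shuffle d -> (x < y)%N -> (y < n)%N ->
  (x < a)%N = (y < a)%N -> (natperm d^-1%g x < natperm d^-1%g y)%N.
Proof.
move=> /shuffleP sd xy yn; have [xa ya|ax ya] := ltnP x a.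
  apply: (@asc_homo _ _ 0 (minn a n)) => //; last by lia.
  by move=> i _ lti; apply: sd; lia.
apply: (@asc_homo _ _ a n) => //.
by move=> i ai lti; apply: sd; lia.
Qed.

(** A value of the same class between d i and d (i + 1) would have to occur at a
position between i and i + 1. *)
Lemma shuffle_step d i : shuffle d -> (i.+1 < n)%N ->
  (natperm d i < a)%N = (natperm d i.+1 < a)%N ->
    natperm d i.+1 = (natperm d i).+1.
Proof.
move=> sd lti same.
have di : (natperm d i < n)%N by rewrite natperm_lt ltnW.
have dSi : (natperm d i.+1 < n)%N by rewrite natperm_lt.
have [lt_d|lt_d|/natperm_inj] := ltngtP (natperm d i) (natperm d i.+1);
  last by lia.
  apply/eqP; rewrite eqn_leq lt_d andbT leqNgt; apply/negP => gap.
  have := shuffle_homo sd (ltnSn (natperm d i));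
    have := shuffle_homo sd gap dSi.
  by rewrite !natpermK; lia.
by have := shuffle_homo sd lt_d di; rewrite !natpermK same => /(_ erefl); lia.
Qed.

Lemma shuffle_adjp d i : shuffle d -> (i.+1 < n)%N ->
  (natperm d i < a)%N != (natperm d i.+1 < a)%N -> shuffle (adjp n i * d)%g.
Proof.
move=> sd lti diff; apply/shuffleP => j ltj ja.
rewrite invMg adjpV // !natpermM !natperm_adjp //; apply: nat_swap_mono.
  by move/shuffleP: sd; apply.
by case=> ej eSj; move: diff; rewrite -eSj -[X in natperm d X]ej !natpermVK;
  lia.
Qed.

(** The Young subgroup of (a, n - a). *)
Definition young2 u := forall x, (natperm u x < a)%N = (x < a)%N.

Lemma young2_1 : young2 1%g. Proof. by move=> x; rewrite natperm1. Qed.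

Lemma young2V u : young2 u -> young2 u^-1%g.
Proof. by move=> yu x; rewrite -[in RHS](natpermVK u x) yu. Qed.

Lemma young2M u w : young2 u -> young2 w -> young2 (u * w)%g.
Proof. by move=> yu yw x; rewrite natpermM yw yu. Qed.

Lemma young2_adjp i : (i.+1 < n)%N -> i.+1 != a -> young2 (adjp n i).
Proof. by move=> lti ia x; rewrite natperm_adjp // /nat_swap; do ?case: eqP;
  lia. Qed.

(** A right descent of u exchanges values of one class, and d^-1 is increasing
on each class, so removing it shortens u and d u alike. *)
Lemma ninv_shuffleM d u : shuffle d -> young2 u ->
  ninv (d * u)%g = (ninv d + ninv u)%N.
Proof.
move=> sd; have [m] := ubnP (ninv u); elim: m u => // m IHm u;
  rewrite ltnS => um yu.
have [->|u1] := eqVneq u 1%g; first by rewrite mulg1 ninv1 addn0.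
have /perm_desc[i lti desc] : u^-1%g != 1%g by rewrite invg_eq1.
have yuV := young2V yu.
have ia : i.+1 != a.
  by apply: contraTneq desc => ia; have := yuV i; have := yuV i.+1; lia.
have [u' eu] : exists u', u = (u' * adjp n i)%g.
  by exists (u * adjp n i)%g; rewrite -mulgA adjpK // mulg1.
have yu' : young2 u'.
  have -> : u' = (u * adjp n i)%g by rewrite eu -mulgA adjpK ?mulg1.
  by apply: young2M => //; apply: young2_adjp.
have asc : (natperm u'^-1%g i < natperm u'^-1%g i.+1)%N.
  by move: desc; rewrite eu invMg adjpV // !natperm_adjpM // nat_swapL
    nat_swapR.
have inv_u : ninv u = (ninv u').+1.
  by rewrite -[LHS]ninvV eu invMg adjpV // ninv_adjp // ninvV.
rewrite inv_u addnS -IHm -?inv_u // -[LHS]ninvV -[in RHS]ninvV eu.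
rewrite mulgA [(_ * adjp _ _)^-1%g]invMg adjpV // ninv_adjp //.
rewrite invMg !natpermM; apply: shuffle_homo => //; first by rewrite natperm_lt.
by rewrite !(young2V yu'); lia.
Qed.

Lemma shuffleM_eq d d' u : shuffle d -> shuffle d' -> young2 u ->
  (d == d' * u)%g = (d == d') && (u == 1%g).
Proof.
move=> sd sd' yu; apply/eqP/andP => [e|[/eqP-> /eqP->]]; last by rewrite mulg1.
have e1 := ninv_shuffleM sd' yu; have := ninv_shuffleM sd (young2V yu).
rewrite -e in e1; rewrite [in LHS]e mulgK e1 ninvV => e2.
have /ninv_eq0 u1 : ninv u = 0%N by lia.
by rewrite e u1 mulg1 !eqxx.
Qed.

End Shuffles.

(** The Hecke algebra together with the coefficient of T_1, its symmetrizing
trace. *)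
Record hecke_trace (K : fieldType) (v : K) (n : nat) (A : algType K)
    (T : nat -> A) (tau : {scalar A}) : Prop := HeckeTrace {
  trace_gens : hecke_gens v n T;
  trace_full : forall x, gensub n T predT x;
  trace_Tw : forall w : 'S_n, tau (Tw T w) = (w == 1%g)%:R }.

Section Trace.
Variables (K : fieldType) (v : K) (n : nat) (A : algType K) (T : nat -> A).
Variable tau : {scalar A}.
Hypothesis dat : hecke_trace v n T tau.
Implicit Types (d u w : 'S_n) (x y z : A).
Local Notation Tw := (@Tw K n A T).
Let relT := trace_gens dat.

Lemma Tw_descr i w : (i.+1 < n)%N ->
  (natperm w^-1%g i.+1 < natperm w^-1%g i)%N ->
  Tw w * T i = (v - 1) *: Tw w + v *: Tw (w * adjp n i)%g.
Proof.
move=> lti desc.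
have e : Tw w = Tw (w * adjp n i)%g * T i.
  rewrite (Tw_ascr relT) //; first by rewrite -mulgA adjpK ?mulg1.
  by rewrite invMg adjpV // !natperm_adjpM // nat_swapL nat_swapR.
by rewrite {1}e -mulrA (gens_sqr relT) // mulrDr -scalerAr -e mulr_algr.
Qed.

Lemma Tw_full_ind (R : A -> Prop) : (forall u, R (Tw u)) ->
  (forall x y, R x -> R y -> R (x + y)) -> (forall c x, R x -> R (c *: x)) ->
  forall x, R x.
Proof.
move=> RT RD RZ x.
by apply: (gensub_Tw_ind relT (P := predT) (Q := fun=> True))
  (trace_full dat x).
Qed.

Lemma tau_TTw i w : (i.+1 < n)%N -> tau (T i * Tw w) = v *+ (w == adjp n i).
Proof.
move=> lti; have /orP[asc|desc] := natperm_asc_or w i.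
  rewrite (Tw_asc relT) // (trace_Tw dat); case: (eqVneq w) => [e|ne].
    by move: asc; rewrite e !natperm_adjp // nat_swapL nat_swapR; lia.
  rewrite (_ : (_ == _) = false) //; apply/eqP => e; case/eqP: ne.
  by rewrite -[w]mul1g -(adjpK lti) -mulgA e mulg1.
rewrite (Tw_desc relT) // linearD !linearZ /= !(trace_Tw dat).
rewrite (_ : (w == 1%g) = false) ?mulr0 ?add0r; last first.
  by apply/eqP => e; move: desc; rewrite e !natperm1; lia.
rewrite -eq_invg_mul adjpV // eq_sym; by case: eqP; rewrite ?mulr1 ?mulr0.
Qed.

Lemma tau_TwT i w : (i.+1 < n)%N -> tau (Tw w * T i) = v *+ (w == adjp n i).
Proof.
move=> lti; have /orP[asc|desc] := natperm_asc_or w^-1%g i.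
  rewrite (Tw_ascr relT) // (trace_Tw dat); case: (eqVneq w) => [e|ne].
    by move: asc; rewrite e adjpV // !natperm_adjp // nat_swapL nat_swapR; lia.
  rewrite (_ : (_ == _) = false) //; apply/eqP => e; case/eqP: ne.
  by rewrite -[w]mulg1 -(adjpK lti) mulgA e mul1g.
rewrite Tw_descr // linearD !linearZ /= !(trace_Tw dat).
rewrite (_ : (w == 1%g) = false) ?mulr0 ?add0r; last first.
  by apply/eqP => e; move: desc; rewrite e invg1 !natperm1; lia.
rewrite -eq_invg_mul -(inj_eq invg_inj) invgK adjpV //.
by case: eqP; rewrite ?mulr1 ?mulr0.
Qed.

(** Both tau (T_i T_w) and tau (T_w T_i) are v if w = s_i and 0 otherwise. *)
Lemma tauC x y : tau (x * y) = tau (y * x).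
Proof.
have tauT i z : (i.+1 < n)%N -> tau (T i * z) = tau (z * T i).
  move=> lti; move: z; apply: Tw_full_ind => [u|z z' e e'|c z e].
  - by rewrite tau_TTw // tau_TwT.
  - by rewrite mulrDr mulrDl !linearD e e'.
  - by rewrite -scalerAr -scalerAl !linearZ /= e.
elim: (trace_full dat x) y => {x} [|i x _ lti _ IHx|x x' _ IHx _ IHx'|c x _ IHx]
  y.
- by rewrite mul1r mulr1.
- by rewrite -mulrA tauT // -mulrA IHx mulrA.
- by rewrite mulrDr mulrDl !linearD IHx IHx'.
- by rewrite -scalerAr -scalerAl !linearZ /= IHx.
Qed.

Lemma tau_centralC z x y : (forall h, z * h = h * z) ->
  tau (z * (x * y)) = tau (z * (y * x)).
Proof. by move=> cz; rewrite mulrA tauC mulrA -cz -mulrA. Qed.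

Lemma tau_rot x y z (s t : A) : tau (z * x * (y * (s * t))) =
  tau (t * z * x * (y * s)).
Proof. by rewrite !mulrA tauC !mulrA. Qed.

(** The bases of all T_w and of all v^-l(w) T_(w^-1) are dual to each other. *)
Lemma tau_TwVTw u w : tau (Tw u^-1%g * Tw w) = v ^+ ninv u *+ (u == w).
Proof.
have [m] := ubnP (ninv u); elim: m u w => // m IHm u w; rewrite ltnS => um.
have [->|/perm_desc[i lti desc]] := eqVneq u 1%g.
  by rewrite invg1 (Tw1 relT) mul1r (trace_Tw dat) ninv1 eq_sym.
have inv_u := ninv_adjp_desc lti desc; set u' := (adjp n i * u)%g in inv_u.
have eu : u = (adjp n i * u')%g by rewrite mulgA adjpK // mul1g.
have asc : (natperm u' i < natperm u' i.+1)%N.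
  by rewrite !natperm_adjpM // nat_swapL nat_swapR.
have -> : Tw u^-1%g = Tw u'^-1%g * T i.
  by rewrite (Tw_ascr relT) ?invgK // eu invMg adjpV.
have um' : (ninv u' < m)%N by rewrite -inv_u.
rewrite -mulrA; have /orP[wasc|wdesc] := natperm_asc_or w i.
  rewrite (Tw_asc relT) // IHm //.
  have -> : (u' == adjp n i * w)%g = (u == w).
    by rewrite eu -[in RHS](inj_eq (@mulgI _ (adjp n i))) mulgA adjpK // mul1g.
  have [e|_] := eqVneq u w; last by rewrite !mulr0n.
  by move: desc; rewrite e ltnNge ltnW.
rewrite (Tw_desc relT) // mulrDr -!scalerAr linearD !linearZ /= !IHm //.
have [e|_] := eqVneq u' w; first by move: asc; rewrite e ltnNge ltnW.
rewrite mulr0 add0r inv_u exprS mulrnAr; congr (_ *+ nat_of_bool _).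
by rewrite eu -[in RHS](inj_eq (@mulgI _ (adjp n i))) mulgA adjpK // mul1g.
Qed.

Hypothesis v0 : v != 0.

Lemma tau_nondegenerate x : (forall y, tau (x * y) = 0) -> x = 0.
Proof.
move=> x0; have [c ec] : exists c : 'S_n -> K, x = \sum_w c w *: Tw w.
  move: x {x0}; apply: Tw_full_ind => [u|x y [c ->] [d ->]|a x [c ->]].
  - exists (fun w => (w == u)%:R); rewrite (bigD1 u) //= eqxx scale1r.
    by rewrite big1 ?addr0 // => w /negbTE ->; rewrite scale0r.
  - by exists (fun w => c w + d w); rewrite -big_split; apply: eq_bigr => w _;
      rewrite scalerDl.
  - by exists (fun w => a * c w); rewrite scaler_sumr; apply: eq_bigr => w _;
      rewrite scalerA.
rewrite ec big1 // => u _; have := x0 (Tw u^-1%g).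
rewrite tauC ec mulr_sumr linear_sum (bigD1 u) //= big1 => [|w wu]; last first.
  by rewrite -scalerAr linearZ /= tau_TwVTw eq_sym (negbTE wu) mulr0.
rewrite addr0 -scalerAr linearZ /= tau_TwVTw eqxx => /eqP.
by rewrite mulf_eq0 expf_eq0 (negbTE v0) andbF orbF => /eqP ->; rewrite scale0r.
Qed.

Section Young.
Variable a : nat.
Local Notation genY := (gensub n T (fun j => j.+1 != a)).

(** The T_d, d a shuffle, are a basis of the algebra as a right module over its
parabolic subalgebra, with dual family v^-l(d) T_(d^-1). *)
Lemma tau_shuffle d d' z : shuffle a d -> shuffle a d' -> genY z ->
  tau (z * Tw d^-1%g * Tw d') = v ^+ ninv d * tau z *+ (d == d').
Proof.
move=> sd sd'; move: z.
apply: (gensub_Tw_ind relT (Q := @young2 n a)) =>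
  [|i u ia lti yu|u yu|x y ex ey|c x ex].
- exact: young2_1.
- by apply: young2M => //; apply: young2_adjp.
- rewrite -mulrA tauC -mulrA (TwM relT) ?(ninv_shuffleM sd') // tau_TwVTw.
  rewrite (shuffleM_eq sd sd') // (trace_Tw dat).
  by case: (d == d'); case: (u == 1%g) => /=; rewrite ?mulr1 ?mulr0 ?mul0rn.
- by rewrite !mulrDl !linearD ex ey -mulrnDl mulrDr.
- by rewrite -!scalerAl !linearZ /= ex mulrnAr mulrCA.
Qed.

(** The relative norm from the parabolic subalgebra of (a, n - a). *)
Definition norm_sum z : A :=
  \sum_(d | shuffle a d) v ^- ninv d *: (Tw d * z * Tw d^-1%g).

(** If d i and d (i + 1) belong to the same class, then T_i T_d = T_d T_j with
T_j in the parabolic subalgebra, and T_i commutes with the term of d. The other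
terms form pairs d, s_i d, and T_i commutes with the sum of each pair by the
quadratic relation. *)
Lemma norm_central z i : (i.+1 < n)%N ->
  (forall j, (j.+1 < n)%N -> j.+1 != a -> T j * z = z * T j) ->
  T i * norm_sum z = norm_sum z * T i.
Proof.
move=> lti cz; rewrite /norm_sum mulr_sumr mulr_suml.
pose same d := (natperm d i < a)%N == (natperm d i.+1 < a)%N.
rewrite (bigID same) [RHS](bigID same) /=; congr (_ + _).
  apply: eq_bigr => d /andP[sd /eqP sm].
  have st := shuffle_step sd lti sm.
  have ltdi : ((natperm d i).+1 < n)%N by rewrite -st natperm_lt.
  have da : (natperm d i).+1 != a by apply/eqP => ea; move: sm;
    rewrite st -ea ltnn ltnSn.
  rewrite -scalerAr -scalerAl; congr (_ *: _).
  rewrite !mulrA (Tw_step relT) // -(mulrA _ (T _)) cz // -!mulrA;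
    congr (_ * (_ * _)).
  have stV : natperm d^-1%g (natperm d i).+1 =
    (natperm d^-1%g (natperm d i)).+1 by rewrite -st !natpermK.
  by rewrite (Tw_step relT) // natpermK.
pose asc d := (natperm d i < natperm d i.+1)%N.
rewrite (bigID asc) [RHS](bigID asc) /=.
(* The shuffles with a descent at i, across classes, are s_i d, d ascending. *)
have sym (F : 'S_n -> A) :
    \sum_(d | shuffle a d && ~~ same d && ~~ asc d) F d =
    \sum_(d | shuffle a d && ~~ same d && asc d) F (adjp n i * d)%g.
  rewrite (reindex_inj (@mulgI _ (adjp n i))) /=; apply: eq_bigl => d.
  rewrite /same /asc !natperm_adjpM // nat_swapL nat_swapR -leqNgt.
  have -> : (natperm d i <= natperm d i.+1)%N =
    (natperm d i < natperm d i.+1)%N.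
    rewrite leq_eqVlt orb_idl // => /eqP /natperm_inj; lia.
  congr (_ && _); rewrite eq_sym.
  apply/andP/andP => -[sd diff]; split=> //; last exact: shuffle_adjp.
  rewrite -[d]mul1g -(adjpK lti) -mulgA; apply: shuffle_adjp => //.
  by rewrite !natperm_adjpM // nat_swapL nat_swapR eq_sym.
rewrite !sym -!big_split /=; apply: eq_bigr => d /andP[_ dasc].
have e1 : Tw (adjp n i * d)%g = T i * Tw d by rewrite (Tw_asc relT).
have e2 : Tw (adjp n i * d)^-1%g = Tw d^-1%g * T i.
  by rewrite invMg adjpV // (Tw_ascr relT) // invgK.
have ek : v ^- (ninv d).+1 = v ^- ninv d * v^-1 by rewrite exprSr invfM.
rewrite e1 e2 ninv_adjp // ek -!scalerA -!scalerAr -!scalerAl -!scalerDr;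
  congr (_ *: _).
set y := Tw d * z * Tw d^-1%g.
have -> : T i * Tw d * z * (Tw d^-1%g * T i) = T i * y * T i by rewrite !mulrA.
have -> : T i * (T i * y * T i) = (v - 1) *: (T i * y * T i) + v *: (y * T i).
  by rewrite !mulrA (gens_sqr relT) // !mulrDl -!scalerAl mul1r.
have -> : T i * y * T i * T i = (v - 1) *: (T i * y * T i) + v *: (T i * y).
  by rewrite -[T i * y * T i * T i]mulrA (gens_sqr relT) // mulrDr -!scalerAr
    mulr1.
rewrite !scalerDr !(scalerA v^-1 v) mulVf // !scale1r.
by rewrite addrCA [RHS]addrCA [T i * y + _]addrC.
Qed.

(** The coefficient of T_d in T_i T_d, for the basis of shuffles. In the second
and third case T_i T_d is T_(s_i d), respectively (v - 1) T_d + v T_(s_i d). *)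
Definition diag_coef d i : A :=
  if (natperm d i < a)%N == (natperm d i.+1 < a)%N then T (natperm d i)
  else if (natperm d i < a)%N then 0 else (v - 1)%:A.

Lemma T_same d i : shuffle a d -> (i.+1 < n)%N ->
  (natperm d i < a)%N = (natperm d i.+1 < a)%N ->
  [/\ T i * Tw d = Tw d * T (natperm d i),
    ((natperm d i).+1 < n)%N & (natperm d i).+1 != a].
Proof.
move=> sd lti sm; have st := shuffle_step sd lti sm; split.
- by rewrite (Tw_step relT).
- by rewrite -st natperm_lt.
- by apply/eqP => ea; move: sm; rewrite st -ea ltnn ltnSn.
Qed.

(** The letters of J are below i and leave the entry at position i + 1 alone, so
the class of this entry keeps d and d' apart. *)
Lemma tau_offdiag d d' J i z : shuffle a d -> shuffle a d' -> genY z ->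
  letters n J -> all (gtn i) J ->
  (natperm d i.+1 < a)%N != (natperm d' i.+1 < a)%N ->
  tau (z * Tw d^-1%g * (Tword T J * Tw d')) = 0.
Proof.
move=> sd; elim/last_ind: J d' z => [|J j IHJ] d' z sd' gz.
  move=> _ _ ne; rewrite Tword_nil mul1r tau_shuffle //.
  by case: eqP => // e; move: ne; rewrite e eqxx.
rewrite -cats1 letters_cat letters_cons all_cat => /andP[lJ /andP[ltj _]].
move=> /andP[Ji /= /andP[ji _]] ne;
  rewrite Tword_cat Tword1 -(mulrA (Tword T J)).
have gT k : k.+1 != a -> (k.+1 < n)%N -> genY (T k * z).
  by move=> ka kn; apply: gensubT.
have nesw : (natperm d i.+1 < a)%N != (natperm (adjp n j * d')%g i.+1 < a)%N.
  by rewrite natperm_adjpM // nat_swap_gt // ltnS.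
have [sm|df] := eqVneq (natperm d' j < a)%N (natperm d' j.+1 < a)%N.
  have [-> ltn_ na] := T_same sd' ltj sm.
  by rewrite tau_rot IHJ //; apply: gT.
have ssw := shuffle_adjp sd' ltj df.
have /orP[asc|desc] := natperm_asc_or d' j.
  by rewrite (Tw_asc relT) // IHJ.
rewrite (Tw_desc relT) // !mulrDr -!scalerAr linearD !linearZ /=.
by rewrite !IHJ // !mulr0 addr0.
Qed.

(** J is increasing and acts from its largest letter on. If a letter j leaves
the diagonal, it changes the class of the entry at position j + 1, and the
smaller letters that follow cannot restore it: only diagonal coefficients
contribute. *)
Lemma tau_diag d J z : shuffle a d -> genY z -> letters n J -> sorted ltn J ->
  tau (z * Tw d^-1%g * (Tword T J * Tw d)) =
  v ^+ ninv d * tau (z * \prod_(i <- J) diag_coef d i).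
Proof.
move=> sd; elim/last_ind: J z => [|J j IHJ] z gz.
  by move=> _ _; rewrite Tword_nil mul1r big_nil mulr1 tau_shuffle // eqxx.
move=> lJj sJj.
have Jj : all (gtn j) J.
  by move: sJj; rewrite -cats1 sorted_pairwise ?pairwise_cat ?allrel1r;
    [case/and3P|exact: ltn_trans].
have sJ : sorted ltn J by move: sJj; rewrite -cats1 => /cat_sorted2[].
move: lJj; rewrite -cats1 letters_cat letters_cons => /andP[lJ /andP[ltj _]].
rewrite Tword_cat Tword1 -(mulrA (Tword T J)) big_cat big_seq1 /= {2}/diag_coef.
case: eqVneq => [sm|df].
  have [-> ltn_ na] := T_same sd ltj sm.
  (* Cyclicity moves the diagonal coefficient of j to the other side of z. *)
  rewrite tau_rot IHJ //; last exact: gensubT.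
  by rewrite -mulrA tauC mulrA.
have ssw := shuffle_adjp sd ltj df.
have nesw : (natperm d j.+1 < a)%N != (natperm (adjp n j * d)%g j.+1 < a)%N.
  by rewrite natperm_adjpM // nat_swapR eq_sym.
have off := tau_offdiag sd ssw gz lJ Jj nesw.
have [dja|dja] := ltnP (natperm d j) a.
  have asc : (natperm d j < natperm d j.+1)%N by move: df; rewrite dja; lia.
  by rewrite (Tw_asc relT) // off !mulr0 linear0 mulr0.
have desc : (natperm d j.+1 < natperm d j)%N by move: df; lia.
rewrite (Tw_desc relT) // !mulrDr -!scalerAr linearD !linearZ /= off mulr0
  addr0.
by rewrite IHJ // mulr1 mulrCA.
Qed.

Lemma tau_norm_sum z J : genY z -> letters n J -> sorted ltn J ->
  tau (norm_sum z * Tword T J) =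
  \sum_(d | shuffle a d) tau (z * \prod_(i <- J) diag_coef d i).
Proof.
move=> gz lJ sJ; rewrite mulr_suml linear_sum; apply: eq_bigr => d sd /=.
have -> : v ^- ninv d *: (Tw d * z * Tw d^-1%g) * Tword T J =
    v ^- ninv d *: (Tw d * (z * Tw d^-1%g * Tword T J)).
  by rewrite -scalerAl !mulrA.
rewrite linearZ /= tauC -mulrA tau_diag // mulrA mulVf ?mul1r //.
by rewrite expf_eq0 (negbTE v0) andbF.
Qed.

End Young.
End Trace.

(** * Coxeter elements on shuffles *)

Section ShuffleSum.
Variables (n a : nat).
Implicit Types d : 'S_n.
Local Notation lo := (fun x => x < a)%N.
Local Notation hi := (fun x => a <= x)%N.

Lemma shuffle_perm_word d : shuffle a d =
  sorted ltn (filter lo (perm_word d)) && sorted ltn (filter hi (perm_word d)).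
Proof.
apply/idP/andP => [sd|[slo shi]].
  have key x y : (x < y)%N -> (y < n)%N -> (natperm d x < a)%N =
    (natperm d y < a)%N ->
      (natperm d x < natperm d y)%N.
    move=> xy yn sm; have [//|lt_d|/natperm_inj] :=
      ltngtP (natperm d x) (natperm d y); last lia.
    have xn : (natperm d x < n)%N by rewrite natperm_lt (ltn_trans xy).
    by have := shuffle_homo sd lt_d xn (esym sm); rewrite !natpermK; lia.
  split; apply: homo_sorted_filter => x y xy; rewrite size_perm_word => yn;
    rewrite !nth_perm_word //; try exact: ltn_trans yn; move=> px py;
      apply: key => //; lia.
apply/shuffleP => j ltj ja.
have [//|lt_d|/natperm_inj] := ltngtP (natperm d^-1%g j) (natperm d^-1%g j.+1);
  last lia.
have pn : (natperm d^-1%g j < n)%N by rewrite natperm_lt ltnW.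
have qn : (natperm d^-1%g j.+1 < n)%N by rewrite natperm_lt.
have sz := size_perm_word d.
have [jlo|jhi] := ltnP j a.
  have := sorted_filter_homo slo lt_d; rewrite sz !nth_perm_word // !natpermVK;
    lia.
have := sorted_filter_homo shi lt_d; rewrite sz !nth_perm_word // !natpermVK;
  lia.
Qed.

Lemma shuffle_filter_lo d : (a <= n)%N -> shuffle a d ->
  filter lo (perm_word d) = iota 0 a.
Proof.
move=> an; rewrite shuffle_perm_word => /andP[slo _].
apply: (irr_sorted_eq ltn_trans ltnn slo (iota_ltn_sorted _ _)) => x.
by rewrite mem_filter (perm_mem (perm_eq_perm_word d)) !mem_iota; lia.
Qed.

Lemma shuffle_filter_hi d : (a <= n)%N -> shuffle a d ->
  filter hi (perm_word d) = iota (a + 0) (n - a).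
Proof.
move=> an; rewrite shuffle_perm_word => /andP[_ shi].
apply: (irr_sorted_eq ltn_trans ltnn shi (iota_ltn_sorted _ _)) => x.
by rewrite mem_filter (perm_mem (perm_eq_perm_word d)) !mem_iota; lia.
Qed.

Lemma shuffle_of_word al be d : be \in splittings al -> sumn be = a ->
  perm_word d = shuffle_word a 0 0 al be -> shuffle a d.
Proof.
move=> sb sa ed; rewrite shuffle_perm_word ed.
by rewrite filter_lo_shuffle_word ?filter_hi_shuffle_word ?sa
  // !iota_ltn_sorted.
Qed.

(** The shuffles without ascents inside the blocks of al are those given by
[shuffle_word], one for each decomposition of al. *)
Lemma sum_shuffles (V : zmodType) (F : 'S_n -> V) (G : seq nat -> V) al :
  sumn al = n -> (a <= n)%N ->
  (forall d, shuffle a d -> ~~ blockwise (no_ascent a) al (perm_word d) ->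
    F d = 0) ->
  (forall d be, be \in splittings al -> sumn be = a ->
     perm_word d = shuffle_word a 0 0 al be -> F d = G be) ->
  \sum_(d | shuffle a d) F d = \sum_(be <- splittings al | sumn be == a) G be.
Proof.
move=> sal an F0 FG.
(* The default value is never reached, by DP. *)
pose D be : 'S_n := odflt 1%g [pick d | perm_word d == shuffle_word a 0 0 al
  be].
have DP be : be \in splittings al -> sumn be = a ->
  perm_word (D be) = shuffle_word a 0 0 al be.
  move=> sb sa; have ps := perm_shuffle_word sb sa; rewrite sal in ps.
  rewrite /D; case: pickP => [d /eqP //|nd].
  by have [w /eqP ew] := perm_word_surj ps; have := nd w; rewrite ew.
pose L := [seq be <- splittings al | sumn be == a].
have LP be : be \in L -> be \in splittings al /\ sumn be = a.
  by rewrite mem_filter => /andP[/eqP].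
transitivity (\sum_(d <- map D L) F d); last first.
  rewrite big_map big_filter big_seq_cond [RHS]big_seq_cond.
  apply: eq_bigr => be /andP[sb /eqP sa]; exact/FG/DP.
pose C d := shuffle a d && blockwise (no_ascent a) al (perm_word d).
rewrite (bigID (fun d => blockwise (no_ascent a) al (perm_word d))) /=.
rewrite [X in _ + X]big1 ?addr0 => [|d /andP[sd nb]]; last exact: F0.
rewrite -big_filter; apply: perm_big; apply: uniq_perm.
- exact/filter_uniq/index_enum_uniq.
- rewrite map_inj_in_uniq ?filter_uniq ?splittings_uniq // =>
  be be' /LP[sb sa] /LP[sb' sa'].
  move=> /(congr1 (@perm_word n)); rewrite !DP //.
  by apply: shuffle_word_inj; rewrite ?sa ?sa'.
move=> d; rewrite mem_filter mem_index_enum andbT.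
apply/andP/mapP => [[sd bw]|[be /LP[sb sa] ->]].
  have [|be [sb sa es]] := shuffle_wordP _ bw (shuffle_filter_lo an sd)
    (shuffle_filter_hi an sd).
    by rewrite size_perm_word.
  have bL : be \in L by rewrite mem_filter sb sa eqxx.
  by exists be => //; apply: (@perm_word_inj n); rewrite DP.
rewrite DP //; split; last by rewrite blockwise_shuffle_word ?sa.
by apply: (shuffle_of_word sb) => //; apply: DP.
Qed.

End ShuffleSum.

Section BlockProduct.
Variables (K : fieldType) (v : K) (n : nat) (A : algType K) (T : nat -> A).
Variable a : nat.
Hypothesis relT : hecke_gens v n T.

(** [diag_coef] depends on two consecutive values only. *)
Definition pair_coef x y : A :=
  if (x < a)%N == (y < a)%N then T x else if (x < a)%N then 0 else (v - 1)%:A.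

Lemma diag_coefE (d : 'S_n) i : diag_coef v T a d i =
  pair_coef (natperm d i) (natperm d i.+1).
Proof. by []. Qed.

Fixpoint chain_prod x s : A := if s is y :: s' then pair_coef x y *
  chain_prod y s' else 1.

Definition seq_prod s : A := if s is x :: s' then chain_prod x s' else 1.

Fixpoint block_prod al s : A :=
  if al is r :: al' then seq_prod (take r s) * block_prod al' (drop r s) else 1.

Lemma chain_prod0 x s : ~~ path (no_ascent a) x s -> chain_prod x s = 0.
Proof.
elim: s x => //= y s IHs x; rewrite negb_and => /orP[nxy|/IHs ->];
  last by rewrite mulr0.
suff -> : pair_coef x y = 0 by rewrite mul0r.
by move: nxy; rewrite /no_ascent /pair_coef; do 2!case: ltnP.
Qed.

Lemma block_prod0 al s : ~~ blockwise (no_ascent a) al s -> block_prod al s = 0.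
Proof.
elim: al s => //= r al IHal s; rewrite negb_and => /orP[|/IHal ->];
  last by rewrite mulr0.
by case: (take r s) => //= x t /chain_prod0 ->; rewrite mul0r.
Qed.

Lemma chain_prodE s o m x t : take m.+1 (drop o s) = x :: t ->
  (o + m.+1 <= size s)%N ->
  \prod_(i <- iota o m) pair_coef (nth 0%N s i) (nth 0%N s i.+1) =
    chain_prod x t.
Proof.
elim: m o x t => [|m IHm] o x t.
  move=> e oms; have : size (x :: t) =
    1%N by rewrite -e size_takel // size_drop; lia.
  by case: t {e} => // _; rewrite big_nil.
move=> e oms; have os : (o < size s)%N by lia.
have oSs : (o.+1 < size s)%N by lia.
move: e; rewrite (drop_nth 0%N os) /= => -[ex].
rewrite (drop_nth 0%N oSs) /= => et; rewrite big_cons -ex -et /=; congr (_ * _).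
by apply: IHm; [rewrite (drop_nth 0%N oSs) | rewrite addSnnS].
Qed.

Lemma prod_cox_word al s o : (o + sumn al <= size s)%N ->
  \prod_(i <- cox_word o al) pair_coef (nth 0%N s i) (nth 0%N s i.+1) =
    block_prod al (drop o s).
Proof.
elim: al o => [|r al IHal] o /=; first by rewrite big_nil.
move=> ors; rewrite big_cat IHal /=; last lia.
rewrite drop_drop [(r + o)%N]addnC; congr (_ * _).
case: r ors => [|r] ors; first by rewrite big_nil take0.
case e: (take r.+1 (drop o s)) => [|x t].
  by have := congr1 size e; rewrite size_takel ?size_drop //; lia.
by rewrite (chain_prodE e) //; lia.
Qed.

Lemma chain_prod_cat x s y t :
  chain_prod x (s ++ y :: t) = chain_prod x s * pair_coef (last x s) y *
    chain_prod y t.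
Proof. by elim: s x => [|z s IHs] x /=; rewrite ?mul1r // IHs !mulrA. Qed.

Lemma seq_prod_iota o m : (o + m <= a)%N || (a <= o)%N ->
  seq_prod (iota o m) = Tword T (iota o m.-1).
Proof.
case: m => [|m] /=; first by rewrite Tword_nil.
elim: m o => [|m IHm] o oa /=; first by rewrite Tword_nil.
rewrite Tword_cons IHm; last lia.
congr (_ * _); rewrite /pair_coef; case: eqP => //; lia.
Qed.

(** A block that meets both classes has exactly one descent between them, with
coefficient v - 1. *)
Definition part_weight (p q : nat) : K := if (0 < p)%N && (0 < q)%N then v -
  1 else 1.

Lemma seq_prod_block c b p q : (b + q <= a)%N ->
  seq_prod (iota (a + c) p ++ iota b q) =
  part_weight p q *: (Tword T (iota (a + c) p.-1) * Tword T (iota b q.-1)).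
Proof.
rewrite /part_weight; case: q => [|q] bq.
  by rewrite /= cats0 andbF seq_prod_iota ?Tword_nil ?mulr1 ?scale1r //; lia.
case: p => [|p].
  by rewrite seq_prod_iota ?Tword_nil ?mul1r ?scale1r // bq.
rewrite /= chain_prod_cat.
rewrite -[chain_prod (a + c) _]/(seq_prod (iota (a + c) p.+1)) seq_prod_iota;
  last lia.
rewrite -[chain_prod b _]/(seq_prod (iota b q.+1)) seq_prod_iota ?bq //=.
have -> : pair_coef (last (a + c) (iota (a + c).+1 p)) b = (v - 1)%:A.
  have la : (a <= last (a + c) (iota (a + c).+1 p))%N.
    have : last (a + c)%N (iota (a + c).+1 p) \in iota (a + c) p.+1
      by apply: mem_last.
    rewrite mem_iota; lia.
  by rewrite /pair_coef ltnNge la (_ : (b < a)%N) //; lia.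
by rewrite mulr_algr scalerAl.
Qed.

Fixpoint split_weight (al be : seq nat) : K :=
  match al, be with
  | r :: al', q :: be' => part_weight (r - q) q * split_weight al' be' | _,
    _ => 1 end.

Lemma Tword_comm s t : letters n s -> letters n t ->
  (forall i j, i \in s -> j \in t -> (i.+1 < j)%N) ->
  Tword T s * Tword T t = Tword T t * Tword T s.
Proof.
move=> ls lt st; elim: s ls st => [|i s IHs] ls st.
  by rewrite Tword_nil mulr1 mul1r.
move: ls; rewrite letters_cons Tword_cons => /andP[lti ls].
rewrite -mulrA IHs // => [|i' j i's jt]; last by apply: st;
  rewrite // inE i's orbT.
rewrite !mulrA; congr (_ * _).
have {st}: forall j, j \in t -> (i.+1 < j)%N by move=> j; apply: st;
  rewrite mem_head.
clear IHs; elim: t lt => [|j t IHt] lt it;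
  first by rewrite Tword_nil mulr1 mul1r.
move: lt; rewrite letters_cons Tword_cons => /andP[ltj lt].
rewrite mulrA (gens_far relT) ?it ?mem_head // -!mulrA IHt // => k kt.
by apply: it; rewrite inE kt orbT.
Qed.

(** Inside each class the block contributes a Coxeter word. Words of different
classes commute, so the contributions of the blocks can be regrouped by classes.
*)
Lemma block_prod_shuffle_word b c al be : be \in splittings al ->
  (b + sumn be <= a)%N ->
  (a + (c + sumn (complements al be)) <= n)%N ->
  block_prod al (shuffle_word a b c al be) =
  split_weight al be *: (Tword T (cox_word b be) *
    Tword T (cox_word (a + c) (complements al be))).
Proof.
elim: al be b c => [|r al IHal] be b c.
  by rewrite splittings_nil => /eqP -> /=; rewrite Tword_nil mulr1 scale1r.
case/splittings_consP => q [be' [-> qr sb]] sa sn.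
rewrite [block_prod _ _]/= -/(shuffle_word a b c (r :: al) (q :: be')).
rewrite take_shuffle_word // drop_shuffle_word // IHal //; last 2 first.
- by move: sa => /=; lia.
- by move: sn => /=; lia.
rewrite seq_prod_block; last by move: sa => /=; lia.
rewrite /= !Tword_cat -!scalerAl -!scalerAr scalerA; congr (_ *: _).
rewrite -addnA !mulrA; congr (_ * _); rewrite -!mulrA.
rewrite ![Tword T (iota (a + c) _) * _]mulrA.
have comm (t : seq nat) : letters n t -> (forall i, i \in t -> (i.+1 < a)%N) ->
    Tword T t * Tword T (iota (a + c) (r - q).-1) =
    Tword T (iota (a + c) (r - q).-1) * Tword T t.
  move=> lt ta; apply: Tword_comm => //.
    by apply/allP => i; rewrite mem_iota inE; move: sn => /=; lia.
  by move=> i j /ta; rewrite mem_iota; lia.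
rewrite comm.
- rewrite mulrA comm //; first by apply/allP => i; rewrite mem_iota inE;
  move: sa sn => /=; lia.
  by move=> i; rewrite mem_iota; move: sa => /=; lia.
- by apply/allP => i /cox_word_bound; rewrite inE; move: sa sn => /=; lia.
- by move=> i /cox_word_bound; move: sa => /=; lia.
Qed.

End BlockProduct.

(** * Traces of relative norms of tensor products *)

Lemma word_act_shift a s x : word_act (map (addn a) s) (a + x) =
  (a + word_act s x)%N.
Proof.
elim: s x => //= i s IHs x; rewrite -IHs; congr (word_act _ _).
by rewrite /nat_swap -addnS !eqn_add2l; case: (x == i); case: (x == i.+1).
Qed.

Lemma ascending_shift a s : ascending (map (addn a) s) = ascending s.
Proof.
by elim: s => //= i s ->; rewrite -addnS !word_act_shift ltn_add2l.
Qed.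

Lemma word_act_shift_lt a s x : (x < a)%N -> word_act (map (addn a) s) x = x.
Proof.
by move=> xa; elim: s => //= i s {2}<-;
  rewrite nat_swap_lt // (leq_trans xa) ?leq_addr.
Qed.

Lemma word_act_cat s t x : word_act (s ++ t) x = word_act t (word_act s x).
Proof. by elim: s x => /=. Qed.

Lemma ascending_cat a s t : letters a s -> ascending s -> ascending t ->
  ascending (s ++ map (addn a) t).
Proof.
move=> + + at_; elim: s => [|i s IHs]; first by rewrite ascending_shift.
rewrite letters_cons /= => /andP[lti ls] /andP[asc as_].
rewrite !word_act_cat IHs // andbT !word_act_shift_lt //.
  by rewrite -(word_actE _ ls) natperm_lt.
by rewrite -(word_actE _ ls) natperm_lt ltnW.
Qed.

(** The later letters are larger, so they fix i and do not bring i + 1 below it.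
*)
Lemma ascending_sorted s : sorted ltn s -> ascending s.
Proof.
elim: s => //= i s IHs pis; rewrite IHs ?(path_sorted pis) // andbT.
have is_ j : j \in s -> (i < j)%N.
  by move: j; apply/allP; apply: order_path_min pis; apply: ltn_trans.
have wi x : (x <= i)%N -> word_act s x = x.
  move=> xi; elim: s {IHs pis} is_ => //= j s IHs is_.
  by rewrite nat_swap_lt ?IHs ?(leq_ltn_trans xi) ?is_ ?mem_head // => k ks;
    apply: is_; rewrite inE ks orbT.
have wge x : (i < x)%N -> (i < word_act s x)%N.
  elim: s x {IHs pis wi} is_ => //= j s IHs x is_ ix; apply: IHs.
    by move=> k ks; apply: is_; rewrite inE ks orbT.
  by have := is_ j (mem_head _ _); rewrite /nat_swap; case: ifP => _;
    [|case: ifP => _]; lia.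
by rewrite wi // wge.
Qed.

Section TraceWords.
Variables (K : fieldType) (v : K) (n : nat) (A : algType K) (T : nat -> A).
Variable tau : {scalar A}.
Hypothesis dat : hecke_trace v n T tau.

Lemma tau_Tword s : letters n s -> ascending s ->
  tau (Tword T s) = (s == [::])%:R.
Proof.
move=> ls as_; have rs : reduced n s by rewrite reducedE.
rewrite -(Tw_word (trace_gens dat)) // (trace_Tw dat); congr (nat_of_bool _)%:R.
apply/eqP/eqP => [e|->]; last exact: wperm_nil.
by apply/size0nil/eqP; rewrite -(eqP rs) e ninv1.
Qed.

End TraceWords.

(** The embeddings of Hecke algebras are bare functions, and morphisms only when
the strands fit; their laws are therefore a hypothesis. *)
Record alg_morph (K : fieldType) (A B : algType K) (e : A -> B) : Prop :=
  AlgMorph {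
  alg_morph1 : e 1 = 1;
  alg_morphM : {morph e : x y / x * y};
  alg_morphD : {morph e : x y / x + y};
  alg_morphZ : forall c, {morph e : x / c *: x} }.

Lemma alg_morph_Tword (K : fieldType) (A B : algType K) (e : A -> B)
    (T : nat -> A) (U : nat -> B) n s :
  alg_morph e -> (forall i, (i.+1 < n)%N -> e (T i) = U i) -> letters n s ->
  e (Tword T s) = Tword U s.
Proof.
move=> me eT; elim: s => [|i s IHs];
  first by rewrite !Tword_nil (alg_morph1 me).
rewrite letters_cons !Tword_cons => /andP[lti ls].
by rewrite (alg_morphM me) eT // IHs.
Qed.

Lemma alg_morph_gen (K : fieldType) (A B : algType K) (e : A -> B)
    (T : nat -> A) (U : nat -> B) m n (P : pred nat) x :
  alg_morph e -> (forall i, (i.+1 < m)%N -> gensub n U P (e (T i))) ->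
  gensub m T predT x -> gensub n U P (e x).
Proof.
move=> me eT; elim=> {x} [|i x _ lti _ IHx|x y _ IHx _ IHy|c x _ IHx].
- by rewrite (alg_morph1 me); apply: gensub1.
- by rewrite (alg_morphM me); apply: gensubM => //; apply: eT.
- by rewrite (alg_morphD me); apply: gensubD.
- by rewrite (alg_morphZ me); apply: gensubZ.
Qed.

Section Induction.
Variables (K : fieldType) (v : K) (a b n : nat).
Variables (A1 A2 A : algType K) (T1 : nat -> A1) (T2 : nat -> A2) (T : nat ->
  A).
Variables (tau1 : {scalar A1}) (tau2 : {scalar A2}) (tau : {scalar A}).
Variables (e1 : A1 -> A) (e2 : A2 -> A).
Hypotheses (v0 : v != 0) (abn : (a + b)%N = n).
Hypotheses (dat1 : hecke_trace v a T1 tau1) (dat2 : hecke_trace v b T2 tau2).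
Hypothesis dat : hecke_trace v n T tau.
Hypotheses (me1 : alg_morph e1) (me2 : alg_morph e2).
Hypothesis e1T : forall i, (i.+1 < a)%N -> e1 (T1 i) = T i.
Hypothesis e2T : forall i, (i.+1 < b)%N -> e2 (T2 i) = T (a + i)%N.
Local Notation genY := (gensub n T (fun j => j.+1 != a)).

Lemma e2_Tword s : letters b s -> e2 (Tword T2 s) = Tword T (map (addn a) s).
Proof.
move=> ls; rewrite (alg_morph_Tword (U := fun i => T (a + i)%N) me2 e2T ls).
by rewrite /Tword big_map.
Qed.

Lemma gen_e1 x : gensub n T (fun i => i.+1 < a)%N (e1 x).
Proof.
apply: (alg_morph_gen me1 _ (trace_full dat1 x)) => i lti.
by rewrite e1T //; apply: gensub_T => //; lia.
Qed.

Lemma gen_e2 x : gensub n T (fun i => a <= i)%N (e2 x).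
Proof.
apply: (alg_morph_gen me2 _ (trace_full dat2 x)) => i lti.
by rewrite e2T //; apply: gensub_T; lia.
Qed.

Lemma genY_tensor x y : genY (e1 x * e2 y).
Proof.
apply: gensubM; [apply: gensub_sub (gen_e1 x)|apply: gensub_sub (gen_e2 y)] =>
  i /=; lia.
Qed.

Lemma comm_e1_e2 x y : e1 x * e2 y = e2 y * e1 x.
Proof.
apply: gensub_comm (gen_e1 x) => i ia lti; apply/esym.
apply: gensub_comm (gen_e2 y) => j ja ltj; apply/esym.
by apply: (gens_far (trace_gens dat)) => //; lia.
Qed.

Lemma tensor_comm z1 z2 j : (forall x, z1 * x = x * z1) ->
  (forall y, z2 * y = y * z2) -> (j.+1 < n)%N -> j.+1 != a ->
  T j * (e1 z1 * e2 z2) = e1 z1 * e2 z2 * T j.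
Proof.
move=> c1 c2 ltj ja; have [lt_ja|le_aj] := ltnP j.+1 a.
  rewrite -e1T // -mulrA -comm_e1_e2 !mulrA; congr (_ * _).
  by rewrite -!(alg_morphM me1) c1.
have ej : j = (a + (j - a))%N by lia.
rewrite ej -e2T; last lia.
by rewrite mulrA -comm_e1_e2 -!mulrA -!(alg_morphM me2) c2.
Qed.

(** A reduced word of S_a followed by the shift of one of S_b is reduced, so tau
vanishes on the product of two basis elements unless both are 1. *)
Lemma tau_tensor x y : tau (e1 x * e2 y) = tau1 x * tau2 y.
Proof.
move: x; apply: (Tw_full_ind dat1) => [u|x x' ex ex'|c x ex]; first last.
- by rewrite (alg_morphZ me1) -scalerAl !linearZ /= ex mulrA.
- by rewrite (alg_morphD me1) mulrDl !linearD ex ex' mulrDl.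
move: y; apply: (Tw_full_ind dat2) => [w|y y' ey ey'|c y ey]; first last.
- by rewrite (alg_morphZ me2) -scalerAr !linearZ /= ey mulrCA.
- by rewrite (alg_morphD me2) mulrDr !linearD ey ey' mulrDr.
rewrite /Tw; set s := map _ _; set t := map _ _.
have ls : letters a s by apply: letters_val.
have lt : letters b t by apply: letters_val.
have as_ : ascending s by rewrite -(reducedE ls) reduced_red_word.
have at_ : ascending t by rewrite -(reducedE lt) reduced_red_word.
rewrite (tau_Tword dat1) // (tau_Tword dat2) //.
rewrite (alg_morph_Tword me1 e1T) // e2_Tword // -Tword_cat (tau_Tword dat).
- by case: s {ls as_} => [|? ?]; case: t {lt at_} => [|? ?];
  rewrite /= ?mulr1 ?mulr0.
- rewrite letters_cat; apply/andP; split; apply/allP => i.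
    by move/(allP ls); rewrite !inE; lia.
  by case/mapP => j /(allP lt) + ->; rewrite !inE; lia.
- exact: ascending_cat.
Qed.

Lemma norm_tensor_central z1 z2 x : (forall x, z1 * x = x * z1) ->
  (forall y, z2 * y = y * z2) ->
  norm_sum v n T a (e1 z1 * e2 z2) * x = x * norm_sum v n T a (e1 z1 * e2 z2).
Proof.
move=> c1 c2; apply/esym; apply: gensub_comm (trace_full dat x) => i _ lti.
apply: (norm_central dat v0) => // j ltj ja; exact: tensor_comm.
Qed.

(** Mackey formula for a Coxeter element: only the shuffles that come from
decompositions of al have a nonzero diagonal coefficient. *)
Lemma tau_norm_tensor z1 z2 al : sumn al = n ->
  tau (norm_sum v n T a (e1 z1 * e2 z2) * Tword T (cox_word 0 al)) =
  \sum_(be <- splittings al | sumn be == a)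
    split_weight v al be * (tau1 (z1 * Tword T1 (cox_word 0 be)) *
                     tau2 (z2 * Tword T2 (cox_word 0 (complements al be)))).
Proof.
move=> sal; rewrite (tau_norm_sum dat v0).
- have relT := trace_gens dat.
  have fpairE (d : 'S_n) : \prod_(i <- cox_word 0 al) diag_coef v T a d i =
    block_prod v T a al (perm_word d).
    rewrite -[perm_word d]drop0 -prod_cox_word ?size_perm_word ?sal //.
    apply: eq_big_seq => i /cox_word_bound; rewrite sal add0n => -[_ lti].
    by rewrite diag_coefE !nth_perm_word // ltnW.
  apply: sum_shuffles => //; first lia.
    by move=> d sd nb; rewrite fpairE block_prod0 // mulr0 linear0.
  move=> d be sb sa ed; have sd := sumn_splittings sb.
  rewrite fpairE ed (block_prod_shuffle_word relT) ?sa //; last lia.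
  rewrite -scalerAr linearZ /=; congr (_ * _).
  rewrite -tau_tensor (alg_morphM me1) (alg_morphM me2).
  rewrite (alg_morph_Tword me1 e1T) -?sa ?cox_word_letters //.
  rewrite e2_Tword; last by rewrite (_ : b = sumn (complements al be))
    ?cox_word_letters //; lia.
  rewrite addn0 -sa -cox_word_shift sa.
  rewrite -!mulrA; congr (tau (_ * _)); rewrite !mulrA; congr (_ * _).
  rewrite -(alg_morph_Tword me1 e1T) -?sa ?cox_word_letters //.
  by rewrite comm_e1_e2.
- exact: genY_tensor.
- by rewrite -sal cox_word_letters.
- exact: cox_word_sorted.
Qed.

End Induction.

(** * Trace functions and Coxeter elements *)

Section TraceReduction.
Variables (K : fieldType) (v : K) (n : nat) (A : algType K) (T : nat -> A).
Hypothesis relT : hecke_gens v n T.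
Local Notation below m := (gensub n T (fun i => i < m)%N).

Lemma below_comm m x y : (forall i, (i < m)%N -> (i.+1 < n)%N ->
  T i * y = y * T i) ->
  below m x -> x * y = y * x.
Proof. exact: gensub_comm. Qed.

Lemma below_T m x : (m.+1 < n)%N -> below m.-1 x -> x * T m = T m * x.
Proof.
move=> ltm; apply: below_comm => i im lti.
by apply: (gens_far relT) => //; lia.
Qed.

Lemma belowS m x : below m x -> below m.+1 x.
Proof. by apply: gensub_sub => i /= /leqW. Qed.

(** Membership in B + B T_m B, where B is generated by the T_i with i < m,
expressed by its elimination principle. *)
Definition layer m z := forall R : A -> Prop,
  (forall x y, R x -> R y -> R (x + y)) -> (forall c x, R x -> R (c *: x)) ->
  (forall x, below m x -> R x) ->
  (forall x y, (m.+1 < n)%N -> below m x -> below m y -> R (x * T m * y)) ->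
    R z.

Lemma layerD m x y : layer m x -> layer m y -> layer m (x + y).
Proof. by move=> lx ly R RD RZ Rl RT; apply: (RD); [apply: lx | apply: ly]. Qed.

Lemma layerZ m c x : layer m x -> layer m (c *: x).
Proof. by move=> lx R RD RZ Rl RT; apply: (RZ); apply: lx. Qed.

Lemma layer_below m x : below m x -> layer m x.
Proof. by move=> bx R _ _ Rl _; apply: Rl. Qed.

Lemma layerT m x y : (m.+1 < n)%N -> below m x -> below m y ->
  layer m (x * T m * y).
Proof. by move=> lt bx bY R _ _ _; apply. Qed.

(** By induction x lies in the layer below. Its part generated by the T_i with i
< m - 1 commutes with T_m, and the remaining part produces T_m T_(m-1) T_m =
T_(m-1) T_m T_(m-1). *)
Lemma layer_top m x y : (m.+1 < n)%N -> (0 < m -> layer m.-1 x)%N ->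
  below m x ->
  below m y -> layer m (T m * x * T m * y).
Proof.
move=> ltm lx bx bY.
have sq a : below m.-1 a -> layer m (T m * a * T m * y).
  move=> ba; rewrite -(below_T ltm ba) -[a * T m * T m]mulrA (gens_sqr relT) //.
  have bma : below m a by apply: gensub_sub ba => i /=; lia.
  rewrite mulrDr mulrDl; apply: layerD.
    by rewrite -scalerAr -scalerAl; apply: layerZ; apply: layerT.
  by rewrite mulr_algr -scalerAl; apply: layerZ; apply: layer_below;
    apply: gensubM.
case: m => [|m] in ltm lx bx bY sq *; first exact: sq.
apply: (lx isT (fun z => layer m.+1 (T m.+1 * z * T m.+1 * y))) => //=.
- by move=> a b la lb; rewrite mulrDr !mulrDl; apply: layerD.
- by move=> c a la; rewrite -scalerAr -!scalerAl; apply: layerZ.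
move=> a b _ ba bb.
have ca : T m.+1 * a = a * T m.+1 by rewrite (@below_T m.+1).
have cb : b * T m.+1 = T m.+1 * b by rewrite (@below_T m.+1).
have -> : T m.+1 * (a * T m * b) * T m.+1 * y =
  a * T m * T m.+1 * (T m * b * y).
  rewrite !mulrA ca -!mulrA [b * _]mulrA cb -!mulrA; congr (a * _).
  by rewrite !mulrA -(gens_braid relT).
by apply: layerT => //; do ?apply: gensubM => //; try exact: belowS;
  apply: gensub_T => //; lia.
Qed.

Lemma layer_mulT m i x : (0 < m -> forall y, below m y -> layer m.-1 y)%N ->
  (i <= m)%N -> (i.+1 < n)%N -> layer m x -> layer m (T i * x).
Proof.
move=> lay im lti lx; apply: (lx (fun z => layer m (T i * z))).
- by move=> y z ly lz; rewrite mulrDr; apply: layerD.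
- by move=> c y ly; rewrite -scalerAr; apply: layerZ.
- move=> y bY; move: im; rewrite leq_eqVlt => /orP[/eqP ei|lt_im].
    by rewrite ei in lti *; rewrite -[T m]mul1r; apply: layerT => //;
      apply: gensub1.
  by apply: layer_below; apply: gensubM => //; apply: gensub_T.
move=> y z ltm bY bz; rewrite !mulrA.
move: im; rewrite leq_eqVlt => /orP[/eqP ei|lt_im].
  by rewrite ei; apply: layer_top => // m0; apply: lay.
by apply: layerT => //; apply: gensubM => //; apply: gensub_T.
Qed.

(** For m = n - 2 this is H_n = H_(n-1) + H_(n-1) T_m H_(n-1), by [layer_top].
*)
Lemma layer_full m x : below m.+1 x -> layer m x.
Proof.
elim: m x => [|m IHm] x;
  elim=> {x} [|i x im lti _ IHx|x y _ IHx _ IHy|c x _ IHx].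
- by apply: layer_below; apply: gensub1.
- exact: layer_mulT.
- exact: layerD.
- exact: layerZ.
- by apply: layer_below; apply: gensub1.
- by apply: layer_mulT => // _; apply: IHm.
- exact: layerD.
- exact: layerZ.
Qed.

Variable chi : {scalar A}.
Hypothesis chiC : forall x y, chi (x * y) = chi (y * x).

(** The tail t commutes with the generators of the first m strands. Let C_k be
the Coxeter element of the strands k, ..., m - 1. An element of the first k + 1
strands, times C_k t, splits into terms a C_k t with a on the first k strands,
where the induction on m applies, and a T_(k-1) b C_k t. In the latter b
commutes with C_k t, so that the value is that of b a C_(k-1) t, with one more
strand in the last block. *)
Lemma trace_reduction m t : (m <= n)%N ->
  (forall i, (i.+1 < m)%N -> T i * t = t * T i) ->
  (forall al, sumn al = m -> all (leq 1) al ->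
    chi (Tword T (cox_word 0 al) * t) = 0) ->
  forall x, below m.-1 x -> chi (x * t) = 0.
Proof.
elim/ltn_ind: m t => -[|m] IHm t mn ct chi0 x bx.
  elim: bx => {x} [|i x //|x y _ IHx _ IHy|c x _ IHx].
  - by have := chi0 [::] erefl isT; rewrite Tword_nil.
  - by rewrite mulrDl linearD IHx IHy addr0.
  - by rewrite -scalerAl linearZ /= IHx mulr0.
(* C k covers the strands k, ..., m. *)
pose C k := Tword T (iota k (m - k)).
have CS k : (k < m)%N -> C k = T k * C k.+1.
  by move=> km; rewrite /C (_ : (m - k = (m - k.+1).+1)%N) ?Tword_cons //; lia.
have lC k : letters n (iota k (m - k)).
  by apply/allP => i; rewrite mem_iota inE; lia.
have Ccomm k y : (k < m)%N -> below k y -> y * C k.+1 = C k.+1 * y.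
  move=> km; apply: gensub_comm => i ik lti;
    rewrite -Tword1 (Tword_comm relT) //.
  - by rewrite letters_cons lti.
  - by move=> i' j; rewrite inE mem_iota => /eqP ->; lia.
have tcomm k y : (k <= m)%N -> below k y -> y * t = t * y.
  by move=> km; apply: gensub_comm => i ik lti; apply: ct; lia.
suff B k y : (k <= m)%N -> below k y -> chi (y * (C k * t)) = 0.
  by have := B m x (leqnn _) bx; rewrite /C subnn Tword_nil mul1r.
elim: k y => [|k IHk] y km bY.
  elim: bY => {y} [|i x' //|x' y _ IHx _ IHy|c x' _ IHx].
  - rewrite mul1r /C subn0; have := chi0 [:: m.+1]; rewrite /= cats0 addn0.
    by apply.
  - by rewrite mulrDl linearD IHx IHy addr0.
  - by rewrite -scalerAl linearZ /= IHx mulr0.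
apply: (layer_full bY (R := fun y => chi (y * (C k.+1 * t)) = 0)).
- by move=> y1 y2 e1 e2; rewrite mulrDl linearD e1 e2 addr0.
- by move=> c y1 e1; rewrite -scalerAl linearZ /= e1 mulr0.
- move=> z bz; apply: (IHm k.+1) => //; first by lia.
  + move=> i ik; have bi : below k (T i) by apply: gensub_T; lia.
    by rewrite mulrA Ccomm // -!mulrA (tcomm k) //; lia.
  + move=> al sal al1; rewrite mulrA -Tword_cat.
    have := chi0 (rcons al (m - k)%N);
      rewrite -cats1 cox_word_cat /= cats0 sal add0n.
    rewrite (_ : (m - k).-1 = m - k.+1)%N; last by lia.
    by apply; rewrite ?sumn_cat /= ?all_cat /= ?al1; lia.
move=> y1 y2 ltk b1 b2.
rewrite -!mulrA [y2 * _]mulrA Ccomm // -[C k.+1 * y2 * t]mulrA (tcomm k) //;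
  last by lia.
rewrite !mulrA chiC !mulrA -[_ * T k * _]mulrA -CS // -mulrA.
by apply: IHk; [lia | apply: gensubM].
Qed.

Lemma trace_vanish : (forall x, gensub n T predT x) ->
  (forall al, sumn al = n -> all (leq 1) al -> chi (Tword T (cox_word 0 al)) =
    0) ->
  forall x, chi x = 0.
Proof.
move=> full chi0 x; rewrite -[x]mulr1; apply: (@trace_reduction n) => //.
- by move=> i _; rewrite mulr1 mul1r.
- by move=> al sal al1; rewrite mulr1 chi0.
elim: (full x) => {x} [|i x _ lti _ IHx|x y _ IHx _ IHy|c x _ IHx].
- exact: gensub1.
- by apply: gensubT => //; lia.
- exact: gensubD.
- exact: gensubZ.
Qed.

End TraceReduction.

Section Symmetry.
Variables (K : fieldType) (v : K) (n : nat) (A : algType K) (T : nat -> A).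
Hypotheses (relT : hecke_gens v n T) (v0 : v != 0).
Variable chi : {scalar A}.
Hypothesis chiC : forall x y, chi (x * y) = chi (y * x).

Lemma chi_intertwine (w : 'S_n) J : letters n J ->
  (forall i, i \in J -> natperm w i.+1 = (natperm w i).+1) ->
  chi (Tword T J) = chi (Tword T (map (natperm w) J)).
Proof.
move=> lJ wJ; have e : Tword T J * Tw T w =
  Tw T w * Tword T (map (natperm w) J).
  elim: J lJ wJ => [|i J IHJ]; first by rewrite !Tword_nil mulr1 mul1r.
  rewrite letters_cons /= !Tword_cons => /andP[lti lJ] wJ.
  rewrite -mulrA IHJ // => [|j jJ]; last by apply: wJ; rewrite inE jJ orbT.
  by rewrite mulrA (Tw_step relT) ?wJ ?mem_head // mulrA.
have [y [wy yw]] := Tw_unit relT w v0.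
by rewrite -[Tword T J]mulr1 -wy mulrA e chiC mulrA yw mul1r.
Qed.

(** The exchange of the neighbouring blocks of p and q letters that start at o.
*)
Definition block_swap o p q x :=
  if (x < o)%N then x else if (x < o + p)%N then (x + q)%N
  else if (x < o + p + q)%N then (x - p)%N else x.

(** T_w, for the exchange w of the two blocks, conjugates the Coxeter elements
into each other. *)
Lemma chi_swap_parts l p q r : sumn (l ++ p :: q :: r) = n ->
  chi (Tword T (cox_word 0 (l ++ p :: q :: r))) =
  chi (Tword T (cox_word 0 (l ++ q :: p :: r))).
Proof.
rewrite sumn_cat /= => sn; pose o := sumn l; pose f := block_swap o p q.
have pf : perm_eq (mkseq f n) (iota 0 n).
  apply: uniq_perm; rewrite ?iota_uniq //.
    rewrite map_inj_uniq ?iota_uniq // => x y; rewrite /f /block_swap.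
    by do !case: ifP; lia.
  move=> x; rewrite mem_iota /=; apply/mapP/idP => [[y]|xn].
    by rewrite mem_iota /= /f /block_swap -/o in sn * => yn ->; do !case: ifP;
      lia.
  exists (block_swap o q p x); rewrite ?mem_iota /f /block_swap -/o in sn *;
    by do !case: ifP; lia.
have [w wf] := perm_of_seq pf.
have {}wf x : (x < n)%N -> natperm w x = f x by move=> xn;
  rewrite wf // nth_mkseq.
have lJ : letters n (cox_word 0 (l ++ p :: q :: r)).
  by rewrite -sn -[(p + _)%N]/(sumn (p :: q :: r)) -sumn_cat cox_word_letters.
have iJ i : i \in cox_word 0 (l ++ p :: q :: r) -> (i.+1 < n)%N.
  by move/(allP lJ); rewrite inE; lia.
have cox_al a b : cox_word 0 (l ++ a :: b :: r) =
    cox_word 0 l ++ iota o a.-1 ++ iota (o + a) b.-1 ++ cox_word (o + a + b) r.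
  by rewrite cox_word_cat /= add0n.
rewrite (chi_intertwine lJ (w := w)) => [|i iin]; last first.
  have ltSi := iJ i iin; rewrite !wf // 1?ltnW // /f /block_swap.
  move: iin; rewrite cox_al !mem_cat !mem_iota =>
    /or4P[/cox_word_bound||| /cox_word_bound];
    rewrite ?add0n -/o => iin; do !case: ifP; lia.
have -> : map (natperm w) (cox_word 0 (l ++ p :: q :: r)) =
    cox_word 0 l ++ iota (o + q) p.-1 ++ iota o q.-1 ++ cox_word (o + q + p) r.
  rewrite (_ : map (natperm w) _ = map f (cox_word 0 (l ++ p :: q :: r)));
    last first.
    by apply/eq_in_map => i /iJ /ltnW /wf.
  rewrite cox_al !map_cat -[(o + p + q)%N]addnA [(p + q)%N]addnC addnA.
  congr (_ ++ _ ++ _ ++ _).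
  - apply: map_id_in => i /cox_word_bound; rewrite add0n -/o /f /block_swap.
    by do !case: ifP; lia.
  - rewrite [(o + q)%N]addnC iotaDl; apply/eq_in_map => i;
    rewrite mem_iota /f /block_swap.
    by do !case: ifP; lia.
  - rewrite [(o + p)%N]addnC iotaDl -map_comp; apply: map_id_in => i.
    by rewrite mem_iota /f /block_swap /=; do !case: ifP; lia.
  - apply: map_id_in => i /cox_word_bound; rewrite /f /block_swap.
    by do !case: ifP; lia.
rewrite cox_al !Tword_cat; congr (chi (_ * _)); rewrite !mulrA; congr (_ * _).
apply/esym; apply: (Tword_comm relT).
- by apply/allP => i; rewrite mem_iota inE; lia.
- by apply/allP => i; rewrite mem_iota inE; lia.
- by move=> i j; rewrite !mem_iota; lia.
Qed.

End Symmetry.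

(** * The regular representation and the algebras H_n *)

Section RegularOperators.
Variables (K : fieldType) (v : K) (n : nat).
Implicit Types (f g : 'S_n -> K) (u w : 'S_n).

(** Left multiplication by T_i, on the coefficients f of the sum of the f w T_w.
This is a pointwise formula, and the relations reduce to identities between
finitely many values. *)
Definition reg_op i f w : K :=
  if (natperm w i < natperm w i.+1)%N then v * f (adjp n i * w)%g
  else f (adjp n i * w)%g + (v - 1) * f w.

Lemma adjpKM i w : (i.+1 < n)%N -> (adjp n i * (adjp n i * w) = w)%g.
Proof. by move=> lti; rewrite mulgA adjpK // mul1g. Qed.

Lemma adjp_braidM i w : (i.+2 < n)%N ->
  (adjp n i.+1 * (adjp n i * (adjp n i.+1 * w)) =
    adjp n i * (adjp n i.+1 * (adjp n i * w)))%g.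
Proof.
move=> lti; apply: natpermP => x _; rewrite !natperm_adjpM ?nat_swap_braid //;
  lia.
Qed.

Lemma adjp_farM i j w : (i.+1 < j)%N -> (j.+1 < n)%N ->
  (adjp n j * (adjp n i * w) = adjp n i * (adjp n j * w))%g.
Proof.
by move=> ij ltj; apply: natpermP => x _;
  rewrite !natperm_adjpM ?[nat_swap i _]nat_swap_comm //; lia.
Qed.

Lemma reg_op_sqr i f w : (i.+1 < n)%N ->
  reg_op i (reg_op i f) w = (v - 1) * reg_op i f w + v * f w.
Proof.
move=> lti; rewrite /reg_op !natperm_adjpM // nat_swapL nat_swapR adjpKM //.
by case: ltngtP => [_|_|/natperm_inj]; [ring | ring | lia].
Qed.

(** Both sides depend on the relative order of three consecutive entries of w,
and each of the six orders leaves a polynomial identity in v. *)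
Lemma reg_op_braid i f w : (i.+2 < n)%N ->
  reg_op i (reg_op i.+1 (reg_op i f)) w =
  reg_op i.+1 (reg_op i (reg_op i.+1 f)) w.
Proof.
move=> lti; have lti1 : (i.+1 < n)%N by apply: ltnW.
rewrite /reg_op !natperm_adjpM // !nat_swapL !nat_swapR
  ![nat_swap i i.+2]nat_swap_gt // ![nat_swap i.+1 i]nat_swap_lt //.
rewrite !nat_swapL !nat_swapR.
rewrite adjp_braidM // !adjpKM //.
have := @natperm_inj _ w i i.+1; have := @natperm_inj _ w i i.+2;
  have := @natperm_inj _ w i.+1 i.+2.
move: (natperm w i) (natperm w i.+1) (natperm w i.+2) => x y z hyz hxz hxy.
case: (ltngtP x y) => [xy|xy|/hxy]; last lia;
case: (ltngtP y z) => [yz|yz|/hyz]; try lia;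
case: (ltngtP x z) => [xz|xz|/hxz]; try lia; ring.
Qed.

Lemma reg_op_far i j f w : (i.+1 < j)%N -> (j.+1 < n)%N ->
  reg_op i (reg_op j f) w = reg_op j (reg_op i f) w.
Proof.
move=> ij ltj; have lti : (i.+1 < n)%N by lia.
rewrite /reg_op !natperm_adjpM // [nat_swap i j]nat_swap_gt
  ?[nat_swap i j.+1]nat_swap_gt ?[nat_swap j i]nat_swap_lt
    ?[nat_swap j i.+1]nat_swap_lt; try lia.
by rewrite adjp_farM //; do 2!case: ifP => _; ring.
Qed.

Definition basis_fun u w : K := (w == u)%:R.

Lemma reg_op_basis_fun i u w : (i.+1 < n)%N ->
  (natperm u i < natperm u i.+1)%N ->
  reg_op i (basis_fun u) w = basis_fun (adjp n i * u)%g w.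
Proof.
move=> lti asc; rewrite /reg_op /basis_fun.
have -> : (adjp n i * w == u)%g = (w == adjp n i * u)%g.
  by rewrite -(inj_eq (@mulgI _ (adjp n i))) adjpKM.
have desc : (natperm (adjp n i * u)%g i < natperm (adjp n i * u)%g i.+1)%N =
  false.
  by rewrite !natperm_adjpM // nat_swapL nat_swapR ltnNge ltnW.
have [->|_] := eqVneq w (adjp n i * u)%g.
  rewrite desc; case: eqP => [e|_]; last by rewrite mulr0 addr0.
  by move: desc; rewrite e asc.
have [->|_] := eqVneq w u; first by rewrite asc mulr0.
by rewrite !mulr0 addr0 if_same.
Qed.

End RegularOperators.

Section RegularRepresentation.
Variables (K : fieldType) (v : K) (n : nat).
Local Notation V := {ffun 'S_n -> K^o}.

Lemma dimV_gt0 : (0 < dim V)%N.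
Proof. by rewrite /dim /= muln1 card_Sn fact_gt0. Qed.

Local Notation B := (lfun_algType dimV_gt0).

Definition reg_ffun i (f : V) : V := [ffun w => reg_op v i f w].

Lemma reg_ffun_linear i : linear (reg_ffun i).
Proof.
move=> c f g; apply/ffunP => w; rewrite !ffunE /reg_op !ffunE /GRing.scale /=.
by case: ifP => _; ring.
Qed.

HB.instance Definition _ i := GRing.isLinear.Build K V V *:%R (reg_ffun i)
  (reg_ffun_linear i).

Definition reg_lfun i : B := linfun (reg_ffun i).

Lemma reg_lfunE i (f : V) : (reg_lfun i : 'End(V)) f = reg_op v i f :> ('S_n ->
  K).
Proof. by apply: funext => w; rewrite lfunE /= ffunE. Qed.

(** Products of endomorphisms are composed in reverse, so a word acts by its
first letter first: as left multiplication by the reversed word. The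
anti-involution of H_n that reverses words makes this a representation all the
same. *)
Lemma reg_mulE (x y : B) f : ((x * y : B) : 'End(V)) f =
  (y : 'End(V)) ((x : 'End(V)) f).
Proof. exact: comp_lfunE. Qed.

Lemma reg_addE (x y : B) (f : V) w :
  ((x + y : B) : 'End(V)) f w = (x : 'End(V)) f w + (y : 'End(V)) f w.
Proof. by rewrite add_lfunE ffunE. Qed.

Lemma reg_scaleE c (x : B) (f : V) w :
  ((c *: x : B) : 'End(V)) f w = c * (x : 'End(V)) f w.
Proof. by rewrite scale_lfunE ffunE. Qed.

Lemma reg_oneE f : ((1 : B) : 'End(V)) f = f.
Proof. exact: id_lfunE. Qed.

Lemma reg_gens : hecke_gens v n reg_lfun.
Proof.
split=> [i lti|i lti|i j ltj ij]; apply/lfunP => f; apply/ffunP => w.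
- rewrite reg_mulE reg_addE !reg_scaleE reg_oneE !reg_lfunE; exact: reg_op_sqr.
- rewrite !reg_mulE !reg_lfunE; exact: reg_op_braid.
- rewrite !reg_mulE !reg_lfunE; exact/esym/reg_op_far.
Qed.

(** As the lengths add up, each letter meets an ascent, and only moves the basis
function. *)
Lemma reg_word_basis_fun s u : letters n s ->
  ninv (wperm n (rev s) * u)%g = (size s + ninv u)%N ->
  (Tword reg_lfun s : 'End(V)) (finfun (basis_fun K u)) =
  finfun (basis_fun K (wperm n (rev s) * u)%g).
Proof.
elim: s u => [|i s IHs] u; first by rewrite Tword_nil reg_oneE wperm_nil mul1g.
rewrite letters_cons Tword_cons reg_mulE rev_cons -cats1 wperm_cat wperm_cons.
rewrite wperm_nil mulg1 -mulgA => /andP[lti ls] e.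
have ls' : letters n (rev s) by rewrite /letters all_rev.
have le1 (w : 'S_n) : (ninv (wperm n (rev s) * w)%g <= size s + ninv w)%N.
  elim/last_ind: s {IHs e ls} ls' => [|t j IHt];
    first by rewrite wperm_nil mul1g.
  rewrite rev_rcons size_rcons letters_cons wperm_cons -mulgA => /andP[ltj lt].
  by rewrite (leq_trans (ninv_adjp_le _ ltj)) // ltnS IHt.
have asc : (natperm u i < natperm u i.+1)%N.
  have /orP[//|dsc] := natperm_asc_or u i.
  by have := le1 (adjp n i * u)%g; rewrite e (ninv_adjp_desc lti dsc) /=; lia.
rewrite -IHs //; last by rewrite e ninv_adjp // /= addSnnS.
congr (_ _); apply/ffunP => w; rewrite reg_lfunE ffunE -(reg_op_basis_fun v) //.
by rewrite /reg_op !ffunE.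
Qed.

End RegularRepresentation.

Section Instantiation.
Variables (K : fieldType) (v : K).
Local Notation H n := (hecke v n).
Local Notation T n := (heckeT v n).

Lemma heckeT_gens n : hecke_gens v n (T n).
Proof.
split=> [i|i|i j].
- rewrite -ltn_predRL => /(@heckeT_quadratic K v n).
  rewrite mulrDr mulr1 mulrBl mulr_algl => e.
  by apply: subr0_eq; rewrite -[RHS]e scalerBl scale1r !opprD opprK !addrA.
- by rewrite -ltn_predRL; apply: heckeT_braid.
- move=> ltj ij; apply: heckeT_commute; rewrite ?ltn_predRL ?ij //.
  by apply: ltn_trans ltj; apply: leq_trans ij _.
Qed.

Section Generation.
Import monalg.

Lemma hecke_full n x : gensub n (T n) predT x.
Proof.
have [z ->] := hecke_pi_surj x; rewrite [z]monalgE rmorph_sum.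
apply: (big_ind (gensub n (T n) predT)) => [|y y'|m _] /=;
  [exact: gensub0|exact: gensubD|].
have -> : << z@_m *g m >> = z@_m *: << m >>.
  apply/malgP => k; rewrite mcoeffZ !mcoeffU mulrnAr mulr1; reflexivity.
rewrite linearZ /=; apply: gensubZ; case: m => s.
elim: s => [|i s IHs].
  rewrite (_ : << _ >> = 1) ?rmorph1; first exact: gensub1.
  congr << _ >>; rewrite /mone /= fmoneE; reflexivity.
rewrite (_ : << _ >> = fvar K i * << FMonom s >>).
  rewrite rmorphM /= -heckeTE; apply: gensubM IHs.
  by apply: gensub_T; rewrite // -ltn_predRL.
rewrite /fvar malgM_def fgmulUU mulr1; congr << _ >>.
by apply/eqP; rewrite fmP fmM fmU.
Qed.

End Generation.

Lemma hecke_gens_rels n (B : algType K) (U : nat -> B) :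
  hecke_gens v n U -> hecke_rels v (fun i : 'I_n.-1 => U i).
Proof.
move=> relU; split=> [k|k l lk|k l kl].
- have := gens_sqr relU (adj_lt k).
  rewrite mulrDr mulr1 mulrBl mulr_algl => ->.
  rewrite scalerBl scale1r; have cancel (x y z : B) : x - y + z - x + (y - z) =
    0; last exact: cancel.
  by rewrite -(addrA x) -(addrA x) [_ - x]addrC addNKr addrACA addNr subrr
    addr0.
- by rewrite lk; apply: (gens_braid relU); rewrite -lk; apply: adj_lt.
- case/orP: kl => kl; first by apply: (gens_far relU) => //; apply: adj_lt.
  by apply/esym/(gens_far relU) => //; apply: adj_lt.
Qed.

Lemma hecke_lift_morph n (B : algType K) (U : nat -> B) : hecke_gens v n U ->
  alg_morph (hecke_lift (fun i : 'I_n.-1 => U i) : H n -> B).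
Proof.
move=> relU; have relf := hecke_gens_rels relU; split.
- exact: hecke_lift1.
- exact: hecke_liftM.
- exact: hecke_liftD.
- exact: hecke_liftZ.
Qed.

Lemma hecke_lift_T n (B : algType K) (U : nat -> B) i : hecke_gens v n U ->
  (i.+1 < n)%N -> hecke_lift (fun i : 'I_n.-1 => U i) (T n i) = U i.
Proof.
move=> relU; rewrite -ltn_predRL => lti.
exact: (hecke_liftT (hecke_gens_rels relU) (Ordinal lti)).
Qed.

Section CanonicalTrace.
Variable n : nat.

Definition reg_rep : H n -> lfun_algType (dimV_gt0 K n) :=
  hecke_lift (fun i : 'I_n.-1 => reg_lfun v n i).

(** The coefficient of T_1, read off the regular representation; reversing words
does not change it. *)
Definition canonical_trace (x : H n) : K :=
  (reg_rep x : 'End({ffun 'S_n -> K^o})) (finfun (basis_fun K 1%g)) 1%g.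

Lemma canonical_trace_scalar : scalar canonical_trace.
Proof.
move=> c x y; rewrite /canonical_trace /reg_rep.
have m := hecke_lift_morph (reg_gens v n).
by rewrite (alg_morphD m) (alg_morphZ m) reg_addE reg_scaleE.
Qed.

HB.instance Definition _ := GRing.isLinear.Build K (H n) K^o *%R canonical_trace
  canonical_trace_scalar.

Lemma canonical_traceP : hecke_trace v n (T n) canonical_trace.
Proof.
split=> [||w]; [exact: heckeT_gens | exact: hecke_full |].
have m := hecke_lift_morph (reg_gens v n).
rewrite /= /canonical_trace /Tw; set s := map _ _;
  have ls : letters n s by apply: letters_val.
have ws : wperm n s = w by apply: wperm_red_word.
have szs : size s = ninv w by rewrite /s size_map; apply: perm_lengthE.
have wrev t : letters n t -> wperm n (rev t) = (wperm n t)^-1%g.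
  elim: t => [|i t IHt]; first by rewrite wperm_nil invg1.
  rewrite letters_cons rev_cons -cats1 wperm_cat !wperm_cons => /andP[lti lt].
  by rewrite IHt // wperm_nil mulg1 invMg adjpV.
rewrite /reg_rep (alg_morph_Tword m (fun i => hecke_lift_T (reg_gens v n)) ls).
rewrite reg_word_basis_fun // mulg1 wrev // ws; last first.
  by rewrite ninvV szs ninv1 addn0.
by rewrite ffunE /basis_fun eq_sym invg_eq1.
Qed.

End CanonicalTrace.

Lemma hecke_emb_morph k a m : (a + m <= k)%N ->
  alg_morph (@hecke_emb K v k a m).
Proof.
move=> le_k; have rel := hecke_emb_rels v le_k; split.
- exact: hecke_lift1.
- exact: hecke_liftM.
- exact: hecke_liftD.
- exact: hecke_liftZ.
Qed.

Lemma hecke_emb_T k a m i : (a + m <= k)%N -> (i.+1 < m)%N ->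
  hecke_emb k a (T m i) = T k (a + i).
Proof.
move=> le_k; rewrite -ltn_predRL => lti.
exact: (hecke_liftT (hecke_emb_rels v le_k) (Ordinal lti)).
Qed.

Lemma reshape_index2 a b x : (x < a + b)%N -> reshape_index [:: a; b] x =
  (a <= x)%N.
Proof.
rewrite /reshape_index /= => xab; rewrite !subn_eq0; case: leqP => // ax.
by rewrite (_ : (x.+1 - a <= b)%N) //; lia.
Qed.

Lemma youngP a b (u : 'S_(a + b)) : u \in young (a + b) [:: a; b] <->
  young2 a u.
Proof.
rewrite inE; split=> [/forallP yu x|yu].
  have [ltx|nx] := ltnP x (a + b); last by rewrite natperm_ge.
  have := yu (Ordinal ltx); rewrite !reshape_index2 // -natpermE /= => /eqP e.
  by rewrite !ltnNge; move: e; case: (a <= natperm u x)%N; case: (a <= x)%N.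
apply/forallP => x; rewrite !reshape_index2 //.
by have := yu x; rewrite natpermE !ltnNge; case: (a <= u x)%N; case: (a <= x)%N.
Qed.

(** If j + 1 occurs before j for values of one class, then d s_j is shorter than
d and in the same coset. *)
Lemma min_coset_shuffle a b (d : 'S_(a + b)) :
  (d \in min_coset_reps (a + b) [:: a; b]) = shuffle a d.
Proof.
rewrite inE; apply/forallP/idP => [md|sd u].
  apply/shuffleP => j ltj ja.
  have [//|lt_d|/natperm_inj] :=
    ltngtP (natperm d^-1%g j) (natperm d^-1%g j.+1); last lia.
  have ysw : adjp (a + b) j \in young (a + b) [:: a;
    b] by apply/youngP/young2_adjp.
  have := md (adjp (a + b) j); rewrite ysw !perm_lengthE /=.
  by rewrite -ninvV (ninv_adjp_desc ltj lt_d) -[X in (_ <= X)%N]ninvV invMg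
    adjpV // ltnn.
apply/implyP => /youngP yu; rewrite !perm_lengthE (ninv_shuffleM sd yu).
exact: leq_addr.
Qed.

Lemma rel_norm_sum a b (z : H (a + b)) :
  rel_norm [:: a; b] z = norm_sum v (a + b) (T (a + b)) a z.
Proof.
rewrite /rel_norm /norm_sum; apply: eq_big => [d|d _];
  first exact: min_coset_shuffle.
rewrite perm_lengthE /hecke_Tw /Tw /Tword !big_map; reflexivity.
Qed.

Lemma rel_norm_one n : rel_norm [:: n] (1 : H n) = 1.
Proof.
have r1 (x : 'I_n) : reshape_index [:: n] x = 0%N.
  by rewrite /reshape_index /= (eqP (ltn_ord x)).
have allY (u : 'S_n) : u \in young n [:: n].
  by rewrite inE; apply/forallP => x; rewrite !r1.
rewrite /rel_norm (big_pred1 1%g) => [|w].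
  rewrite perm_lengthE ninv1 expr0 invr1 scale1r mulr1 invg1.
  have -> : hecke_Tw v (1 : 'S_n)%g = 1.
    have r0 : red_word (1 : 'S_n)%g = [::].
      by apply: size0nil; apply: etrans (perm_lengthE _) _; rewrite ninv1.
    by rewrite /hecke_Tw r0 big_nil.
  exact: mulr1.
rewrite inE; apply/forallP/eqP => [mw|-> u]; last first.
  by rewrite perm_lengthE ninv1 implybT.
have := mw w^-1%g; rewrite allY mulgV !perm_lengthE ninv1 leqn0 => /eqP.
exact: ninv_eq0.
Qed.

End Instantiation.

(** * Coefficients of the characteristic *)

Section Characteristic.
Variables (K : fieldType) (v : K).
Local Notation H n := (hecke v n).
Local Notation T n := (heckeT v n).
Implicit Types (x y z : hecke_sum v) (al be : seq nat).

Lemma centerP n (z : H n) : z \in hecke_center <-> forall h, z * h = h * z.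
Proof. by split=> [/asboolP|/asboolP]. Qed.

Lemma center_sumP x : x \in center_sum v <-> forall n h, x n * h = h * x n.
Proof.
split=> [/asboolP cx n|cx]; first by apply/centerP; apply: cx.
apply/asboolP => n; apply/centerP; exact: (cx n).
Qed.

Lemma hecke_inj_center n (z : H n) : (forall h, z * h = h * z) ->
  hecke_inj z \in center_sum v.
Proof.
move=> cz; apply/center_sumP => k h /=.
have [e|ne] := eqVneq n k; first by subst k; rewrite dfwith_in; apply: cz.
rewrite dfwith_out; last exact: ne.
rewrite mulr0 mul0r; reflexivity.
Qed.

Definition graded_unit n : hecke_sum v := hecke_inj (1 : H n).

Lemma graded_unit_center n : graded_unit n \in center_sum v.
Proof. apply: hecke_inj_center => h; rewrite mulr1 mul1r; reflexivity. Qed.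

Lemma rel_norm1E n : rel_norm1 v n = graded_unit n.
Proof. rewrite /rel_norm1 rel_norm_one; reflexivity. Qed.

Lemma graded_unit_out n k : n != k -> graded_unit n k = 0.
Proof. by move=> nk; exact: dfwith_out. Qed.

Definition deg_le N x := forall n, (N < n)%N -> x n = 0.

Lemma deg_le_ex x : exists N, deg_le N x.
Proof. by have [N xN] := dsumP x; exists N => n /ltnW /xN. Qed.

Lemma deg_le_leq N M x : (N <= M)%N -> deg_le N x -> deg_le M x.
Proof. by move=> NM xN n Mn; apply: xN; apply: leq_ltn_trans Mn. Qed.

Lemma deg_le_graded_unit n : deg_le n (graded_unit n).
Proof. by move=> k nk; apply: graded_unit_out; rewrite neq_ltn nk. Qed.

Lemma deg_le0 N : deg_le N 0. Proof. by move=> n _; reflexivity. Qed.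

Lemma deg_leD N x y : deg_le N x -> deg_le N y -> deg_le N (x + y).
Proof. by move=> xN yN n Nn; rewrite /= (xN n Nn) (yN n Nn); exact: addr0. Qed.

Lemma deg_leZ N c x : deg_le N x -> deg_le N (c *: x).
Proof. by move=> xN n Nn; rewrite /= (xN n Nn); exact: scaler0. Qed.

Lemma deg_le_circ N M x y : deg_le N x -> deg_le M y ->
  deg_le (N + M) (circ x y).
Proof.
move=> xN yM k ltk; apply: big1 => m _.
have mk : (m + (k - m))%N = k by rewrite subnKC // -ltnS.
have [mN|Nm] := leqP m N; last by rewrite (xN m Nm); exact: hecke_circ0l mk.
have km : (M < k - m)%N by lia.
by rewrite (yM _ km); exact: hecke_circ0r mk.
Qed.

Lemma hecke_circE k a b (z1 : H a) (z2 : H b) : (a + b)%N = k ->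
  hecke_circ k z1 z2 = norm_sum v k (T k) a (hecke_emb k 0 z1 *
    hecke_emb k a z2).
Proof. by move=> abk; subst k; apply: rel_norm_sum. Qed.

Hypothesis v0 : v != 0.

Lemma hecke_circ_central k a b (z1 : H a) (z2 : H b) h : (a + b)%N = k ->
  (forall h, z1 * h = h * z1) -> (forall h, z2 * h = h * z2) ->
  hecke_circ k z1 z2 * h = h * hecke_circ k z1 z2.
Proof.
move=> abk c1 c2; rewrite (hecke_circE _ _ abk).
have le1 : (0 + a <= k)%N by lia.
have le2 : (a + b <= k)%N by lia.
exact: (norm_tensor_central v0 abk (canonical_traceP v a) (canonical_traceP v b)
  (canonical_traceP v k) (hecke_emb_morph v le1) (hecke_emb_morph v le2)
  (fun i => hecke_emb_T v le1) (fun i => hecke_emb_T v le2)).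
Qed.

Lemma circ_center x y : x \in center_sum v -> y \in center_sum v ->
  circ x y \in center_sum v.
Proof.
move=> /center_sumP cx /center_sumP cy; apply/center_sumP => n h.
rewrite /= /circ_fun mulr_suml mulr_sumr; apply: eq_bigr => m _.
have mn : (m + (n - m))%N = n by rewrite subnKC // -ltnS.
exact: (hecke_circ_central _ mn (cx m) (cy _)).
Qed.

Lemma canonical_trace_linear n c (h g : H n) : canonical_trace (c *: h + g) =
  c * canonical_trace h + canonical_trace g.
Proof. exact: canonical_trace_scalar. Qed.

Lemma canonical_trace0 n : canonical_trace (0 : H n) = 0.
Proof. by have := canonical_trace_linear (-1) (0 : H n) 0;
  rewrite scaler0 add0r mulN1r addNr. Qed.

Lemma canonical_trace_sum n (I : Type) (r : seq I) (F : I -> H n) :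
  canonical_trace (\sum_(i <- r) F i) = \sum_(i <- r) canonical_trace (F i).
Proof.
apply: (big_morph (fun h : H n => canonical_trace h));
  last exact: canonical_trace0.
by move=> h g; have := canonical_trace_linear 1 h g; rewrite scale1r mul1r.
Qed.

Definition word_trace x n (s : seq nat) : K :=
  canonical_trace (x n * Tword (T n) s).

(** The coefficient of t^al in the characteristic of x. The powers of v - 1 make
the characteristic multiplicative, see [weight_split]. *)
Definition char_coef x al : K :=
  (v - 1) ^+ count (leq 1) al * word_trace x (sumn al) (cox_word 0 al).

Lemma word_trace_linear c x y n s : word_trace (c *: x + y) n s =
  c * word_trace x n s + word_trace y n s.
Proof. by rewrite /word_trace /= mulrDl -scalerAl canonical_trace_linear. Qed.

Lemma char_coef_linear c x y al : char_coef (c *: x + y) al =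
  c * char_coef x al + char_coef y al.
Proof. by rewrite /char_coef word_trace_linear mulrDr mulrCA. Qed.

Lemma canonical_trace_circ k a x y al : (a <= k)%N -> sumn al = k ->
  canonical_trace (hecke_circ k (x a) (y (k - a)%N) *
    Tword (T k) (cox_word 0 al)) =
  \sum_(be <- splittings al | sumn be == a) split_weight v al be *
    (word_trace x (sumn be) (cox_word 0 be) *
      word_trace y (sumn (complements al be)) (cox_word 0 (complements al be))).
Proof.
move=> ak sal; have abk : (a + (k - a))%N = k by rewrite subnKC.
have le1 : (0 + a <= k)%N by [].
have le2 : (a + (k - a) <= k)%N by rewrite abk.
rewrite (hecke_circE _ _ abk) (tau_norm_tensor v0 abk (canonical_traceP v a)
  (canonical_traceP v (k - a)) (canonical_traceP v k) (hecke_emb_morph v le1)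
  (hecke_emb_morph v le2) (fun i => hecke_emb_T v le1)
  (fun i => hecke_emb_T v le2)) //.
rewrite big_seq_cond [RHS]big_seq_cond; apply: eq_bigr => be /andP[sb /eqP sa].
have -> : sumn (complements al be) = (k - a)%N by have := sumn_splittings sb;
  lia.
by rewrite sa.
Qed.

(** A part r = (r - q) + q gives one nonzero part on the left and as many as
there are nonzero summands on the right; [part_weight] accounts for the
difference. *)
Lemma weight_split al be : be \in splittings al ->
  (v - 1) ^+ count (leq 1) al * split_weight v al be =
  (v - 1) ^+ count (leq 1) be * (v - 1) ^+ count (leq 1) (complements al be).
Proof.
elim: al be => [|r al IHal] be; first by rewrite splittings_nil => /eqP -> /=;
  rewrite mulr1.
case/splittings_consP => q [be' [-> qr /IHal e]] /=.
rewrite !exprD mulrACA e /part_weight.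
have -> : (v - 1) ^+ (0 < r)%N * (if (0 < r - q)%N && (0 < q)%N then v -
  1 else 1) =
  (v - 1) ^+ (0 < q)%N * (v - 1) ^+ (0 < r - q)%N.
  by case: q qr => [|q] qr; case e': (r - _)%N => [|p];
     case: r qr e' => [|r] qr e' //=; rewrite ?expr1 ?expr0 ?mulr1 ?mul1r //;
       lia.
by rewrite mulrACA.
Qed.

Lemma char_coef_circ x y al :
  char_coef (circ x y) al = \sum_(be <- splittings al) char_coef x be *
    char_coef y (complements al be).
Proof.
rewrite {1}/char_coef /word_trace /= /circ_fun mulr_suml canonical_trace_sum.
set k := sumn al; pose F be := split_weight v al be *
    (word_trace x (sumn be) (cox_word 0 be) *
      word_trace y (sumn (complements al be)) (cox_word 0 (complements al be))).
transitivity ((v - 1) ^+ count (leq 1) al * \sum_(be <- splittings al) F be).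
  congr (_ * _).
  rewrite (eq_bigr (fun m : 'I_k.+1 => \sum_(be <- splittings al | sumn be == m)
    F be)); last first.
    by move=> m _; apply: canonical_trace_circ; rewrite // -ltnS.
  rewrite (exchange_big_dep predT) //= big_seq_cond [RHS]big_seq_cond.
  apply: eq_bigr => be /andP[sb _].
  have lt_k : (sumn be < k.+1)%N by have := sumn_splittings sb; rewrite /k; lia.
  by rewrite (big_pred1 (Ordinal lt_k)).
rewrite mulr_sumr big_seq_cond [RHS]big_seq_cond;
  apply: eq_bigr => be /andP[sb _].
by rewrite /F /char_coef mulrA weight_split // mulrACA.
Qed.

Definition ctrace n (z : H n) (y : H n) : K := canonical_trace (z * y).

Lemma ctrace_scalar n (z : H n) : scalar (ctrace z).
Proof. by move=> c g h; rewrite /ctrace mulrDr -scalerAr canonical_trace_linear.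
  Qed.

HB.instance Definition _ n (z : H n) := GRing.isLinear.Build K (H n) K^o *%R
  (ctrace z) (ctrace_scalar z).

Lemma ctraceC n (z : H n) : (forall h, z * h = h * z) ->
  forall g h, ctrace z (g * h) = ctrace z (h * g).
Proof.
by move=> cz g h; apply: (tau_centralC (canonical_traceP v n)).
Qed.

Lemma center_eq0 n (z : H n) : (forall h, z * h = h * z) ->
  (forall al, sumn al = n -> all (leq 1) al ->
    canonical_trace (z * Tword (T n) (cox_word 0 al)) = 0) ->
  z = 0.
Proof.
move=> cz z0; apply: (tau_nondegenerate (canonical_traceP v n) v0) => y.
exact: (trace_vanish (heckeT_gens v n) (ctraceC cz)
  (hecke_full (v := v) (n := n)) z0).
Qed.

Lemma size_parts al : all (leq 1) al -> (size al <= sumn al)%N.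
Proof. by elim: al => //= r al IHal /andP[r1 /IHal]; lia. Qed.

Lemma char_coef_swap x l p q r : x \in center_sum v ->
  char_coef x (l ++ p :: q :: r) = char_coef x (l ++ q :: p :: r).
Proof.
move=> /center_sumP cx; rewrite /char_coef; congr (_ ^+ _ * _).
  by rewrite !count_cat /=; lia.
have e : sumn (l ++ q :: p :: r) = sumn (l ++ p :: q :: r).
  by rewrite !sumn_cat /=; lia.
rewrite e; apply: (chi_swap_parts (heckeT_gens v _) v0 (ctraceC (cx _))).
reflexivity.
Qed.

Lemma char_coef_graded_unit n al :
  char_coef (graded_unit n) al =
    (v - 1) ^+ n *+ ((sumn al == n) && all (leq^~ 1%N) al).
Proof.
rewrite /char_coef /word_trace; case: (eqVneq (sumn al) n) => [sal|ne];
  last first.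
  by rewrite graded_unit_out 1?eq_sym // mul0r canonical_trace0 mulr0.
rewrite sal /= dfwith_in mul1r (tau_Tword (canonical_traceP v n)); last 2 first.
- by rewrite -sal cox_word_letters.
- exact/ascending_sorted/cox_word_sorted.
rewrite cox_word_eq0; case: allP => [al1|_] /=; last by rewrite mulr0.
rewrite mulr1 -sal; congr (_ ^+ _).
elim: al {sal} al1 => //= r al IHal al1; rewrite IHal => [|x xal]; last first.
  by apply: al1; rewrite inE xal orbT.
by have := al1 r (mem_head _ _); case: r {al1} => [|[|r]].
Qed.

Hypothesis v1 : v != 1.

(** Zero parts change neither the Coxeter word nor the power of v - 1, so
sequences of length k detect everything in degrees up to k. *)
Lemma char_coef_eq0 k x : x \in center_sum v ->
  (forall n, (k < n)%N -> x n = 0) ->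
  (forall al, size al = k -> char_coef x al = 0) -> x = 0.
Proof.
move=> /center_sumP cx xk x0; apply: dsum_eqP => n.
have [nk|kn] := leqP n k; last exact: (xk n kn).
apply: (center_eq0 (cx n)) => al sal al1.
(* All parts of al are positive, so there are at most n <= k of them. *)
pose al' := al ++ nseq (k - size al) 0%N.
have sal' : sumn al' = n by rewrite sumn_cat sumn_nseq mul0n addn0.
have := x0 al'; rewrite size_cat size_nseq subnKC; last first.
  by rewrite (leq_trans (size_parts al1)) ?sal.
move=> /(_ erefl) /eqP; rewrite /char_coef mulf_eq0 expf_eq0 subr_eq0
  (negbTE v1) andbF /=.
by rewrite sal' /word_trace cox_word_cat cox_word_nseq0 cats0 => /eqP.
Qed.

End Characteristic.

(** * The characteristic as a symmetric polynomial *)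

From mathcomp Require Import mpoly.

Section Polynomials.
Variable k : nat.

Definition parts (m : 'X_{1..k}) : seq nat := multinom_val m.

Lemma size_parts_m m : size (parts m) = k.
Proof. exact: size_tuple. Qed.

Lemma nth_parts m (i : 'I_k) : nth 0%N (parts m) i = m i.
Proof. by rewrite mnm_tnth (tnth_nth 0%N). Qed.

Lemma sumn_parts m : sumn (parts m) = mdeg m.
Proof. by rewrite sumnE. Qed.

Lemma parts_inj : injective parts.
Proof. by move=> m m' /val_inj/(congr1 (@Multinom k));
  case: m m' => [?] [?]. Qed.

Lemma parts_surj al : size al = k -> exists m, parts m = al.
Proof.
by move=> sal; exists (Multinom (Tuple (introT eqP sal))).
Qed.

Lemma splittings_nthP al be : reflect
  (size be = size al /\ forall i, (nth 0 be i <= nth 0 al i)%N)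
    (be \in splittings al).
Proof.
apply: (iffP idP) => [sb|[]].
  split; first exact: size_splittings.
  elim: al be sb => [|r al IHal] be; first by rewrite splittings_nil => /eqP ->
    i; rewrite nth_nil.
  by case/splittings_consP => q [be' [-> qr sb]] [|i] //=; apply: IHal.
elim: al be => [|r al IHal] [|q be] //= [sz] le;
  rewrite splittings_cons (le 0%N) /=.
by apply: IHal => // i; apply: (le i.+1).
Qed.

Lemma nth_complements al be i : be \in splittings al ->
  nth 0%N (complements al be) i = (nth 0 al i - nth 0 be i)%N.
Proof.
elim: al be i => [|r al IHal] be i; first by rewrite splittings_nil => /eqP ->
  /=; rewrite nth_nil.
by case/splittings_consP => q [be' [-> qr sb]]; case: i => //= i; apply: IHal.
Qed.

Lemma splittings_parts m p q : m = (p + q)%MM ->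
  parts p \in splittings (parts m) /\ complements (parts m) (parts p) = parts q.
Proof.
move=> e; have nthm i : (i < k)%N -> nth 0%N (parts m) i =
  (nth 0%N (parts p) i + nth 0%N (parts q) i)%N.
  by move=> ik; rewrite -[ i ]/(val (Ordinal ik)) !nth_parts e mnmDE.
have sb : parts p \in splittings (parts m).
  apply/splittings_nthP; split=> [|i]; first by rewrite !size_parts_m.
  have [ik|ki] := ltnP i k; first by rewrite nthm // leq_addr.
  by rewrite !nth_default ?size_parts_m.
split=> //; apply: (@eq_from_nth _ 0%N).
  by rewrite size_complements // !size_parts_m.
move=> i; rewrite size_complements // size_parts_m => ik.
by rewrite nth_complements // nthm // addKn.
Qed.

Lemma sum_splittings (V : zmodType) (F : seq nat -> seq nat ->
  V) (m : 'X_{1..k}) :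
  \sum_(be <- splittings (parts m)) F be (complements (parts m) be) =
  \sum_(p : 'X_{1..k < (mdeg m).+1, (mdeg m).+1} | m == (p.1 + p.2)%MM)
    F (parts p.1) (parts p.2).
Proof.
pose B := 'X_{1..k < (mdeg m).+1}.
rewrite [RHS](eq_bigr (fun p : B * B =>
  F (parts p.1) (complements (parts m) (parts p.1)))); last first.
  by move=> p /eqP/splittings_parts[_ ->].
rewrite -big_filter -(big_map (fun p : B * B => parts p.1) predT
  (fun be => F be (complements (parts m) be))).
apply: perm_big; apply: uniq_perm; first exact: splittings_uniq.
  rewrite map_inj_in_uniq ?filter_uniq ?index_enum_uniq // => -[p q] [p' q'].
  rewrite !mem_filter /= => /andP[/eqP e _] /andP[/eqP e' _] /parts_inj epp.
  congr (_, _); apply: val_inj => //=; apply/eqP.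
  by rewrite -(eqm_add2l p) -e epp -e'.
move=> be; apply/idP/mapP => [sb|[p]]; last first.
  by rewrite mem_filter => /andP[/eqP/splittings_parts[sb _] _ ->].
have [p ep] : exists p, parts p = be by apply: parts_surj;
  rewrite (size_splittings sb) size_parts_m.
have [q eq] : exists q, parts q = complements (parts m) be.
  by apply: parts_surj; rewrite (size_complements sb) size_parts_m.
have em : m = (p + q)%MM.
  apply/mnmP => i; rewrite mnmDE -!nth_parts ep eq nth_complements // subnKC //.
  by have /splittings_nthP[_ ->] := sb.
have degp : (mdeg p < (mdeg m).+1)%N by rewrite em mdegD ltnS leq_addr.
have degq : (mdeg q < (mdeg m).+1)%N by rewrite em mdegD ltnS leq_addl.
exists (BMultinom degp, BMultinom degq); rewrite ?ep //.
by rewrite mem_filter /= -em eqxx mem_index_enum.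
Qed.

End Polynomials.

Section Characteristic.
Variables (K : fieldType) (v : K).
Hypothesis v0 : v != 0.
Variable k : nat.
Implicit Types (x y z : hecke_sum v) (m : 'X_{1..k}).

Definition hdeg x : nat := projT1 (cid (deg_le_ex x)).

Lemma hdegP x : deg_le (hdeg x) x.
Proof. exact: projT2 (cid (deg_le_ex x)). Qed.

(** The characteristic in k variables; [hdeg] only provides a finite range, see
[mcoeff_center_char]. *)
Definition center_char x : {mpoly K[k]} :=
  \sum_(m : 'X_{1..k < (hdeg x).+1}) char_coef x (parts m) *: 'X_[m].

Lemma char_coef_deg N x al : deg_le N x -> (N < sumn al)%N ->
  char_coef x al = 0.
Proof. by move=> xN Nal;
  rewrite /char_coef /word_trace (xN _ Nal) mul0r canonical_trace0 mulr0. Qed.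

Lemma mcoeff_center_char x m : (center_char x)@_m = char_coef x (parts m).
Proof.
rewrite /center_char raddf_sum /=; have [lt_m|ge_m] :=
  ltnP (mdeg m) (hdeg x).+1.
  rewrite (bigD1 (BMultinom lt_m)) //= mcoeffZ mcoeffX eqxx mulr1 big1 ?addr0
    //.
  move=> i; rewrite -val_eqE /= => /negbTE ne.
  by rewrite mcoeffZ mcoeffX ne mulr0.
rewrite (char_coef_deg (@hdegP x)) ?sumn_parts // big1 // => i _.
rewrite mcoeffZ mcoeffX; case: eqP => [e|_]; last by rewrite mulr0.
by have := bmdeg i; rewrite e ltnNge ge_m.
Qed.

Lemma center_char_linear c x y : center_char (c *: x + y) = c *: center_char x +
  center_char y.
Proof. by apply/mpolyP => m;
  rewrite mcoeffD mcoeffZ !mcoeff_center_char char_coef_linear. Qed.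

Lemma center_char0 : center_char 0 = 0.
Proof.
by apply/mpolyP => m; rewrite mcoeff_center_char mcoeff0 /char_coef /word_trace
  /= mul0r canonical_trace0 mulr0.
Qed.

Lemma center_char_circ x y : center_char (circ x y) =
  center_char x * center_char y.
Proof.
apply/mpolyP => m; rewrite mcoeffM mcoeff_center_char (char_coef_circ v0).
rewrite (sum_splittings (fun be ga => char_coef x be * char_coef y ga)).
by apply: eq_bigr => p _; rewrite !mcoeff_center_char.
Qed.

Lemma center_char_graded_unit n : center_char (graded_unit v n) =
  (v - 1) ^+ n *: mesym k K n.
Proof.
apply/mpolyP => m; rewrite mcoeff_center_char char_coef_graded_unit mcoeffZ
  mcoeff_mesym mulr_natr.
congr (_ *+ nat_of_bool _); rewrite /mechar sumn_parts; congr (_ && _).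
apply/allP/forallP => [h i|h j]; first by rewrite -nth_parts; apply: h;
  rewrite mem_nth ?size_parts_m.
by case/(nthP 0%N) => i; rewrite size_parts_m => ik <-; have := h (Ordinal ik);
  rewrite -nth_parts.
Qed.

Lemma msize_center_char N x : deg_le N x -> (msize (center_char x) <= N.+1)%N.
Proof.
move=> xN; rewrite msizeE; apply/bigmax_leqP_seq => m.
rewrite mcoeff_msupp mcoeff_center_char => nz _; rewrite ltnS leqNgt;
  apply: contra nz => Nm.
by rewrite (char_coef_deg xN) // sumn_parts.
Qed.

Lemma parts_perm_adj m (i : 'I_k.-1) :
  exists l p q r, parts m = l ++ p :: q :: r /\
    parts [multinom m (adj_tperm i j) | j < k] = l ++ q :: p :: r.
Proof.
have lti := adj_lt i; have sz := size_parts_m m.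
exists (take i (parts m)), (nth 0%N (parts m) i), (nth 0%N (parts m) i.+1),
  (drop i.+2 (parts m)).
split.
  rewrite -[LHS](cat_take_drop i) [drop i _](drop_nth 0%N) ?sz ?(ltnW lti) //.
  by rewrite [drop i.+1 _](drop_nth 0%N) ?sz ?lti.
have szt : size (take i (parts m)) = i by rewrite size_takel // sz; lia.
apply: (@eq_from_nth _ 0%N).
  by rewrite size_parts_m size_cat /= size_drop szt sz; lia.
move=> j; rewrite size_parts_m => jk; rewrite nth_cat szt.
rewrite -[j]/(val (Ordinal jk)) nth_parts mnmE -nth_parts /=.
have -> : (adj_tperm i (Ordinal jk) : nat) = nat_swap i j.
  by rewrite -adjpE -natpermE natperm_adjp.
rewrite /nat_swap; have [ji|ij] := ltnP j i.
  by rewrite nth_take //; do 2!(case: eqP; first lia).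
have [ej|nj] := eqVneq j i; first by rewrite ej subnn.
have [ej|nSj] := eqVneq j i.+1; first by rewrite ej subSnn.
have -> : (j - i = (j - i.+2).+2)%N by lia.
by rewrite /= nth_drop; congr (nth _ _ _); lia.
Qed.

(** An adjacent transposition of the exponents exchanges two neighbouring parts,
and adjacent transpositions generate. *)
Lemma center_char_sym x : x \in center_sum v -> center_char x \is symmetric.
Proof.
move=> cx; pose good (s : 'S_k) := forall m,
  char_coef x (parts [multinom m (s i) | i < k]) = char_coef x (parts m).
have goodM s t : good s -> good t -> good (s * t)%g.
  by move=> gs gt m; rewrite mpermM; apply: etrans (gs _) (gt m).
apply/issymP => s; apply/mpolyP => m; rewrite mcoeff_sym !mcoeff_center_char.
suff: good s by [].
have [t <-] := word_permE s; rewrite /word_perm.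
elim/big_ind: _ => [m'|u w gu gw|i _ m'].
- by rewrite mperm1.
- exact: goodM.
- have [l [p [q [r [-> ->]]]]] := parts_perm_adj m' i.
  by rewrite (char_coef_swap v0 _ _ _ _ cx).
Qed.

Hypothesis v1 : v != 1.

Lemma center_char_eq0 x : x \in center_sum v -> deg_le k x ->
  center_char x = 0 -> x = 0.
Proof.
move=> cx xk px; apply: (char_coef_eq0 v0 v1 cx xk) => al sal.
by have [m em] := parts_surj sal; rewrite -em -mcoeff_center_char px mcoeff0.
Qed.

End Characteristic.

Section ElementarySymmetric.
Variables (K : fieldType) (k : nat).
Local Notation S := [tuple mesym k K i.+1 | i < k].

Lemma comp_mesymX (m : 'X_{1..k}) :
  'X_[m] \mPo S = \prod_(i < k) mesym k K i.+1 ^+ m i.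
Proof.
rewrite comp_mpolyX; apply: eq_bigr => i _.
by rewrite tnth_mktuple.
Qed.

Lemma mesym_free (I : eqType) (r : seq I) (E : I -> 'X_{1..k}) (a : I -> K) :
  uniq r -> {in r &, injective E} ->
  \sum_(m <- r) a m *: \prod_(i < k) mesym k K i.+1 ^+ E m i = 0 ->
  forall m, m \in r -> a m = 0.
Proof.
move=> ur injE e0 m mr; pose q : {mpoly K[k]} := \sum_(m <- r) a m *: 'X_[E m].
have q0 : q = 0.
  apply: msym_fundamental_un0; rewrite -[RHS]e0 /q raddf_sum /=;
    apply: eq_bigr => j _.
  by rewrite linearZ /= comp_mesymX.
have := mcoeff0 K (E m);
  rewrite -q0 /q raddf_sum /= (bigD1_seq m) //= mcoeffZ mcoeffX eqxx.
rewrite mulr1 big_seq_cond big1 ?addr0 // => j /andP[jr jm].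
rewrite mcoeffZ mcoeffX; case: eqP => [ej|_]; last by rewrite mulr0.
by rewrite (injE _ _ jr mr ej) eqxx in jm.
Qed.

(** The bound on the weight controls the degrees of the central elements that
are built from this expansion. *)
Lemma mesym_span N (p : {mpoly K[k]}) : p \is symmetric ->
  (msize p <= N.+1)%N ->
  exists (r : seq 'X_{1..k}) (a : 'X_{1..k} -> K),
    p = \sum_(m <- r) a m *: \prod_(i < k) mesym k K i.+1 ^+ m i /\
    forall m, m \in r -> (\sum_(i < k) m i * i.+1 <= N)%N.
Proof.
move=> /sym_fundamental[t [<- wt]] szp.
exists (msupp t), (fun m => t@_m); split=> [|m mt].
  rewrite comp_mpolyEX; apply: eq_bigr => m _; by rewrite comp_mesymX.
rewrite -ltnS (leq_trans _ szp) // (leq_trans _ wt) //.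
exact: mmeasure_mnm_lt.
Qed.

End ElementarySymmetric.

(** * The algebra of centers *)

From mathcomp Require Import monalg.

Section CommutativeMonomials.
Variables (R : comNzRingType) (I : choiceType) (f : I -> R).
Local Open Scope fset_scope.

Definition cmeval (m : {cmonom I}) : R := \prod_(i <- finsupp m) f i ^+ m i.

Lemma cmevalw (m : {cmonom I}) (d : {fset I}) : finsupp m `<=` d ->
  cmeval m = \prod_(i <- d) f i ^+ m i.
Proof.
move=> le; rewrite /cmeval (big_fset_incl _ le) //.
by move=> i _; rewrite -cmE_neq0 negbK => /eqP ->; rewrite expr0.
Qed.

Lemma cmeval_mmorphism : mmorphism cmeval.
Proof.
split=> [m1 m2|]; last by rewrite /cmeval mdom1 big_seq_fset0.
rewrite (@cmevalw m1 _ (fsubsetUl _ (finsupp m2)))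
  (@cmevalw m2 _ (fsubsetUr (finsupp m1) _)).
rewrite /cmeval mdomD -big_split /=; apply: eq_bigr => i _.
by rewrite cmM exprD.
Qed.

HB.instance Definition _ := isMultiplicative.Build _ _ cmeval cmeval_mmorphism.

Lemma cmevalU i : cmeval (ucm i) = f i.
Proof. by rewrite /cmeval mdomU big_seq_fset1 cmUU expr1. Qed.

End CommutativeMonomials.

Lemma cmeval_ord (R : comNzRingType) (f : nat -> R) (m : {cmonom nat}) k :
  (forall i, i \in finsupp m -> (i < k)%N) ->
  cmeval f m = \prod_(i < k) f i ^+ m i.
Proof.
move=> mk; rewrite -(big_mkord xpredT (fun i => f i ^+ m i)).
rewrite (bigID (fun i => i \in finsupp m)) /= [X in _ * X]big1 ?mulr1;
  last first.
  by move=> i; rewrite -cmE_eq0 => /eqP ->; rewrite expr0.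
rewrite -big_filter; apply: perm_big; apply: uniq_perm; first exact: fset_uniq.
  by rewrite filter_uniq ?iota_uniq.
move=> i; rewrite mem_filter mem_index_iota /=.
by apply/idP/andP => [im|[]//]; rewrite im mk.
Qed.

Section CenterAlgebra.
Variables (K : fieldType) (v : K).
Hypotheses (v0 : v != 0) (v1 : v != 1).

Lemma center_sum_zmod : zmod_closed (center_sum v).
Proof.
split=> [|x y /center_sumP cx /center_sumP cy]; apply/center_sumP => n h.
  by rewrite /= mul0r mulr0.
by rewrite /= mulrBl mulrBr cx cy.
Qed.

Lemma center_sum_scaler c x : x \in center_sum v -> c *: x \in center_sum v.
Proof.
move=> /center_sumP cx; apply/center_sumP => n h.
by rewrite /= -scalerAl -scalerAr cx.
Qed.

End CenterAlgebra.

HB.instance Definition _ (K : fieldType) (v : K) :=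
  GRing.isZmodClosed.Build (hecke_sum v) (center_sum v) (center_sum_zmod v).
HB.instance Definition _ (K : fieldType) (v : K) :=
  GRing.isScaleClosed.Build K (hecke_sum v) (center_sum v)
    (@center_sum_scaler K v).

Section CenterType.
Variables (K : fieldType) (v : K).

(** The conditions on v are parameters, since the product is commutative and
associative by virtue of them. *)
Record centers (v0 : v != 0) (v1 : v != 1) := Centers {
  centers_val :> hecke_sum v; centersP : centers_val \in center_sum v }.

Variables (v0 : v != 0) (v1 : v != 1).
Local Notation Z := (centers v0 v1).

HB.instance Definition _ := [isSub for @centers_val v0 v1].
HB.instance Definition _ := [Choice of Z by <:].
HB.instance Definition _ := [SubChoice_isSubZmodule of Z by <:].
HB.instance Definition _ := [SubZmodule_isSubLmodule of Z by <:].

(** Enough variables detect any given range of degrees. *)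
Lemma center_char_inj (x y : Z) : (forall k, center_char k x = center_char k y)
  -> x = y.
Proof.
move=> e; have [N xN] := deg_le_ex x; have [M yM] := deg_le_ex y.
apply/eqP; rewrite -subr_eq0; apply/eqP; apply: val_inj.
apply: (center_char_eq0 v0 v1 (k := maxn N M)); first exact: valP.
  rewrite /= -scaleN1r; apply: deg_leD; [|apply: deg_leZ];
    apply: deg_le_leq; [|exact: xN| |exact: yM]; lia.
by rewrite /= addrC -scaleN1r center_char_linear e scaleN1r addNr.
Qed.

Definition centers_one : Z := Centers v0 v1 (graded_unit_center v 0).
Definition centers_mul (x y : Z) : Z :=
  Centers v0 v1 (circ_center v0 (centersP x) (centersP y)).

Lemma centers_mulA : associative centers_mul.
Proof. by move=> x y z; apply: center_char_inj => k;
  rewrite !(center_char_circ v0) mulrA. Qed.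
Lemma centers_mulC : commutative centers_mul.
Proof. by move=> x y; apply: center_char_inj => k;
  rewrite !(center_char_circ v0) mulrC. Qed.

Lemma center_char_one k : center_char k (graded_unit v 0) = 1.
Proof. by rewrite center_char_graded_unit expr0 scale1r mesym0E. Qed.

Lemma centers_mul1 : left_id centers_one centers_mul.
Proof. by move=> x; apply: center_char_inj => k;
  rewrite (center_char_circ v0) center_char_one mul1r. Qed.

Lemma centers_mulDl : left_distributive centers_mul +%R.
Proof.
move=> x y z; apply: val_inj => /=.
have := circ_linearl (val z) 1 (val x) (val y); rewrite !scale1r; exact.
Qed.

Lemma centers_1neq0 : centers_one != 0.
Proof.
apply/eqP => /(congr1 (fun x : Z => center_char 0 x));
  rewrite /= center_char_one center_char0 => /eqP.
by rewrite oner_eq0.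
Qed.

HB.instance Definition _ := GRing.Zmodule_isComNzRing.Build Z
  centers_mulA centers_mulC centers_mul1 centers_mulDl centers_1neq0.

Lemma centers_scaleAl (c : K) (x y : Z) : c *: (x * y) = (c *: x) * y.
Proof.
apply: center_char_inj => k; have e (z : Z) : center_char k (c *: val z) =
  c *: center_char k z.
  by rewrite -[_ *: _]addr0 center_char_linear center_char0 addr0.
rewrite (_ : val (c *: (x * y)) = c *: val (x * y)) // e.
rewrite (_ : val (c *: x * y) = circ (c *: val x) (val y)) //.
by rewrite !(center_char_circ v0) e scalerAl.
Qed.

HB.instance Definition _ := GRing.Lmodule_isLalgebra.Build K Z centers_scaleAl.
HB.instance Definition _ := GRing.Lalgebra_isComAlgebra.Build K Z.

Section Character.
Variable k : nat.

Definition centers_char (x : Z) : mpoly k K := center_char k x.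

Lemma centers_char_zmod : zmod_morphism centers_char.
Proof.
move=> x y; rewrite /centers_char (_ : val (x - y) = (-1) *: val y + val x).
  by rewrite center_char_linear scaleN1r addrC.
by rewrite scaleN1r addrC.
Qed.
HB.instance Definition _ := GRing.isZmodMorphism.Build Z (mpoly k K)
  centers_char centers_char_zmod.

Lemma centers_char_monoid : monoid_morphism centers_char.
Proof. by split=> [|x y];
  [exact: center_char_one | exact: (center_char_circ v0)]. Qed.
HB.instance Definition _ := GRing.isMonoidMorphism.Build Z (mpoly k K)
  centers_char centers_char_monoid.

Lemma centers_char_scalable : scalable centers_char.
Proof.
move=> c x; rewrite /centers_char (_ : val (c *: x) = c *: val x + 0);
  last by rewrite addr0.
by rewrite center_char_linear center_char0 addr0.
Qed.
HB.instance Definition _ := GRing.isScalable.Build K Z (mpoly k K) *:%R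
  centers_char centers_char_scalable.

End Character.

Definition centers_unit n : Z := Centers v0 v1 (graded_unit_center v n).

Lemma centers_char_unit k n : centers_char k (centers_unit n) =
  (v - 1) ^+ n *: mesym k K n.
Proof. exact: center_char_graded_unit. Qed.

(** The substitution of N_(i+1)(1) for the i-th variable. *)
Definition centers_eval (p : {malg K[{cmonom nat}]}) : Z :=
  mmap (in_alg Z) (cmeval (fun i => centers_unit i.+1)) p.

Lemma centers_eval_zmod : zmod_morphism centers_eval.
Proof. by move=> p q; apply: (raddfB (mmap (in_alg Z) _)). Qed.
HB.instance Definition _ := GRing.isZmodMorphism.Build {malg K[{cmonom nat}]} Z
  centers_eval centers_eval_zmod.

Lemma centers_eval_monoid : monoid_morphism centers_eval.
Proof.
by split=> [|p q]; [exact: (rmorph1 (mmap (in_alg Z) _))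
  | exact: (rmorphM (mmap (in_alg Z) _))].
Qed.
HB.instance Definition _ := GRing.isMonoidMorphism.Build {malg K[{cmonom nat}]}
  Z centers_eval centers_eval_monoid.

Lemma centers_eval_scalable : scalable centers_eval.
Proof. by move=> c p; rewrite /centers_eval mmapZ /= mulr_algl. Qed.
HB.instance Definition _ := GRing.isScalable.Build K {malg K[{cmonom nat}]} Z
  *:%R centers_eval centers_eval_scalable.

Lemma centers_eval_var i : centers_eval << ucm i >> = centers_unit i.+1.
Proof. by rewrite /centers_eval mmapU /= scale1r mul1r cmevalU. Qed.

Lemma pow_neq0 n : (v - 1) ^+ n != 0.
Proof. by rewrite expf_neq0 // subr_eq0. Qed.

Lemma centers_char_monomial k (E : 'I_k -> nat) :
  centers_char k (\prod_(i < k) centers_unit i.+1 ^+ E i) =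
  (\prod_(i < k) (v - 1) ^+ (i.+1 * E i)) *: \prod_(i < k) mesym k K i.+1 ^+ E
    i.
Proof.
rewrite rmorph_prod /= -scaler_prod; apply: eq_bigr => i _.
by rewrite rmorphXn /= centers_char_unit exprZn exprM.
Qed.

Lemma weight_neq0 k (E : 'I_k -> nat) : \prod_(i < k) (v - 1) ^+ (i.+1 * E i) !=
  0.
Proof. by apply/prodf_neq0 => i _; apply: pow_neq0. Qed.

(** In as many variables as occur in p, the characteristic of the image of p is
a polynomial in the elementary symmetric polynomials, whose coefficients are
those of p up to powers of v - 1. *)
Lemma centers_eval_eq0 p : centers_eval p = 0 -> p = 0.
Proof.
move=> p0; pose k := (\max_(m <- msupp p) \max_(i <- finsupp m) i.+1)%N.
have mk m i : m \in msupp p -> i \in finsupp m -> (i < k)%N.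
  move=> mp im; pose F (u : {cmonom nat}) := (\max_(j <- finsupp u) j.+1)%N.
  have im' : i \in enum_fset (finsupp m) by [].
  have mp' : m \in enum_fset (msupp p) by [].
  apply: (@leq_trans (F m));
    last exact: (leq_bigmax_seq _ (P := xpredT) (F := F)).
  exact: (leq_bigmax_seq _ (P := xpredT) (F := succn)).
pose E (m : {cmonom nat}) : multinom k := [multinom m i | i < k]%MM.
have := congr1 (centers_char k) p0;
  rewrite raddf0 /centers_eval mmapE raddf_sum /= => e0.
have {}e0 : \sum_(m <- msupp p)
  (mcoeff m p * \prod_(i < k) (v - 1) ^+ (i.+1 * E m i)) *:
    \prod_(i < k) mesym k K i.+1 ^+ E m i = 0.
  rewrite -[RHS]e0 big_seq_cond [RHS]big_seq_cond;
    apply: eq_bigr => m /andP[mp _].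
  rewrite mulr_algl linearZ /= (@cmeval_ord _ _ m k (fun i => mk m i mp)).
  rewrite (centers_char_monomial (fun i => m i)) scalerA.
  by congr ((_ * _) *: _); apply: eq_bigr => i _; rewrite mnmE.
have injE : {in msupp p &, injective E}.
  move=> m m' mp mp' /mnmP e; apply/eqP/cmP => i.
  have [ik|ki] := ltnP i k.
    by have := e (Ordinal ik); rewrite !mnmE.
  have out (u : {cmonom nat}) : u \in msupp p -> u i = 0%N.
    move=> up; apply/eqP; rewrite cmE_eq0; apply/negP => /(mk _ _ up); lia.
  by rewrite !out.
have a0 := mesym_free (fset_uniq _) injE e0.
apply/malgP => m; rewrite mcoeff0; case: (boolP (m \in msupp p)) => [mp|mp].
  by have /eqP := a0 m mp; rewrite mulf_eq0 (negbTE (weight_neq0 _)) orbF =>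
    /eqP.
by rewrite mcoeff_outdom.
Qed.

Lemma deg_le_prod k (E : 'I_k -> nat) :
  deg_le (\sum_(i < k) E i * i.+1)%N
    (val (\prod_(i < k) centers_unit i.+1 ^+ E i : Z)).
Proof.
elim/big_rec2: _ => [|i N y _ yN]; first exact: (@deg_le_graded_unit _ v 0).
apply: deg_le_circ yN; elim: (E i) => [|e IHe];
  first exact: (@deg_le_graded_unit _ v 0).
by rewrite mulSn exprS; apply: deg_le_circ IHe; apply: deg_le_graded_unit.
Qed.

Definition centers_phi (p : {malg K[{cmonom nat}]}) : hecke_sum v :=
  centers_eval p.

Lemma centers_phi_zmod : zmod_morphism centers_phi.
Proof. by move=> p q; rewrite /centers_phi raddfB. Qed.
HB.instance Definition _ := GRing.isZmodMorphism.Build {malg K[{cmonom nat}]}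
  (hecke_sum v) centers_phi centers_phi_zmod.

Lemma centers_phi_scalable : scalable centers_phi.
Proof. by move=> c p; rewrite /centers_phi linearZ. Qed.
HB.instance Definition _ := GRing.isScalable.Build K {malg K[{cmonom nat}]}
  (hecke_sum v) *:%R centers_phi centers_phi_scalable.

(** Let N bound the degrees of z. The characteristic of z in N variables is a
polynomial in e_1, ..., e_N of weight at most N; the same polynomial in the
N_i(1) has no component of degree above N, and N variables detect the rest. *)
Lemma centers_eval_surj z : exists p, centers_eval p = z.
Proof.
have [N zN] := deg_le_ex (val z).
have sz : centers_char N z \is symmetric by apply: (center_char_sym v0);
  apply: valP.
have [r [a [ez wr]]] := mesym_span sz (msize_center_char N zN).
(* The denominator cancels the scalars of centers_char_unit. *)
pose b m := a m / \prod_(i < N) (v - 1) ^+ (i.+1 * fun_of_multinom m i).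
pose p : {malg K[{cmonom nat}]} := \sum_(m <- r) b m *:
  \prod_(i < N) << ucm (val i) >> ^+ fun_of_multinom m i.
have ep : centers_eval p = \sum_(m <- r) b m *: \prod_(i < N) centers_unit i.+1
  ^+ fun_of_multinom m i.
  rewrite /p raddf_sum; apply: eq_bigr => m _ /=.
  rewrite linearZ /= rmorph_prod; congr (_ *: _); apply: eq_bigr => i _ /=.
  by rewrite rmorphXn /= centers_eval_var.
exists p; apply/eqP; rewrite -subr_eq0; apply/eqP; apply: val_inj.
apply: (center_char_eq0 v0 v1 (k := N)); first exact: valP.
  rewrite /= -scaleN1r; apply: deg_leD; last exact: deg_leZ.
  rewrite ep; elim: (r) wr => [|m r' IHr] wr; first by rewrite big_nil;
    apply: deg_le0.
  rewrite big_cons /=; apply: deg_leD; last first.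
    by apply: IHr => m' m'r; apply: wr; rewrite inE m'r orbT.
  apply: deg_leZ; apply: deg_le_leq (wr m (mem_head _ _)) _.
  exact: deg_le_prod.
have -> : val (centers_eval p - z) =
  (-1) *: val z + val (centers_eval p) by rewrite scaleN1r addrC.
rewrite center_char_linear -[center_char N (val z)]/(centers_char N z)
  -[center_char N _]/(centers_char N (centers_eval p)) scaleN1r.
apply/eqP; rewrite addrC subr_eq0; apply/eqP; rewrite ez ep raddf_sum /=.
apply: eq_bigr => m _; rewrite linearZ /= (centers_char_monomial (fun i => m i))
  scalerA.
by rewrite /b divfK // weight_neq0.
Qed.

End CenterType.

Theorem theorem3p5 (R : realType) :
  [/\ {in center_sum (Cv_v R) &, forall x y, circ x y \in center_sum (Cv_v R)},
      {in center_sum (Cv_v R) &, forall x y, circ x y = circ y x},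
      {in center_sum (Cv_v R) & &, forall x y z,
         circ x (circ y z) = circ (circ x y) z}
    & exists phi : {linear {malg (Cv R)[{cmonom nat}]} -> hecke_sum (Cv_v R)},
      [/\ injective phi,
          forall z, z \in center_sum (Cv_v R) <-> exists p, phi p = z,
          phi 1 = hecke_inj (1 : hecke (Cv_v R) 0),
          forall p q, phi (p * q) = circ (phi p) (phi q)
        & forall n, phi << ucm n >> = rel_norm1 (Cv_v R) n.+1]].
Proof.
have v0 : Cv_v R != 0 by rewrite /Cv_v tofrac_eq0 polyX_eq0.
have v1 : Cv_v R != 1.
  rewrite /Cv_v -tofrac1 tofrac_eq;
    apply/eqP => /(congr1 (fun p : {poly _} => size p)).
  by rewrite size_polyX size_poly1.
split=> [x y cx cy|x y cx cy|x y z cx cy cz|].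
- exact: circ_center.
- exact: (congr1 (@centers_val _ _ v0 v1)
  (centers_mulC (Centers v0 v1 cx) (Centers v0 v1 cy))).
- exact: (congr1 (@centers_val _ _ v0 v1)
    (centers_mulA (Centers v0 v1 cx) (Centers v0 v1 cy) (Centers v0 v1 cz))).
exists (centers_phi v0 v1); split=> [|z||p q|n].
- apply: raddf_inj => p p0; apply: (centers_eval_eq0 (v0 := v0) (v1 := v1));
  exact: val_inj.
- split=> [cz|[p <-]]; last exact: centersP.
  have [p ep] := centers_eval_surj (Centers v0 v1 cz); exists p.
  exact: (congr1 (@centers_val _ _ v0 v1) ep).
- exact: (congr1 (@centers_val _ _ v0 v1) (rmorph1 (centers_eval v0 v1))).
- exact: (congr1 (@centers_val _ _ v0 v1) (rmorphM (centers_eval v0 v1) p q)).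
- apply: etrans (congr1 (@centers_val _ _ v0 v1) (centers_eval_var v0 v1 n)) _.
  exact/esym/rel_norm1E.
Qed.
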